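(* Let $f:(\mathbb R,0)\to(\mathbb R^m,0)$ be the germ of a quasi-homogeneous curve. Let $a_1,\dots,a_p$ be a quasi-homogeneous basis, of quasi-degrees $\delta_1\le\cdots\le\delta_s<\delta_{s+1}\le\cdots\le\delta_p$, of the space of algebraic restrictions of closed $2$-forms to $f$. Let $a=\sum_{j=s}^p c_ja_j$, where $c_j\in\mathbb R$ for $j=s,\dots,p$ and $c_s\neq 0$. If there exists a quasi-homogeneous vector field $X$ liftable over $f$ such that $\mathcal L_Xa_s=ra_k$ for some $k>s$ and $r\neq 0$, then $a$ is diffeomorphic to $\sum_{j=s}^{k-1}c_ja_j+\sum_{j=k+1}^p b_ja_j$ for some $b_j\in\mathbb R$, $j=k+1,\dots,p$.
   Context: All germs are smooth. A curve-germ $f:(\mathbb R,0)\to(\mathbb R^m,0)$ is quasi-homogeneous if there exist a coordinate $t$ on $(\mathbb R,0)$, coordinates $(x_1,\dots,x_m)$ on $(\mathbb R^m,0)$ and positive integers $(\lambda_1,\dots,\lambda_m)$ (weights) such that $df(t\frac{d}{dt})=E\circ f$, where $E=\sum_{i=1}^m\lambda_ix_i\frac{\partial}{\partial x_i}$. These coordinates and weights are fixed. A germ of a differential form or vector field $\alpha$ is quasi-homogeneous of quasi-degree $\delta$ if $\mathcal L_E\alpha=\delta\alpha$. A germ of a $k$-form vanishes on $f$ if all its coefficients vanish at $f(t)$ for all $t$ near $0$. Germs of $k$-forms $\omega_1,\omega_2$ have the same algebraic restriction to $f$ if $\omega_1-\omega_2=\alpha+d\beta$ with $\alpha$ a $k$-form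 vanishing on $f$ and $\beta$ a $(k-1)$-form vanishing on $f$; the class of $\omega$ is denoted $[\omega]_f$. For $a=[\omega]_f$ let $a^{(r)}=[\omega^{(r)}]_f$, where $\omega^{(r)}$ is the quasi-homogeneous part of quasi-degree $r$ of the Taylor series of $\omega$ (this is well defined); $a$ is quasi-homogeneous of quasi-degree $r$ if $a=a^{(r)}$. The space of algebraic restrictions of closed $2$-forms to $f$ is finite dimensional and admits quasi-homogeneous bases. A germ $X$ of a vector field on $(\mathbb R^m,0)$ is liftable over $f$ if there is a function-germ $g$ on $(\mathbb R,0)$ with $g\,\frac{df}{dt}=X\circ f$. For such $X$, $\mathcal L_X[\omega]_f:=[\mathcal L_X\omega]_f$ is well defined. Two algebraic restrictions $[\omega]_f$ and $[\widetilde\omega]_f$ are diffeomorphic if there exist germs of diffeomorphisms $\Phi$ of $(\mathbb R^m,0)$ and $\phi$ of $(\mathbb R,0)$ such that $\Phi\circ f\circ\phi=f$ and $[\Phi^*\omega]_f=[\widetilde\omega]_f$. *)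

(* Defs.v *)
From HB Require Import structures.
From mathcomp Require Import all_boot all_order all_algebra all_fingroup.
From mathcomp Require Import all_classical all_reals all_analysis.

Set Implicit Arguments.
Unset Strict Implicit.
Unset Printing Implicit Defensive.

Import Order.TTheory GRing.Theory Num.Theory.
Import numFieldNormedType.Exports.

Local Open Scope classical_set_scope.
Local Open Scope ring_scope.

(** A germ at [0] is given by a representative defined on the whole space, and
    statements about germs are required only near [0].  Only the values of a
    representative on a neighbourhood of [0] matter. *)

Section SmoothGerms.
Context {R : realType}.
Implicit Types V W : normedModType R.

Definition iter_derive V W (vs : seq V) (F : V -> W) : V -> W :=
  foldr (fun v (G : V -> W) x => 'D_v G x) F vs.

(** On a finite dimensional [V] this is the existence of a [C^oo]
    representative: the neighbourhood does not depend on the order [size vs]. *)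
Definition smooth_germ V W (F : V -> W) : Prop :=
  \forall x \near (0 : V),
    forall vs : seq V, differentiable (iter_derive vs F) x.

Definition inverse_germs V (F G : V -> V) : Prop :=
  [/\ smooth_germ F, smooth_germ G, F 0 = 0, G 0 = 0 &
      \forall x \near (0 : V), G (F x) = x /\ F (G x) = x].

Definition diffeo_germ V (F : V -> V) : Prop :=
  exists G : V -> V, inverse_germs F G.

End SmoothGerms.

(** [w x I] is the coefficient [w_x (d/dx_(I 0), ..., d/dx_(I (k-1)))];
    [I] ranges over all multi-indices, not only the increasing ones. *)
Definition kform (R : realType) (m k : nat) : Type :=
  'rV[R]_m -> {ffun 'I_k -> 'I_m} -> R.

Section Forms.
Context {R : realType} {m : nat}.
Local Notation Rm := 'rV[R]_m.

Definition basis_vec (i : 'I_m) : Rm := delta_mx 0 i.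

Definition partial (i : 'I_m) (g : Rm -> R) : Rm -> R :=
  fun x => 'D_(basis_vec i) g x.

Definition component (F : Rm -> Rm) (j : 'I_m) : Rm -> R := fun x => F x 0 j.

Definition form_germ k (w : kform R m k) : Prop :=
  (forall I, smooth_germ (fun x => w x I)) /\
  (\forall x \near (0 : Rm), forall (s : 'S_k) (I : {ffun 'I_k -> 'I_m}),
     w x [ffun l => I (s l)] = (-1) ^+ s * w x I).

Definition zero_form k : kform R m k := fun _ _ => 0.

Definition scale_form k (r : R) (w : kform R m k) : kform R m k :=
  fun x I => r * w x I.

Definition add_form k (w1 w2 : kform R m k) : kform R m k :=
  fun x I => w1 x I + w2 x I.

Definition lin_comb k p (P : pred 'I_p) (c : 'I_p -> R)
    (w : 'I_p -> kform R m k) : kform R m k :=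
  fun x I => \sum_(j < p | P j) c j * w j x I.

Definition ext_d k (w : kform R m k) : kform R m k.+1 := fun x I =>
  \sum_(l < k.+1)
    (-1) ^+ l * partial (I l) (fun y => w y [ffun j => I (lift l j)]) x.

Definition pullback k (F : Rm -> Rm) (w : kform R m k) : kform R m k :=
  fun x I =>
  \sum_(J : {ffun 'I_k -> 'I_m})
    (\prod_(l < k) partial (I l) (component F (J l)) x) * w (F x) J.

(** [(L_X w)_I = X(w_I) + sum_l sum_j (d X_j / d x_(I l)) w_(I[l := j])] *)
Definition lie_form k (X : Rm -> Rm) (w : kform R m k) : kform R m k :=
  fun x I =>
  'D_(X x) (fun y => w y I) x +
  \sum_(l < k) \sum_(j < m)
    partial (I l) (component X j) x *
      w x [ffun l' => if l' == l then j else I l'].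

(** [L_X Y = [X, Y]], with components [X(Y_i) - Y(X_i)]. *)
Definition lie_field (X Y : Rm -> Rm) : Rm -> Rm := fun x =>
  'D_(X x) Y x - 'D_(Y x) X x.

Definition closed_form k (w : kform R m k) : Prop :=
  form_germ w /\ (\forall x \near (0 : Rm), forall I, ext_d w x I = 0).

End Forms.

Section AlgebraicRestrictions.
Context {R : realType} {m : nat}.
Local Notation Rm := 'rV[R]_m.

Definition curve_germ (f : R -> Rm) : Prop := smooth_germ f /\ f 0 = 0.

Definition vanishes_on k (f : R -> Rm) (w : kform R m k) : Prop :=
  \forall t \near (0 : R), forall I, w (f t) I = 0.

(** The algebraic restriction [[w]_f] is the class of [w] for this relation;
    it is always handled through a representative [w]. *)
Definition same_restriction k (f : R -> Rm) (w1 w2 : kform R m k.+1) : Prop :=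
  exists (al : kform R m k.+1) (be : kform R m k),
    [/\ form_germ al, form_germ be, vanishes_on f al, vanishes_on f be &
        \forall x \near (0 : Rm), forall I,
          w1 x I - w2 x I = al x I + ext_d be x I].

Definition liftable (f : R -> Rm) (X : Rm -> Rm) : Prop :=
  smooth_germ X /\
  exists g : R -> R, smooth_germ g /\
    \forall t \near (0 : R), g t *: derive1 f t = X (f t).

Definition diffeomorphic_restrictions k (f : R -> Rm)
    (w w' : kform R m k.+1) : Prop :=
  exists (Phi : Rm -> Rm) (phi : R -> R),
    [/\ diffeo_germ Phi, diffeo_germ phi,
        \forall t \near (0 : R), Phi (f (phi t)) = f t &
        same_restriction f (pullback Phi w) w'].

Definition closed2_basis (f : R -> Rm) p (a : 'I_p -> kform R m 2) : Prop :=
  [/\ forall j, closed_form (a j),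
      forall w : kform R m 2, closed_form w ->
        exists c : 'I_p -> R, same_restriction f w (lin_comb predT c a) &
      forall c : 'I_p -> R,
        same_restriction f (lin_comb predT c a) (@zero_form R m 2) ->
        forall j, c j = 0].

End AlgebraicRestrictions.

Section QuasiHomogeneity.
Context {R : realType} {m : nat}.
Local Notation Rm := 'rV[R]_m.

(** [E = sum_i lam_i x_i d/dx_i] in the coordinates [(x_1, ..., x_m) = h],
    where [h'] is inverse to [h]: the field [d/dx_i] at [y] is the [i]-th
    partial derivative of [h'] at [h y]. *)
Definition euler_field (lam : 'I_m -> nat) (h h' : Rm -> Rm) : Rm -> Rm :=
  fun y => 'D_(\row_i ((lam i)%:R * h y 0 i)) h' (h y).

(** [tau] is the coordinate [t] on the line as a function of the standard
    parameter [u], so that [t d/dt = (tau / tau') d/du]. *)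
Definition quasihomogeneous_curve (f : R -> Rm) (tau : R -> R)
    (h h' : Rm -> Rm) (lam : 'I_m -> nat) : Prop :=
  [/\ curve_germ f, diffeo_germ tau, inverse_germs h h',
      forall i, (0 < lam i)%N &
      \forall u \near (0 : R),
        (tau u / derive1 tau u) *: derive1 f u = euler_field lam h h' (f u)].

Definition quasihomogeneous_field (lam : 'I_m -> nat) (h h' : Rm -> Rm)
    (delta : R) (X : Rm -> Rm) : Prop :=
  smooth_germ X /\
  \forall x \near (0 : Rm),
    lie_field (euler_field lam h h') X x = delta *: X x.

Definition taylor_coef (al : 'I_m -> nat) (g : Rm -> R) : R :=
  iter_derive (flatten [seq nseq (al i) (basis_vec i) | i <- enum 'I_m]) g 0 /
    (\prod_(i < m) (al i)`!)%N%:R.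

(** Part of quasi-degree [r] of the Taylor series at [0] in the standard
    coordinates, [dx_i] having quasi-degree [lam i].  When the weights are
    positive, the exponents of the monomials involved are at most [r]. *)
Definition std_quasi_part k (lam : 'I_m -> nat) (r : nat)
    (w : kform R m k) : kform R m k :=
  fun x I =>
    \sum_(al : {ffun 'I_m -> 'I_r.+1} |
           (\sum_(i < m) lam i * al i + \sum_(l < k) lam (I l) == r)%N)
      taylor_coef (fun i => al i) (fun y => w y I) *
      \prod_(i < m) x 0 i ^+ al i.

(** The same in the coordinates [h], with inverse [h']. *)
Definition quasi_part k (lam : 'I_m -> nat) (h h' : Rm -> Rm) (r : nat)
    (w : kform R m k) : kform R m k :=
  pullback h (std_quasi_part lam r (pullback h' w)).

Definition quasihomogeneous_restriction k (f : R -> Rm)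
    (lam : 'I_m -> nat) (h h' : Rm -> Rm) (r : nat)
    (w : kform R m k.+1) : Prop :=
  same_restriction f w (quasi_part lam h h' r w).

End QuasiHomogeneity.

(* Main.v *)
(** In the given coordinates [f t = (A_i t^lam_i)], and a quasi-homogeneous liftable [X]
    of quasi-degree [D] satisfies [X_i (f t) = b lam_i A_i t^(lam_i + D)]. Comparing
    quasi-degrees in [L_X a_s = r a_k] forces [D = delta_k - delta_s > 0].  No flow of [X] is
    needed: with [psi t = t (1 + eps b t^D)], the finite combination
    [Phi_i = sum_(n <= lam_i) kap_(i,n) X^n(x_i)] satisfies [Phi (f t) = f (psi t)] exactly,
    and it is a diffeomorphism because its linear part is unipotent for the weights.

    By Cartan's formula for the Euler field, [a_j = [d eta_j]] with [eta_j] quasi-homogeneous,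
    and the restriction of [d eta] depends only on the one-variable coefficients of [eta] on
    [f]. Expanding those of [Phi^* eta - eta - eps c_s L_X eta_s], [eta = sum c_j eta_j], shows
    that they have no part of quasi-degree at most [delta_k]. Hence [Phi^* a] is
    [a + eps c_s r a_k] up to the [a_j] with [delta_j > delta_k], and
    [eps = - c_k / (c_s r)] removes [a_k]. *)
Require Import Defs.
From HB Require Import structures.
From mathcomp Require Import all_boot all_order all_algebra all_fingroup.
From mathcomp Require Import all_classical all_reals all_analysis.
From mathcomp Require Import ring lra.

Set Implicit Arguments.
Unset Strict Implicit.
Unset Printing Implicit Defensive.

Import Order.TTheory GRing.Theory Num.Theory.
Import numFieldNormedType.Exports.

Local Open Scope classical_set_scope.
Local Open Scope ring_scope.

(** * Smooth functions and germs *)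

(** On the curve [X] is [b t^D] times the Euler field, so [X^n(x_i)] takes at [f t] the value [b^n
    lam_i (lam_i + D) ... (lam_i + (n - 1) D) A_i t^(lam_i + n D)]. The target [f (psi t)] has the
    component [A_i t^lam_i (1 + eps b t^D)^lam_i], a binomial sum of [lam_i + 1] terms. Matching the
    two sums term by term gives the constants [kap] and shows why finitely many iterates suffice.

    The obstacle is that germs are only smooth: a function whose Taylor coefficients on [f] vanish
    need not vanish on [f]. Homogeneous germs escape this because they satisfy an Euler equation,
    whose smooth solutions on the line are exact monomials. For the remainder of the pullback only
    low Taylor coefficients are known. Its restriction is nevertheless a combination of the [a_j],
    since these span, and each coefficient with [delta_j <= delta_k] is shown to vanish by taking a
    quasi-homogeneous part, an operation that preserves vanishing on [f]. Finite dimension thus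
    replaces an estimate of the remainder. *)

Section SmoothOn.
Context {R : realType}.
Implicit Types V W : normedModType R.

(** Derivatives are taken in constant directions, so every order stays in the type [V -> W]. The
    count is shifted: order 0 already asks for differentiability, which makes the sum, product and
    chain rules available at each stage of an induction. *)
Fixpoint Ck V W (U : set V) (n : nat) (F : V -> W) : Prop :=
  (forall x, U x -> differentiable F x) /\
  (if n is n'.+1 then forall v, Ck U n' ('D_v F) else True).

Definition smooth_on V W (U : set V) (F : V -> W) : Prop := forall n, Ck U n F.

Lemma Ck_differentiable V W (U : set V) n (F : V -> W) x :
  Ck U n F -> U x -> differentiable F x.
Proof. by case: n => [|n] [dF _] Ux; exact: dF. Qed.

Lemma CkW V W (U : set V) n (F : V -> W) : Ck U n.+1 F -> Ck U n F.
Proof.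
elim: n F => [|n IH] F; first by move=> [].
by move=> [dF DF]; split=> // v; apply: IH; exact: DF.
Qed.

Lemma Ck_sub V W (U U' : set V) n (F : V -> W) :
  U `<=` U' -> Ck U' n F -> Ck U n F.
Proof.
move=> UU'; elim: n F => [|n IH] F /=.
  by move=> [dF _]; split=> // x /UU'; exact: dF.
by move=> [dF DF]; split=> [x /UU'|v]; [exact: dF|apply: IH; exact: DF].
Qed.

(** An explicit epsilon estimate gives both differentiability and the differential; the inverse
    function theorem delivers its bounds in this form. *)
Lemma differentiable_eps V W (F : V -> W) x (L : {linear V -> W}) :
  continuous L ->
  (forall e, 0 < e -> \forall h \near (0 : V),
    `|F (h + x) - F x - L h| <= e * `|h|) ->
  differentiable F x /\ 'd F x = L :> (V -> W).
Proof.
move=> cL FL.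
have E : F \o shift x = cst (F x) + L +o_ (0 : V) id.
  apply/eqaddoP => e e0; have := FL e e0; apply: filterS => h.
  by rewrite /= opprD addrA.
split; last exact: diff_unique.
apply/diffP => /=.
(* The differential is chosen among the continuous linear maps with the little-o property, so
   exhibiting [L] is enough. *)
apply: (@getPex _ (fun (df : {linear V -> W}) => continuous df /\
  forall y, F y = F (lim (nbhs x)) + df (y - lim (nbhs x))
                  +o_(y \near x) (y - lim (nbhs x)))).
exists L; split=> //; apply: eqaddoEx => y; rewrite lim_id//.
rewrite -[in LHS](subrK x y); have /= -> := congr1 (fun f => f (y - x)) E; congr (_ + _).
rewrite -(comp_centerK x id) -[X in the_littleo _ _ _ X](comp_centerK x).
by rewrite -[_ (y - x)]/((_ \o (center x)) y) -littleo_center0.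
Qed.

Lemma differentiable_epsE V W (F : V -> W) x : differentiable F x ->
  forall e, 0 < e -> \forall h \near (0 : V),
    `|F (h + x) - F x - 'd F x h| <= e * `|h|.
Proof.
move=> /diff_locally /eqaddoP E e /E; apply: filterS => h.
by rewrite /= opprD addrA.
Qed.

Lemma near_eq_differentiable V W (F G : V -> W) x :
  (\near x, F x = G x) -> differentiable F x -> differentiable G x.
Proof.
move=> FG dF; have eFG : F x = G x := nbhs_singleton FG.
apply: (differentiable_eps (diff_continuous dF) _).1 => e e0.
have := differentiable_epsE dF e0.
have : \forall h \near (0 : V), F (h + x) = G (h + x).
  by move: FG; rewrite (near_shift 0 x)/= subr0.
by apply: filterS2 => h; rewrite eFG => ->.
Qed.

Lemma Ck_ext V W (U : set V) n (F G : V -> W) :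
  open U -> (forall x, U x -> F x = G x) -> Ck U n F -> Ck U n G.
Proof.
move=> oU; elim: n F G => [|n IH] F G FG [dF DF].
  split=> // x Ux; apply: near_eq_differentiable (dF _ Ux).
  by apply: filterS (open_nbhs_nbhs (conj oU Ux)).
split=> [x Ux|v].
  apply: near_eq_differentiable (dF _ Ux).
  by apply: filterS (open_nbhs_nbhs (conj oU Ux)).
apply: IH (DF v) => x Ux; apply: near_eq_derive.
by apply: filterS (open_nbhs_nbhs (conj oU Ux)).
Qed.

Lemma smooth_onP V W (U : set V) (F : V -> W) :
  smooth_on U F <->
  forall x, U x -> forall vs, differentiable (iter_derive vs F) x.
Proof.
split=> [sF x Ux vs|sF n].
  elim/last_ind: vs F sF => [|vs v IH] F sF; first exact: (sF 0%N).1.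
  rewrite /iter_derive -cats1 foldr_cat; apply: IH => n.
  exact: (sF n.+1).2.
elim: n F sF => [|n IH] F sF.
  by split=> // x Ux; exact: (sF x Ux [::]).
split=> [x Ux|v]; first exact: (sF x Ux [::]).
by apply: IH => x Ux vs; have := sF x Ux (rcons vs v);
  rewrite /iter_derive -cats1 foldr_cat.
Qed.

Lemma smooth_onD V W (U : set V) (F : V -> W) v :
  smooth_on U F -> smooth_on U ('D_v F).
Proof. by move=> sF n; exact: (sF n.+1).2. Qed.

Lemma smooth_on_differentiable V W (U : set V) (F : V -> W) x :
  smooth_on U F -> U x -> differentiable F x.
Proof. by move=> /(_ 0%N); exact: Ck_differentiable. Qed.

Lemma Ck_cst V W (U : set V) n (w : W) : Ck U n (fun=> w : W).
Proof.
elim: n w => [|n IH] w; first by [].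
split=> // v; suff -> : 'D_v (fun=> w) = (fun=> 0) :> (V -> W) by [].
by apply/funext => x; exact: derive_cst.
Qed.

Lemma CkD V W (U : set V) n (F G : V -> W) :
  open U -> Ck U n F -> Ck U n G -> Ck U n (fun x => F x + G x).
Proof.
move=> oU; elim: n F G => [|n IH] F G [dF DF] [dG DG]; split=> //.
- by move=> x Ux; apply: differentiableD; [exact: dF|exact: dG].
- by move=> x Ux; apply: differentiableD; [exact: dF|exact: dG].
- move=> v; apply: Ck_ext oU _ (IH _ _ (DF v) (DG v)) => x Ux.
  by rewrite deriveD//; apply: diff_derivable; [exact: dF|exact: dG].
Qed.

Lemma CkM V (U : set V) n (F G : V -> R) :
  open U -> Ck U n F -> Ck U n G -> Ck U n (fun x => F x * G x).
Proof.
move=> oU; elim: n F G => [|n IH] F G cF cG; have [dF DF] := cF; have [dG DG] := cG;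
  split=> //.
- by move=> x Ux; apply: differentiableM; [exact: dF|exact: dG].
- by move=> x Ux; apply: differentiableM; [exact: dF|exact: dG].
- move=> v; apply: Ck_ext oU _ (CkD oU (IH _ _ (CkW cF) (DG v)) (IH _ _ (CkW cG) (DF v))).
  by move=> x Ux; rewrite deriveM//; apply: diff_derivable; [exact: dF|exact: dG].
Qed.

Lemma Ck_scaler V W (U : set V) n (F : V -> R) (w : W) :
  open U -> Ck U n F -> Ck U n (fun x => F x *: w).
Proof.
move=> oU; elim: n F => [|n IH] F cF; have [dF DF] := cF; split=> //.
- by move=> x Ux; exact: (differentiableZl _ (dF _ Ux)).
- by move=> x Ux; exact: (differentiableZl _ (dF _ Ux)).
- move=> v; apply: Ck_ext oU _ (IH _ (DF v)) => x Ux.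
  rewrite deriveE; last exact: dF.
  rewrite deriveE; last exact: (differentiableZl _ (dF _ Ux)).
  by rewrite diffZl//; exact: dF.
Qed.

Lemma Ck_sum V W (U : set V) n (I : Type) (r : seq I) (P : pred I) (F : I -> V -> W) :
  open U -> (forall i, P i -> Ck U n (F i)) ->
  Ck U n (fun x => \sum_(i <- r | P i) F i x).
Proof.
move=> oU cF; elim: r => [|i r IH].
  by apply: Ck_ext oU _ (Ck_cst U n (0 : W)) => x _; rewrite big_nil.
case: (boolP (P i)) => Pi.
  by apply: Ck_ext oU _ (CkD oU (cF _ Pi) IH) => x _; rewrite big_cons Pi.
by apply: Ck_ext oU _ IH => x _; rewrite big_cons (negbTE Pi).
Qed.

Lemma Ck_prod V (U : set V) n (I : Type) (r : seq I) (P : pred I) (F : I -> V -> R) :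
  open U -> (forall i, P i -> Ck U n (F i)) ->
  Ck U n (fun x => \prod_(i <- r | P i) F i x).
Proof.
move=> oU cF; elim: r => [|i r IH].
  by apply: Ck_ext oU _ (Ck_cst U n (1 : R)) => x _; rewrite big_nil.
case: (boolP (P i)) => Pi.
  by apply: Ck_ext oU _ (CkM oU (cF _ Pi) IH) => x _; rewrite big_cons Pi.
by apply: Ck_ext oU _ IH => x _; rewrite big_cons (negbTE Pi).
Qed.

Lemma Ck_linear V W (U : set V) n (L : {linear V -> W}) :
  continuous L -> Ck U n L.
Proof.
move=> cL.
have dL x : differentiable L x by exact: linear_differentiable.
case: n => [|n]; first by [].
split=> // v.
suff -> : 'D_v L = (fun=> L v) :> (V -> W) by exact: Ck_cst.
by apply/funext => x; rewrite deriveE// diff_lin.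
Qed.

Lemma CkV V (U : set V) n (F : V -> R) :
  open U -> (forall x, U x -> F x != 0) -> Ck U n F -> Ck U n (fun x => (F x)^-1).
Proof.
move=> oU F0; elim: n => [|n IH] cF; have [dF DF] := cF; split=> //.
- by move=> x Ux; apply: differentiableV; [exact: dF|exact: F0].
- by move=> x Ux; apply: differentiableV; [exact: dF|exact: F0].
- move=> v; have cV := IH (CkW cF).
  apply: Ck_ext oU _ (CkM oU (CkM oU (Ck_cst U n (-1 : R)) (CkM oU cV cV)) (DF v)).
  move=> x Ux; rewrite deriveV ?F0//; last by apply: diff_derivable; exact: dF.
  by rewrite mulN1r -exprVn expr2.
Qed.

End SmoothOn.

(** * Chain rule and symmetry of second derivatives *)

Section ChainRule.
Context {R : realType}.
Implicit Types V W Z : normedModType R.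

Lemma differentiable_lincomp V W Z (L : {linear W -> Z}) (F : V -> W) x v :
  continuous L -> differentiable F x ->
  differentiable (L \o F) x /\ 'D_v (L \o F) x = L ('D_v F x).
Proof.
move=> cL dF; have dL : differentiable L (F x) by exact: linear_differentiable.
have dLF := differentiable_comp dF dL; split=> //.
by rewrite !deriveE// diff_comp//= diff_lin.
Qed.

Lemma Ck_lincomp V W Z (U : set V) n (L : {linear W -> Z}) (F : V -> W) :
  open U -> continuous L -> Ck U n F -> Ck U n (L \o F).
Proof.
move=> oU cL; elim: n F => [|n IH] F [dF DF].
  by split=> // x Ux; exact: (differentiable_lincomp 0 cL (dF x Ux)).1.
split=> [x Ux|v]; first exact: (differentiable_lincomp 0 cL (dF x Ux)).1.
apply: Ck_ext oU _ (IH _ (DF v)) => x Ux.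
by rewrite (differentiable_lincomp v cL (dF x Ux)).2.
Qed.

Lemma rV_coord_linear m (i : 'I_m) :
  exists2 L : {linear 'rV[R]_m -> R}, (fun x : 'rV[R]_m => x 0 i) = L & continuous L.
Proof.
have lin : linear (fun x : 'rV[R]_m => x 0 i) by move=> a u v; rewrite !mxE.
pose LM := GRing.isLinear.Build _ _ _ _ _ lin.
pose L : {linear _ -> _} := HB.pack (fun x : 'rV[R]_m => x 0 i) LM.
by exists L => //; exact: coord_continuous.
Qed.

Lemma Ck_rVP V (U : set V) n m (F : V -> 'rV[R]_m) : open U ->
  Ck U n F <-> forall i, Ck U n (fun x => F x 0 i).
Proof.
move=> oU; split=> [cF i|cF].
  have [L eL cL] := rV_coord_linear i.
  by apply: Ck_ext oU _ (Ck_lincomp oU cL cF) => x _; rewrite /= -eL.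
apply: Ck_ext oU _ (@Ck_sum _ _ _ U n 'I_m _ predT
  (fun i x => F x 0 i *: delta_mx 0 i) oU (fun i _ => Ck_scaler _ oU (cF i))).
by move=> x _; rewrite [RHS]row_sum_delta.
Qed.

Lemma derive_coord V m (F : V -> 'rV[R]_m) x v i : differentiable F x ->
  'D_v (fun y => F y 0 i) x = 'D_v F x 0 i.
Proof.
move=> dF; have [L eL cL] := rV_coord_linear i.
have := (differentiable_lincomp v cL dF).2.
by rewrite -eL.
Qed.

(** A finite system of linear coordinates, so that the chain rule can be written with
    partial derivatives uniformly for the line and for row vectors. *)
Definition coordinates W n (e : 'I_n -> W) (p : 'I_n -> W -> R) : Prop :=
  (forall w, w = \sum_i p i w *: e i) /\
  (forall i, exists2 L : {linear W -> R}, p i = L & continuous L).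

Lemma coordinates_rV m :
  coordinates (fun i : 'I_m => delta_mx 0 i) (fun i (x : 'rV[R]_m) => x 0 i).
Proof.
by split=> [x|i]; [rewrite [LHS]row_sum_delta|exact: rV_coord_linear].
Qed.

Lemma coordinates_line :
  coordinates (fun _ : 'I_1 => 1 : R) (fun _ (x : R) => x).
Proof.
split=> [x|i]; first by rewrite big_ord1 /GRing.scale/= mulr1.
by exists (idfun : {linear R -> R}) => // x; exact: cvg_id.
Qed.

Lemma derive_comp V W Z n (e : 'I_n -> W) p (F : V -> W) (G : W -> Z) x v :
  coordinates e p -> differentiable F x -> differentiable G (F x) ->
  'D_v (G \o F) x = \sum_i p i ('D_v F x) *: 'D_(e i) G (F x).
Proof.
move=> [ep _] dF dG; have dGF := differentiable_comp dF dG.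
rewrite deriveE// diff_comp//= -(deriveE _ dF) [in LHS](ep ('D_v F x)) linear_sum.
by apply: eq_bigr => i _; rewrite linearZ/= -deriveE.
Qed.

Lemma Ck_comp V W n e p k (U : set V) (U' : set W) (F : V -> W) (G : W -> R) :
  @coordinates W n e p -> open U -> (forall x, U x -> U' (F x)) ->
  Ck U k F -> Ck U' k G -> Ck U k (G \o F).
Proof.
move=> ep oU FU; elim: k G => [|k IH] G cF cG; have [dF DF] := cF; have [dG DG] := cG.
  by split=> // x Ux; exact: (differentiable_comp (dF _ Ux) (dG _ (FU _ Ux))).
split=> [x Ux|v]; first by exact: (differentiable_comp (dF _ Ux) (dG _ (FU _ Ux))).
have cD i : Ck U k (fun x => p i ('D_v F x) * 'D_(e i) G (F x)).
  apply: CkM => //; last exact: (IH _ (CkW cF) (DG (e i))).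
  by have [L -> cL] := ep.2 i; exact: (Ck_lincomp oU cL (DF v)).
apply: Ck_ext oU _ (@Ck_sum _ _ _ U k _ _ predT _ oU (fun i _ => cD i)) => x Ux.
by rewrite (derive_comp v ep (dF x Ux) (dG _ (FU _ Ux))).
Qed.

(** The two difference quotients coincide as functions of [h], whatever the regularity of [F]. This
    reduces directional derivatives to the mean value theorem on the line. *)
Lemma derive_line V W (F : V -> W) (u y : V) (r : R) :
  'D_1 (fun t : R => F (t *: u + y)) r = 'D_u F (r *: u + y) /\
  (derivable F (r *: u + y) u -> derivable (fun t : R => F (t *: u + y)) r 1).
Proof.
rewrite /derive /derivable.
suff -> : (fun h : R => h^-1 *: (((fun t : R => F (t *: u + y)) \o shift r) (h *: 1) -
    F (r *: u + y))) = (fun h : R => h^-1 *: ((F \o shift (r *: u + y)) (h *: u) -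
    F (r *: u + y))) by [].
apply/funext => h /=; congr (_ *: (F _ - _)).
by rewrite scalerDl addrA; congr (_ *: _ + _ + _); exact: mulr1.
Qed.

(** The mean value theorem is applied once, in the direction [u], to the increment of [F] by
    [s *: v]. Differentiability of ['D_u F] at the single point [x] then evaluates both terms of the
    resulting derivative. *)
Lemma second_difference V (U : set V) (F : V -> R) (u v x : V) :
  open U -> Ck U 1 F -> U x -> forall e, 0 < e -> exists2 d, 0 < d &
    forall s, 0 < s < d ->
      `|F (s *: u + (s *: v + x)) - F (s *: u + x) - (F (s *: v + x) - F x)
        - s ^+ 2 * 'D_v ('D_u F) x| <= e * s ^+ 2.
Proof.
move=> oU [dF DF] Ux e e0.
have dDu : differentiable ('D_u F) x by exact: (DF u).1.
(* For [0 <= c <= s] the two error terms involve [|c u + s v| + |c u|], at most [s (2 |u| + |v|)];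
   the summand 1 keeps [K] positive. *)
set K := 1 + 2 * `|u| + `|v|.
have K0 : 0 < K by rewrite /K -addrA ltr_pwDl// addr_ge0// mulr_ge0.
have /nbhs_ballP[d0 /= d00 bd0] : \forall h \near (0 : V), U (h + x) /\
    `|'D_u F (h + x) - 'D_u F x - 'd ('D_u F) x h| <= e / K * `|h|.
  near=> h; split; last first.
    by near: h; apply: differentiable_epsE => //; exact: divr_gt0.
  near: h; have : \forall y \near x, U y by exact: open_nbhs_nbhs.
  by rewrite (near_shift 0 x)/= subr0.
exists (d0 / K); first exact: divr_gt0.
move=> s /andP[s0 sd].
have inball a b : 0 <= a <= s -> 0 <= b <= s -> ball (0 : V) d0 (a *: u + b *: v).
  move=> /andP[a0 as_] /andP[b0 bs]; rewrite -ball_normE/= sub0r normrN.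
  apply: le_lt_trans (ler_normD _ _) _; rewrite !normrZ !ger0_norm//.
  move: sd; rewrite ltr_pdivlMr// => /le_lt_trans; apply.
  rewrite /K mulrDr mulrDr mulr1.
  rewrite lerD//; last by rewrite ler_wpM2r.
  rewrite mulrCA ler_wpDl ?(ltW s0)//.
  rewrite mulr2n mulrDl !mul1r ler_wpDl ?mulr_ge0 ?(ltW s0)//.
  by rewrite ler_wpM2r.
have s01 : 0 <= s <= s by rewrite ltW/=.
have s00 : 0 <= (0 : R) <= s by rewrite lexx ltW.
pose phi (t : R) := F (t *: u + (s *: v + x)) - F (t *: u + x).
pose dphi (t : R) := 'D_u F (t *: u + (s *: v + x)) - 'D_u F (t *: u + x).
have phiE t : 0 <= t <= s -> is_derive t 1 phi (dphi t).
  move=> ts; have U1 : U (t *: u + (s *: v + x)) by rewrite addrA; apply: (bd0 _ (inball _ _ ts s01)).1.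
  have U2 : U (t *: u + x).
    by have := (bd0 _ (inball _ _ ts s00)).1; rewrite scale0r addr0.
  apply: is_deriveB; apply: DeriveDef.
  - by apply: (derive_line _ _ _ _).2; apply/diff_derivable/dF.
  - by rewrite (derive_line _ _ _ _).1.
  - by apply: (derive_line _ _ _ _).2; apply/diff_derivable/dF.
  - by rewrite (derive_line _ _ _ _).1.
have [c cs phis] : exists2 c, c \in `]0, s[%R & phi s - phi 0 = dphi c * (s - 0).
  apply: MVT => //.
    by move=> t; rewrite in_itv/= => /andP[t0 ts]; apply: phiE; rewrite !ltW.
  apply: derivable_within_continuous => t; rewrite in_itv/= => ts.
  by have [] := phiE t ts.
have {}cs : 0 <= c <= s by move: cs; rewrite in_itv/= => /andP[t0 ts]; rewrite !ltW.
have -> : F (s *: u + (s *: v + x)) - F (s *: u + x) - (F (s *: v + x) - F x) =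
    phi s - phi 0 by rewrite /phi scale0r !add0r.
have [_ B1] := bd0 _ (inball _ _ cs s01).
have [_] := bd0 _ (inball _ _ cs s00); rewrite scale0r addr0 => B2.
rewrite phis subr0 expr2 -mulrA (mulrC (dphi c)) -mulrBr normrM (gtr0_norm s0).
rewrite mulrCA ler_wpM2l ?(ltW s0)//.
have -> : s * 'D_v ('D_u F) x = 'd ('D_u F) x (c *: u + s *: v) - 'd ('D_u F) x (c *: u).
  by rewrite linearD/= addrAC subrr add0r linearZ/= deriveE.
set X1 := 'D_u F (c *: u + s *: v + x) in B1.
have -> : dphi c - ('d ('D_u F) x (c *: u + s *: v) - 'd ('D_u F) x (c *: u)) =
  (X1 - 'D_u F x - 'd ('D_u F) x (c *: u + s *: v)) -
  ('D_u F (c *: u + x) - 'D_u F x - 'd ('D_u F) x (c *: u)).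
  rewrite /dphi addrA -/X1; ring.
apply: le_trans (ler_normB _ _) _; apply: le_trans (lerD B1 B2) _.
rewrite -mulrDr mulrAC ler_pdivrMr// -mulrA ler_wpM2l ?(ltW e0)//.
have := ler_normD (c *: u) (s *: v); rewrite !normrZ (ger0_norm (andP cs).1) (gtr0_norm s0).
have cu : c * `|u| <= s * `|u| by rewrite ler_wpM2r// (andP cs).2.
move=> h1; rewrite /K mulrDr mulrDr mulr1; lra.
Unshelve. all: by end_near. Qed.

(** The second difference is symmetric in [u] and [v], and each mixed derivative, multiplied by
    [s ^+ 2], approximates it up to [e * s ^+ 2]. *)
Lemma schwarz V (U : set V) (F : V -> R) (u v x : V) :
  open U -> Ck U 1 F -> U x -> 'D_u ('D_v F) x = 'D_v ('D_u F) x.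
Proof.
move=> oU cF Ux; apply/eqP; rewrite -subr_eq0 -normr_le0.
apply/ler_addgt0Pr => e e0; rewrite add0r.
have e2 : 0 < e / 2 by rewrite divr_gt0.
have [d1 d10 H1] := second_difference u v oU cF Ux e2.
have [d2 d20 H2] := second_difference v u oU cF Ux e2.
pose s := Num.min d1 d2 / 2.
have s0 : 0 < s by rewrite divr_gt0// lt_min d10.
have sm : s < Num.min d1 d2.
  by rewrite /s ltr_pdivrMr// ltr_pMr ?ltr1n// lt_min d10.
move: sm; rewrite lt_min => /andP[sd1 sd2].
have {}H1 := H1 s; have {}H2 := H2 s.
rewrite s0 sd1 in H1; rewrite s0 sd2 in H2.
have {}H1 := H1 isT; have {}H2 := H2 isT.
rewrite [s *: v + (s *: u + x)]addrCA in H2.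
set D := F _ - _ - _ in H1.
have E2 : F (s *: u + (s *: v + x)) - F (s *: v + x) - (F (s *: u + x) - F x) = D.
  by rewrite /D; ring.
rewrite E2 in H2.
have s2 : 0 < s ^+ 2 by rewrite exprn_gt0.
rewrite -(ler_pM2l s2) -[X in X * _](ger0_norm (ltW s2)) -normrM mulrBr.
rewrite -(subrKA D) -opprB [X in `|X|]addrC.
apply: le_trans (ler_normB _ _) _; apply: le_trans (lerD H1 H2) _.
by rewrite -mulrDl -splitr mulrC.
Qed.

End ChainRule.

(** * Closure properties of smooth germs *)

Section SmoothGermTheory.
Context {R : realType}.
Implicit Types V W : normedModType R.

Lemma smooth_germP V W (F : V -> W) :
  smooth_germ F <-> exists U : set V, [/\ open U, U 0 & smooth_on U F].
Proof.
split=> [sF|[U [oU U0 /smooth_onP sF]]].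
  exists (interior [set x | forall vs, differentiable (iter_derive vs F) x]).
  split; [exact: open_interior|exact: sF|].
  by apply/smooth_onP => x Ux; exact: interior_subset Ux.
by apply: filterS (open_nbhs_nbhs (conj oU U0)).
Qed.

Lemma near_nbhs V (P : V -> Prop) :
  (\forall x \near (0 : V), P x) -> \forall x \near (0 : V), \forall y \near x, P y.
Proof. by move=> nP; exact: nbhs_interior. Qed.

Lemma near_forall V (I : finType) (P : I -> V -> Prop) :
  (forall i, \forall x \near (0 : V), P i x) -> \forall x \near (0 : V), forall i, P i x.
Proof. by move=> nP; exact: (filter_forall (nbhs_filter (0 : V)) nP). Qed.

Lemma smooth_germ_ext V W (F G : V -> W) :
  (\forall x \near (0 : V), F x = G x) -> smooth_germ F -> smooth_germ G.
Proof.
move=> /near_nbhs FG /smooth_germP[U [oU U0 sF]]; apply/smooth_germP.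
pose U' := U `&` interior [set x | F x = G x].
have oU' : open U' by apply: openI => //; exact: open_interior.
exists U'; split => //; first by split => //; exact: nbhs_singleton FG.
move=> n; apply: Ck_ext oU' _ (Ck_sub _ (sF n)); last by move=> x [].
by move=> x [_]; exact: interior_subset.
Qed.

Lemma smooth_germ_eq V W (F G : V -> W) : F =1 G -> smooth_germ F -> smooth_germ G.
Proof. by move=> /funext ->. Qed.

Lemma near_derive V W (F G : V -> W) v :
  (\forall x \near (0 : V), F x = G x) ->
  \forall x \near (0 : V), 'D_v F x = 'D_v G x.
Proof. by move=> /near_nbhs; apply: filterS => x; exact: near_eq_derive. Qed.

Lemma smooth_germ_differentiable V W (F : V -> W) :
  smooth_germ F -> \forall x \near (0 : V), differentiable F x.
Proof. by apply: filterS => x /(_ [::]). Qed.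

Lemma smooth_germ_derivable V W (F : V -> W) :
  smooth_germ F -> \forall x \near (0 : V), forall v, derivable F x v.
Proof.
by move=> /smooth_germ_differentiable; apply: filterS => x dF v; exact: diff_derivable.
Qed.

Lemma smooth_germ_cvg V W (F : V -> W) (P : W -> Prop) :
  smooth_germ F -> (\forall y \near F 0, P y) -> \forall x \near (0 : V), P (F x).
Proof.
move=> /smooth_germ_differentiable/nbhs_singleton/differentiable_continuous cF nP.
exact: cF.
Qed.

Lemma smooth_germ_cvg0 V W (F : V -> W) (P : W -> Prop) :
  smooth_germ F -> F 0 = 0 -> (\forall y \near (0 : W), P y) ->
  \forall x \near (0 : V), P (F x).
Proof. by move=> sF F0 nP; apply: smooth_germ_cvg => //; rewrite F0. Qed.

Lemma smooth_germ_derive V W (F : V -> W) v : smooth_germ F -> smooth_germ ('D_v F).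
Proof.
move=> /smooth_germP[U [oU U0 sF]]; apply/smooth_germP; exists U; split=> //.
exact: smooth_onD.
Qed.

Lemma smooth_germ_cst V W (w : W) : smooth_germ (fun=> w : W) (V := V).
Proof.
apply/smooth_germP; exists setT; split=> //; first exact: openT.
by move=> n; exact: Ck_cst.
Qed.

Lemma smooth_germ2 V W1 W2 W3 (op : (V -> W1) -> (V -> W2) -> V -> W3) F G :
  (forall U n, open U -> Ck U n F -> Ck U n G -> Ck U n (op F G)) ->
  smooth_germ F -> smooth_germ G -> smooth_germ (op F G).
Proof.
move=> opC /smooth_germP[U [oU U0 sF]] /smooth_germP[U' [oU' U'0 sG]].
have oI : open (U `&` U') by exact: openI.
apply/smooth_germP; exists (U `&` U'); split=> // n.
by apply: opC => //; [apply: Ck_sub (sF n)|apply: Ck_sub (sG n)] => x [].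
Qed.

Lemma smooth_germD V W (F G : V -> W) :
  smooth_germ F -> smooth_germ G -> smooth_germ (fun x => F x + G x).
Proof.
by apply: (smooth_germ2 (op := fun F G x => F x + G x)) => U n; exact: CkD.
Qed.

Lemma smooth_germM V (F G : V -> R) :
  smooth_germ F -> smooth_germ G -> smooth_germ (fun x => F x * G x).
Proof.
by apply: (smooth_germ2 (W1 := R) (W2 := R) (W3 := R) (op := fun (F G : V -> R) x => F x * G x)) => U n; exact: CkM.
Qed.

Lemma smooth_germZ V (c : R) (F : V -> R) :
  smooth_germ F -> smooth_germ (fun x => c * F x).
Proof. by apply: smooth_germM; exact: smooth_germ_cst. Qed.

Lemma smooth_germN V (F : V -> R) : smooth_germ F -> smooth_germ (fun x => - F x).
Proof. by move=> /(smooth_germZ (-1)); apply: smooth_germ_eq => x; rewrite mulN1r. Qed.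

Lemma smooth_germB V (F G : V -> R) :
  smooth_germ F -> smooth_germ G -> smooth_germ (fun x => F x - G x).
Proof. by move=> sF /smooth_germN; exact: smooth_germD. Qed.

Lemma smooth_germ_sum V (I : Type) (r : seq I) (P : pred I) (F : I -> V -> R) :
  (forall i, P i -> smooth_germ (F i)) ->
  smooth_germ (fun x => \sum_(i <- r | P i) F i x).
Proof.
move=> sF; elim: r => [|i r IH].
  by apply: smooth_germ_eq (smooth_germ_cst V (0 : R)) => x; rewrite big_nil.
case: (boolP (P i)) => Pi.
  by apply: smooth_germ_eq (smooth_germD (sF _ Pi) IH) => x; rewrite big_cons Pi.
by apply: smooth_germ_eq IH => x; rewrite big_cons (negbTE Pi).
Qed.

Lemma smooth_germ_prod V (I : Type) (r : seq I) (P : pred I) (F : I -> V -> R) :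
  (forall i, P i -> smooth_germ (F i)) ->
  smooth_germ (fun x => \prod_(i <- r | P i) F i x).
Proof.
move=> sF; elim: r => [|i r IH].
  by apply: smooth_germ_eq (smooth_germ_cst V (1 : R)) => x; rewrite big_nil.
case: (boolP (P i)) => Pi.
  by apply: smooth_germ_eq (smooth_germM (sF _ Pi) IH) => x; rewrite big_cons Pi.
by apply: smooth_germ_eq IH => x; rewrite big_cons (negbTE Pi).
Qed.

Lemma smooth_germX V (F : V -> R) n :
  smooth_germ F -> smooth_germ (fun x => F x ^+ n).
Proof.
move=> sF; elim: n => [|n IH]; first exact: smooth_germ_cst.
by apply: smooth_germ_eq (smooth_germM sF IH) => x; rewrite exprS.
Qed.

Lemma smooth_germ_linear V W (L : {linear V -> W}) : continuous L -> smooth_germ L.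
Proof.
move=> cL; apply/smooth_germP; exists setT; split=> //; first exact: openT.
by move=> n; exact: Ck_linear.
Qed.

Lemma smooth_germ_coord m (i : 'I_m) : smooth_germ (fun x : 'rV[R]_m => x 0 i).
Proof. by have [L -> cL] := @rV_coord_linear R m i; exact: (smooth_germ_linear cL). Qed.

Lemma smooth_germ_rVP V m (F : V -> 'rV[R]_m) :
  smooth_germ F <-> forall i, smooth_germ (fun x => F x 0 i).
Proof.
split=> [/smooth_germP[U [oU U0 sF]] i|sF].
  by apply/smooth_germP; exists U; split=> // n; exact: (Ck_rVP n F oU).1.
set A := [set x | forall i vs, differentiable (iter_derive vs (fun x => F x 0 i)) x].
have nA : nbhs (0 : V) A by apply: filter_forall => i; exact: sF.
have oA : open (interior A) by exact: open_interior.
apply/smooth_germP; exists (interior A); split=> // n; apply/Ck_rVP => // i.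
by move: n; apply/smooth_onP => x /interior_subset.
Qed.

Lemma smooth_germ_comp_coord V W n e p (F : V -> W) (G : W -> R) :
  @coordinates R W n e p -> F 0 = 0 ->
  smooth_germ F -> smooth_germ G -> smooth_germ (G \o F).
Proof.
move=> ep F0 sF /smooth_germP[U' [oU' U'0 sG]].
have nFU : \forall x \near (0 : V), U' (F x).
  by apply: (smooth_germ_cvg0 sF F0); exact: open_nbhs_nbhs.
have /smooth_germP[U [oU U0 {}sF]] := sF.
pose U1 := U `&` interior [set x | U' (F x)].
have oU1 : open U1 by apply: openI => //; exact: open_interior.
apply/smooth_germP; exists U1; split=> // k.
apply: (Ck_comp (U' := U') ep oU1) => //.
- by move=> x [_ /interior_subset].
- by apply: Ck_sub (sF k) => x [].
Qed.

Lemma smooth_germ_comp V m (F : V -> 'rV[R]_m) (G : 'rV[R]_m -> R) :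
  F 0 = 0 -> smooth_germ F -> smooth_germ G -> smooth_germ (G \o F).
Proof. exact: (smooth_germ_comp_coord (coordinates_rV m)). Qed.

Lemma smooth_germ_comp_line V (F : V -> R) (G : R -> R) :
  F 0 = 0 -> smooth_germ F -> smooth_germ G -> smooth_germ (G \o F).
Proof. exact: (smooth_germ_comp_coord (@coordinates_line R)). Qed.

Lemma smooth_germ_comp_rV V m n (F : V -> 'rV[R]_m) (G : 'rV[R]_m -> 'rV[R]_n) :
  F 0 = 0 -> smooth_germ F -> smooth_germ G -> smooth_germ (G \o F).
Proof.
move=> F0 sF /smooth_germ_rVP sG; apply/smooth_germ_rVP => i.
exact: (smooth_germ_comp F0 sF (sG i)).
Qed.

Lemma smooth_germ_comp_curve V n (F : V -> R) (G : R -> 'rV[R]_n) :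
  F 0 = 0 -> smooth_germ F -> smooth_germ G -> smooth_germ (G \o F).
Proof.
move=> F0 sF /smooth_germ_rVP sG; apply/smooth_germ_rVP => i.
exact: (smooth_germ_comp_line F0 sF (sG i)).
Qed.

Lemma near_derive_comp V W m (F : V -> 'rV[R]_m) (G : 'rV[R]_m -> W) v :
  F 0 = 0 -> smooth_germ F -> smooth_germ G ->
  \forall x \near (0 : V), 'D_v (G \o F) x =
    \sum_i 'D_v (fun y => F y 0 i) x *: 'D_(delta_mx 0 i) G (F x).
Proof.
move=> F0 sF sG; have dF := smooth_germ_differentiable sF.
have dG : \forall x \near (0 : V), differentiable G (F x).
  by apply: (smooth_germ_cvg0 sF F0 (P := fun y => differentiable G y)); exact: smooth_germ_differentiable.
near=> x; have dFx : differentiable F x by near: x.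
rewrite (derive_comp v (coordinates_rV m))//; last by near: x.
by apply: eq_bigr => i _; rewrite derive_coord.
Unshelve. all: by end_near. Qed.

Lemma near_derive_comp_line V W (F : V -> R) (G : R -> W) v :
  F 0 = 0 -> smooth_germ F -> smooth_germ G ->
  \forall x \near (0 : V), 'D_v (G \o F) x = 'D_v F x *: 'D_1 G (F x).
Proof.
move=> F0 sF sG; have dF := smooth_germ_differentiable sF.
have dG : \forall x \near (0 : V), differentiable G (F x).
  by apply: (smooth_germ_cvg0 sF F0 (P := fun y => differentiable G y)); exact: smooth_germ_differentiable.
near=> x; have dFx : differentiable F x by near: x.
rewrite (derive_comp v (@coordinates_line R))//; last by near: x.
by rewrite big_ord1.
Unshelve. all: by end_near. Qed.

Lemma near_schwarz V (F : V -> R) u v : smooth_germ F ->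
  \forall x \near (0 : V), 'D_u ('D_v F) x = 'D_v ('D_u F) x.
Proof.
move=> /smooth_germP[U [oU U0 sF]].
by apply: filterS (open_nbhs_nbhs (conj oU U0)) => x; exact: (schwarz u v oU (sF 1%N)).
Qed.

Lemma derive_rV m W (G : 'rV[R]_m -> W) x v : differentiable G x ->
  'D_v G x = \sum_i v 0 i *: 'D_(delta_mx 0 i) G x.
Proof.
move=> dG; rewrite deriveE// [X in 'd G x X](row_sum_delta v) linear_sum.
by apply: eq_bigr => i _; rewrite linearZ/= -deriveE.
Qed.

End SmoothGermTheory.

(** * The inverse function theorem *)

Section InverseFunction.
Context {R : realType} {m : nat}.
Local Notation Rm := 'rV[R]_m.

Lemma contraction_fixpoint (T : Rm -> Rm) (rho : R) : 0 <= rho ->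
  (forall x, `|x| <= rho -> `|T x| <= rho) ->
  (forall x y, `|x| <= rho -> `|y| <= rho -> `|T x - T y| <= 2^-1 * `|x - y|) ->
  exists2 x, `|x| <= rho & x = T x.
Proof.
move=> rho0 Trho Tc.
pose X : completeNormedModType R := HB.pack_for (completeNormedModType R) Rm.
pose U : set X := [set x | `|x| <= rho].
have TU : set_fun U U T by move=> x Ux; exact: Trho.
have cU : closed U.
  suff -> : U = closed_ball_ (fun x => `|x|) (0 : X) rho by exact: closed_closed_ball_.
  by apply/seteqP; split=> x; rewrite /U/closed_ball_/= sub0r normrN.
have ctr : is_contraction (mkfun TU).
  exists (2^-1%:nng); split=> /=; first by rewrite invf_lt1 ?ltr1n.
  by move=> [x y] [Ux Uy] /=; exact: Tc.
have U0 : U !=set0 by exists 0; rewrite /U/= normr0.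
by have [x Ux xT] := banach_fixed_point ctr cU U0; exists x.
Qed.

Lemma continuous_mulmxr n (B : 'M[R]_(m, n)) : continuous (mulmxr B : Rm -> 'rV[R]_n).
Proof.
move=> x; apply: differentiable_continuous; apply: (Ck_differentiable (U := setT) (n := 0)) => //.
apply/Ck_rVP; first exact: openT.
move=> j; apply: Ck_ext openT _ (@Ck_sum _ _ _ setT 0%N _ _ predT
  (fun i (x : Rm) => x 0 i * B i j) openT _).
  by move=> y _; rewrite !mxE.
move=> i _; apply: CkM openT _ (Ck_cst _ _ _).
by have [L -> cL] := @rV_coord_linear R m i; exact: Ck_linear.
Qed.

Lemma norm_rV_le (x : Rm) (e : R) : 0 <= e -> (forall i, `|x 0 i| <= e) -> `|x| <= e.
Proof.
move=> e0 xe; rewrite [leLHS]/Num.norm/= mx_normrE.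
by apply: bigmax_le => // -[i j] _ /=; rewrite ord1.
Qed.

Lemma coord_le_norm (x : Rm) i : `|x 0 i| <= `|x|.
Proof.
rewrite [leRHS]/Num.norm/= mx_normrE.
exact: (le_bigmax _ (fun ij : 'I_1 * 'I_m => `|x ij.1 ij.2|) (0, i)).
Qed.

Lemma near0_norm (P : Rm -> Prop) : (\forall x \near (0 : Rm), P x) ->
  exists2 rho : R, 0 < rho & forall x, `|x| <= rho -> P x.
Proof.
move=> /nbhs_ballP[d /= d0 dP]; exists (d / 2); first exact: divr_gt0.
move=> x xd; apply: dP; rewrite -ball_normE/= sub0r normrN.
by rewrite (le_lt_trans xd)// ltr_pdivrMr// ltr_pMr// ltr1n.
Qed.

Lemma lipschitz_small (H : Rm -> Rm) : smooth_germ H ->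
  (forall i j, 'D_(delta_mx 0 i) (fun y => H y 0 j) 0 = 0) ->
  exists2 rho : R, 0 < rho & forall x y, `|x| <= rho -> `|y| <= rho ->
    `|H x - H y| <= 2^-1 * `|x - y|.
Proof.
(* Summing [m] partial derivatives bounded by [e] gives a Lipschitz constant at most 1/2; [m.+1]
   avoids dividing by zero when [m = 0]. *)
move=> sH DH0; pose e : R := (2 * m.+1%:R)^-1.
have e0 : 0 < e by rewrite invr_gt0 mulr_gt0// ltr0n.
have sHj j : smooth_germ (fun x => H x 0 j) by exact: (smooth_germ_rVP H).1.
have nD (j i : 'I_m) : \forall x \near (0 : Rm),
    (fun x => `|'D_(delta_mx 0 i) (fun y => H y 0 j) x| <= e) x.
  apply: (@smooth_germ_cvg R Rm R ('D_(delta_mx 0 i) (fun y => H y 0 j)) (fun z => `|z| <= e)).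
    exact: (smooth_germ_derive _ (sHj j)).
  rewrite DH0; have := nbhsx_ballx (0 : R) _ e0; apply: filterS => z.
  by rewrite -ball_normE/= sub0r normrN => /ltW.
have nH : \forall x \near (0 : Rm), forall j : 'I_m,
    differentiable (fun y => H y 0 j) x /\
    forall i : 'I_m, `|'D_(delta_mx 0 i) (fun y => H y 0 j) x| <= e.
  apply: (@filter_forall Rm 'I_m (fun j x => differentiable (fun y => H y 0 j) x /\
    forall i : 'I_m, `|'D_(delta_mx 0 i) (fun y => H y 0 j) x| <= e)
    (nbhs (0 : Rm)) (nbhs_filter (0 : Rm))) => j.
  apply: filterI; first exact: (smooth_germ_differentiable (sHj j)).
  exact: (@filter_forall Rm 'I_m
    (fun i x => `|'D_(delta_mx 0 i) (fun y => H y 0 j) x| <= e)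
    (nbhs (0 : Rm)) (nbhs_filter (0 : Rm)) (nD j)).
have [rho rho0 Hrho] := near0_norm nH.
exists rho => // x y xr yr; apply: norm_rV_le; first by rewrite mulr_ge0// invr_ge0.
move=> j; rewrite !mxE; pose phi (t : R) : R := H (t *: (x - y) + y) 0 j.
pose dphi (t : R) : R := 'D_(x - y) (fun y => H y 0 j) (t *: (x - y) + y).
have inr (t : R) : 0 <= t <= 1 -> `|t *: (x - y) + y| <= rho.
  move=> /andP[t0 t1].
  have -> : t *: (x - y) + y = t *: x + (1 - t) *: y.
    by rewrite scalerBr scalerBl scale1r addrAC addrA.
  apply: le_trans (ler_normD _ _) _; rewrite !normrZ (ger0_norm t0) ger0_norm ?subr_ge0//.
  have -> : rho = t * rho + (1 - t) * rho by rewrite -mulrDl subrKC mul1r.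
  by rewrite lerD// ler_wpM2l// subr_ge0.
have phiE (t : R) : 0 <= t <= 1 -> is_derive t 1 phi (dphi t).
  move=> /inr /Hrho /(_ j)[dHt _]; apply: DeriveDef.
    by apply: (@derive_line R Rm R (fun y => H y 0 j) (x - y) y t).2; exact: diff_derivable.
  exact: (@derive_line R Rm R (fun y => H y 0 j) (x - y) y t).1.
have [c c01 phic] : exists2 c, c \in `]0, 1[%R & phi 1 - phi 0 = dphi c * (1 - 0).
  apply: MVT => //.
    by move=> t; rewrite in_itv/= => /andP[t0 t1]; apply: phiE; rewrite !ltW.
  apply: derivable_within_continuous => t; rewrite in_itv/= => ts.
  by have [] := phiE t ts.
have -> : H x 0 j - H y 0 j = phi 1 - phi 0.
  by rewrite /phi scale0r add0r scale1r subrK.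
have {}c01 : 0 <= c <= 1 by move: c01; rewrite in_itv/= => /andP[t0 ts]; rewrite !ltW.
have [dHc Hc] := Hrho _ (inr _ c01) j.
rewrite phic subr0 mulr1 /dphi derive_rV//; apply: le_trans (ler_norm_sum _ _ _) _.
apply: (@le_trans _ _ (\sum_(i < m) `|x - y| * e)).
  by apply: ler_sum => i _; rewrite normrZ ler_pM// coord_le_norm.
rewrite sumr_const card_ord -[leLHS]mulr_natr -mulrA mulrC ler_wpM2r//.
by rewrite /e invfM -mulrA ler_piMr ?invr_ge0// ler_pdivrMl ?ltr0n// mulr1 ler_nat.
Qed.

(** Rows are indexed by directions and columns by components, so the matrix acts on row vectors from
    the right and the chain rule reads [jac (F \o G) x = jac G x *m jac F (G x)]. *)
Definition jac (F : Rm -> Rm) (x : Rm) : 'M[R]_m :=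
  \matrix_(i, j) 'D_(delta_mx 0 i) (fun y => F y 0 j) x.

Lemma derive_jac (F : Rm -> Rm) x v : differentiable F x -> 'D_v F x = v *m jac F x.
Proof.
move=> dF; apply/rowP => j; rewrite -derive_coord// derive_rV; last first.
  have [L eL cL] := @rV_coord_linear R m j.
  by have := (differentiable_lincomp v cL dF).1; rewrite -eL.
by rewrite mxE; apply: eq_bigr => i _; rewrite mxE.
Qed.

Lemma Ck_det (V : normedModType R) (U : set V) k n (A : V -> 'M[R]_n) : open U ->
  (forall i j, Ck U k (fun x => A x i j)) -> Ck U k (fun x => \det (A x)).
Proof.
move=> oU cA; apply: Ck_sum => // s _; apply: CkM => //; first exact: Ck_cst.
by apply: Ck_prod.
Qed.

Lemma Ck_invmx (V : normedModType R) (U : set V) k (A : V -> 'M[R]_m) i j : open U ->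
  (forall x, U x -> \det (A x) != 0) ->
  (forall i j, Ck U k (fun x => A x i j)) -> Ck U k (fun x => invmx (A x) i j).
Proof.
move=> oU dA cA.
have cdet := Ck_det oU cA.
have cadj : Ck U k (fun x => (\adj (A x)) i j).
  have : Ck U k (fun x => (-1) ^+ (j + i) * \det (row' j (col' i (A x)))).
    apply: CkM => //; first exact: Ck_cst.
    apply: Ck_det => // a b.
    by apply: Ck_ext oU _ (cA (lift j a) (lift i b)) => x _; rewrite !mxE.
  by move=> c; apply: Ck_ext oU _ c => x _; rewrite /adjugate mxE.
apply: Ck_ext oU _ (CkM oU (CkV oU dA cdet) cadj) => x Ux.
by rewrite /invmx unitmxE unitfE (dA x Ux) [RHS]mxE.
Qed.

Lemma derive_coord_basis i j (x : Rm) :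
  'D_(delta_mx 0 i) (fun y : Rm => y 0 j) x = (i == j)%:R.
Proof.
rewrite (@derive_coord R Rm m idfun) // derive_id mxE eqxx/= eq_sym//.
Qed.

(** [H = id - F] has zero derivative at 0, hence is 1/2-Lipschitz on a small ball. Then
    [x = y + H x] is a fixed point problem for a contraction, and the same bound makes [F] expand
    distances by at least 1/2, so that the solution is unique and Lipschitz in [y]. *)
Lemma local_inverse_bounds (F : Rm -> Rm) : smooth_germ F -> F 0 = 0 -> jac F 0 = 1%:M ->
  exists rho (G : Rm -> Rm), [/\ 0 < rho,
    forall x : Rm, `|x| <= rho -> \det (jac F x) != 0,
    exists U : set Rm, [/\ open U, (forall x : Rm, `|x| <= rho -> U x) & smooth_on U F],
    forall y : Rm, `|y| <= rho / 2 -> `|G y| <= rho /\ F (G y) = y &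
    forall x x' : Rm, `|x| <= rho -> `|x'| <= rho -> `|x - x'| <= 2 * `|F x - F x'|].
Proof.
move=> sF F0 JF; pose H x := x - F x.
have sH : smooth_germ H.
  apply/smooth_germ_rVP => i.
  have := smooth_germB (smooth_germ_coord i) ((smooth_germ_rVP F).1 sF i).
  by apply: smooth_germ_eq => x; rewrite !mxE.
have [rho1 rho10 H1] : exists2 rho : R, 0 < rho & forall x y, `|x| <= rho -> `|y| <= rho ->
    `|H x - H y| <= 2^-1 * `|x - y|.
  apply: lipschitz_small => // i j.
  have -> : (fun y => H y 0 j) = (fun y : Rm => y 0 j) - (fun y => F y 0 j).
    by apply/funext => y; rewrite !mxE.
  have dF := nbhs_singleton (smooth_germ_differentiable ((smooth_germ_rVP F).1 sF j)).
  rewrite deriveB; first last.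
  - exact: diff_derivable.
  - by apply: diff_derivable; exact: differentiable_coord.
  rewrite derive_coord_basis; have := congr1 (fun A : 'M[R]_m => A i j) JF.
  by rewrite !mxE => ->; rewrite subrr.
have sdet : smooth_germ (fun x => \det (jac F x)).
  apply: smooth_germ_sum => s _; apply: smooth_germM; first exact: smooth_germ_cst.
  apply: smooth_germ_prod => i _.
  apply: smooth_germ_eq (smooth_germ_derive (delta_mx 0 i) ((smooth_germ_rVP F).1 sF (s i))).
  by move=> x; rewrite mxE.
have [U [oU U0 sU]] := (smooth_germP F).1 sF.
have nUd : \forall x \near (0 : Rm), U x /\ \det (jac F x) != 0.
  apply: filterI; first exact: open_nbhs_nbhs.
  apply: (smooth_germ_cvg (P := fun z : R => z != 0) sdet).
  rewrite JF det1; apply: open_nbhs_nbhs; split; first exact: open_neq.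
  exact: oner_neq0.
have [rho2 rho20 H2] := near0_norm nUd.
pose rho := Num.min rho1 rho2.
have rho0 : 0 < rho by rewrite lt_min rho10.
have rho_1 (x : Rm) : `|x| <= rho -> `|x| <= rho1 by rewrite le_min => /andP[].
have rho_2 (x : Rm) : `|x| <= rho -> `|x| <= rho2 by rewrite le_min => /andP[].
have low (x x' : Rm) : `|x| <= rho -> `|x'| <= rho -> `|x - x'| <= 2 * `|F x - F x'|.
  move=> xr xr'; have := H1 x x' (rho_1 _ xr) (rho_1 _ xr').
  have -> : H x - H x' = (x - x') - (F x - F x') by rewrite /H !opprD !opprK addrACA.
  have := lerB_dist (x - x') (F x - F x'); lra.
have ex (y : Rm) : exists x : Rm, `|y| <= rho / 2 -> `|x| <= rho /\ F x = y.
  (* Outside this ball the inverse takes the default value 0; only its germ matters. *)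
  have [yr|] := boolP (`|y| <= rho / 2); last by exists 0.
  have [x xr xy] : exists2 x : Rm, `|x| <= rho & x = y + H x.
    apply: (@contraction_fixpoint (fun x => y + H x)); first exact: ltW.
    - move=> x xr; apply: le_trans (ler_normD _ _) _.
      have r0 : `|0 : Rm| <= rho by rewrite normr0 ltW.
      have := H1 x 0 (rho_1 _ xr) (rho_1 _ r0).
      by rewrite {2}/H F0 !subr0; lra.
    - move=> x x' xr xr'; rewrite opprD addrACA subrr add0r.
      exact: H1 (rho_1 _ xr) (rho_1 _ xr').
  exists x => _; split=> //; move: xy; rewrite /H addrCA => /eqP.
  by rewrite -subr_eq0 opprD addrA subrr add0r opprB subr_eq0 => /eqP.
have [G GP] := choice ex.
exists rho, G; split=> //.
- by move=> x /rho_2/H2[].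
- by exists U; split=> // x /rho_2/H2[].
Qed.

(** The Lipschitz bound on [G] turns the first-order expansion of [F] into one for [G], with the
    inverse matrix as differential. Smoothness is a bootstrap: the derivative of [G] is a smooth
    function of [G], so each order of regularity yields the next. *)
Lemma inverse_function_id (F : Rm -> Rm) : smooth_germ F -> F 0 = 0 -> jac F 0 = 1%:M ->
  diffeo_germ F.
Proof.
move=> sF F0 JF.
have [rho [G [rho0 detF [U [oU UU sU]] GP low]]] := local_inverse_bounds sF F0 JF.
have openb (r : R) : open [set x : Rm | `|x| < r].
  have -> : [set x : Rm | `|x| < r] = ball (0 : Rm) r.
    by apply/seteqP; split=> x; rewrite -ball_normE/= sub0r normrN.
  exact: ball_open.
pose W := [set y : Rm | `|y| < rho / 2]; have oW : open W := openb _.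
pose U' := [set x : Rm | `|x| < rho]; have oU' : open U' := openb _.
have r20 : 0 < rho / 2 by rewrite divr_gt0.
have W0 : W 0 by rewrite /W/= normr0.
have nx0 : `|0 : Rm| <= rho by rewrite normr0 ltW.
have Glow (y y' : Rm) : W y -> W y' -> `|G y - G y'| <= 2 * `|y - y'|.
  move=> Wy Wy'; have [yr yF] := GP _ (ltW Wy); have [yr' yF'] := GP _ (ltW Wy').
  by have := low _ _ yr yr'; rewrite yF yF'.
have G0 : G 0 = 0.
  have [yr yF] := GP _ (ltW W0); have := low _ _ yr nx0.
  by rewrite yF F0 !subr0 normr0 mulr0 normr_le0 => /eqP.
have GU (y : Rm) : W y -> U' (G y).
  move=> Wy; have := Glow _ _ Wy W0; rewrite G0 !subr0 => /le_lt_trans; apply.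
  by rewrite mulrC -ltr_pdivlMr.
have dG (y : Rm) : W y -> differentiable G y /\ forall v, 'D_v G y = v *m invmx (jac F (G y)).
  move=> Wy; set x := G y; have Ux : U x by apply/UU/ltW/GU.
  have dFx : differentiable F x := smooth_on_differentiable sU Ux.
  have uJ : jac F x \in unitmx by rewrite unitmxE unitfE; apply/detF/ltW/GU.
  set B := invmx (jac F x); have cB := @continuous_mulmxr m B.
  have [C C0 BC] := linear_lipschitz cB.
  have [dGy GB] : differentiable G y /\ 'd G y = (mulmxr B) :> (Rm -> Rm).
    apply: differentiable_eps => // e e0.
    (* [C] bounds the operator [B] and 2 is the Lipschitz constant of [G], so an error [e / (2 * C)]
       for [F] becomes an error [e] for [G]. *)
    have e'0 : 0 < e / (2 * C) by rewrite divr_gt0// mulr_gt0.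
    have [r r0 Hr] := near0_norm (differentiable_epsE dFx e'0).
    have nW : \forall k \near (0 : Rm), W (k + y) /\ `|k| <= r / 2.
      apply: filterI.
        have : \forall z \near y, W z by exact: open_nbhs_nbhs.
        by rewrite (near_shift 0 y)/= subr0.
      have := nbhsx_ballx (0 : Rm) (r / 2) _; rewrite divr_gt0// => /(_ isT).
      by apply: filterS => k; rewrite -ball_normE/= sub0r normrN => /ltW.
    apply: filterS nW => k [Wk kr].
    have hk := Glow _ _ Wk Wy; rewrite addrK -/x in hk.
    have hr : `|G (k + y) - x| <= r by move: kr; lra.
    have := Hr _ hr; rewrite subrK (GP _ (ltW Wk)).2 (GP _ (ltW Wy)).2 addrK.
    rewrite -deriveE// derive_jac// => Hk.
    have -> : G (k + y) - G y - mulmxr B k =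
        - (mulmxr B (k - (G (k + y) - x) *m jac F x)).
      by rewrite /= mulmxBl mulmxK// opprB.
    rewrite normrN; apply: le_trans (BC _) _.
    apply: (@le_trans _ _ (C * (e / (2 * C) * (2 * `|k|)))).
      rewrite ler_wpM2l//; first exact: ltW.
      by apply: le_trans Hk _; rewrite ler_wpM2l// ltW.
    by rewrite le_eqVlt; apply/orP; left; apply/eqP; field; rewrite gt_eqF.
  by split=> // v; rewrite deriveE// GB.
have sG : smooth_on W G.
  have sJ k i j : Ck U' k (fun x => invmx (jac F x) i j).
    apply: Ck_invmx => // [x /ltW/detF//|a b].
    have := (Ck_rVP k F oU).1 (sU k) b.
    have := (Ck_rVP k.+1 F oU).1 (sU k.+1) b.
    move=> [_ /(_ (delta_mx 0 a))] cab _.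
    apply: Ck_sub (Ck_ext oU _ cab); first by move=> z /ltW/UU.
    by move=> z _; rewrite mxE.
  elim=> [|k IH]; first by split=> // y /dG[].
  split=> [y /dG[]//|v]; apply/Ck_rVP => // j.
  have cJ i : Ck W k ((fun x => invmx (jac F x) i j) \o G).
    exact: (Ck_comp (coordinates_rV m) oW GU IH (sJ k i j)).
  apply: Ck_ext oW _ (@Ck_sum _ _ _ W k _ _ predT _ oW
    (fun i _ => CkM oW (Ck_cst W k (v 0 i)) (cJ i))).
  by move=> y Wy; rewrite (dG y Wy).2 mxE.
exists G; split=> //; first by apply/smooth_germP; exists W.
have nF : \forall x \near (0 : Rm), W (F x).
  by apply: (smooth_germ_cvg0 sF F0); exact: open_nbhs_nbhs.
have nW : \forall x \near (0 : Rm), W x by exact: open_nbhs_nbhs.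
near=> x; have Wx : W x by near: x.
have WF : W (F x) by near: x.
split; last by have [] := GP _ (ltW Wx).
have [yr yF] := GP _ (ltW WF).
have xr : `|x| <= rho by apply: le_trans (ltW Wx) _; rewrite ler_piMr ?ltW// invf_lt1 ?ltr1n.
have := low _ _ yr xr; rewrite yF subrr normr0 mulr0 normr_le0 subr_eq0 => /eqP //.
Unshelve. all: by end_near. Qed.

End InverseFunction.

(** * Germs of diffeomorphisms *)

Section Diffeomorphisms.
Context {R : realType}.

Lemma smooth_germ_mulmxr m n (B : 'M[R]_(m, n)) : smooth_germ (fun x : 'rV[R]_m => x *m B).
Proof. exact: (@smooth_germ_linear R _ _ (mulmxr B) (@continuous_mulmxr R m n B)). Qed.

(** Composing with the inverse of the linear part reduces to a map tangent to the identity. *)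
Lemma diffeo_germ_of_jac m (F : 'rV[R]_m -> 'rV[R]_m) :
  smooth_germ F -> F 0 = 0 -> jac F 0 \in unitmx -> diffeo_germ F.
Proof.
move=> sF F0 uJ; set A := invmx (jac F 0).
pose F1 x := F x *m A.
have sF1 : smooth_germ F1 := smooth_germ_comp_rV F0 sF (smooth_germ_mulmxr A).
have F10 : F1 0 = 0 by rewrite /F1 F0 mul0mx.
have dF := nbhs_singleton (smooth_germ_differentiable sF).
have [dF1 DF1] : differentiable F1 0 /\ forall v, 'D_v F1 0 = 'D_v F 0 *m A.
  split=> [|v]; first exact: (nbhs_singleton (smooth_germ_differentiable sF1)).
  exact: (@differentiable_lincomp R _ _ _ (mulmxr A) F 0 v (@continuous_mulmxr R m m A) dF).2.
have J1 : jac F1 0 = 1%:M.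
  apply/row_matrixP => i; rewrite !rowE -derive_jac// DF1 derive_jac//.
  by rewrite -mulmxA mulmxV.
have [G1 [_ sG1 _ G10 GF1]] := inverse_function_id sF1 F10 J1.
exists (fun z => G1 (z *m A)); split=> //.
- apply: (@smooth_germ_comp_rV R _ _ _ (mulmxr A) G1) => //; last exact: smooth_germ_mulmxr.
  by rewrite /= mul0mx.
- by rewrite mul0mx.
have GF2 : \forall x \near (0 : 'rV[R]_m), G1 (F1 (x *m A)) = x *m A /\ F1 (G1 (x *m A)) = x *m A.
  by apply: (smooth_germ_cvg0 (smooth_germ_mulmxr A) _ GF1); rewrite mul0mx.
near=> x; split.
  have [+ _] : G1 (F1 x) = x /\ F1 (G1 x) = x by near: x.
  by [].
have [_] : G1 (F1 (x *m A)) = x *m A /\ F1 (G1 (x *m A)) = x *m A by near: x.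
by rewrite {1}/F1 => /(congr1 (mulmxr (jac F 0))) /=; rewrite !mulmxKV.
Unshelve. all: by end_near. Qed.

Lemma smooth_germ_const_mx : smooth_germ (fun t : R => const_mx t : 'rV[R]_1).
Proof.
apply/smooth_germ_rVP => i; apply: smooth_germ_eq (@smooth_germ_linear R R R idfun _).
  by move=> x; rewrite mxE.
by move=> x; exact: cvg_id.
Qed.

Lemma diffeo_germ_line (F : R -> R) :
  smooth_germ F -> F 0 = 0 -> 'D_1 F 0 != 0 -> diffeo_germ F.
Proof.
move=> sF F0 DF0; pose c (t : R) : 'rV[R]_1 := const_mx t.
pose F1 (x : 'rV[R]_1) := c (F (x 0 0)).
have c0 : c 0 = 0 by apply/rowP => i; rewrite !mxE.
have sFx : smooth_germ (fun x : 'rV[R]_1 => F (x 0 0)).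
  apply: (@smooth_germ_comp_line R _ (fun x : 'rV[R]_1 => x 0 0) F) => //.
    by rewrite mxE.
  exact: smooth_germ_coord.
have sF1 : smooth_germ F1.
  apply: (@smooth_germ_comp_curve R _ 1 (fun x : 'rV[R]_1 => F (x 0 0)) c) => //.
    by rewrite mxE.
  exact: smooth_germ_const_mx.
have F10 : F1 0 = 0 by rewrite /F1 mxE F0.
have J1 : jac F1 0 = ('D_1 F 0)%:M.
  apply/matrixP => i j; rewrite !ord1 !mxE eqxx mulr1n.
  have -> : (fun y : 'rV[R]_1 => F1 y 0 0) = F \o (fun y : 'rV[R]_1 => y 0 0).
    by apply/funext => y; rewrite /F1 mxE.
  have := nbhs_singleton (near_derive_comp_line (F := fun y : 'rV[R]_1 => y 0 0)
    (delta_mx 0 0) _ (smooth_germ_coord _) sF).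
  rewrite mxE => -> //; rewrite derive_coord_basis eqxx.
  by rewrite scale1r.
have [|G1 [_ sG1 _ G10 GF1]] := diffeo_germ_of_jac sF1 F10.
  by rewrite J1 unitmxE det_scalar1 unitfE.
exists (fun t => G1 (c t) 0 0); split=> //.
- apply: (@smooth_germ_comp R R 1 c (fun x => G1 x 0 0)) => //.
  + exact: smooth_germ_const_mx.
  + exact: (smooth_germ_rVP G1).1.
- by rewrite c0 G10 mxE.
have := smooth_germ_cvg0 smooth_germ_const_mx c0 GF1; apply: filterS => t [E1 E2]; split.
  by move: E1; rewrite /F1 mxE /c => ->; rewrite mxE.
by move: E2; rewrite /F1 /c => /(congr1 (fun x : 'rV[R]_1 => x 0 0)); rewrite !mxE.
Qed.

(** Smoothness of composites is a hypothesis because it is proved separately for the line and for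
    row vectors; both instances follow. *)
Lemma inverse_germs_comp (V : normedModType R) (F G F' G' : V -> V) :
  (forall A B : V -> V, A 0 = 0 -> smooth_germ A -> smooth_germ B -> smooth_germ (B \o A)) ->
  inverse_germs F G -> inverse_germs F' G' -> inverse_germs (F' \o F) (G \o G').
Proof.
move=> comp [sF sG F0 G0 FG] [sF' sG' F'0 G'0 FG']; split=> //=; try exact: comp.
- by rewrite F0.
- by rewrite G'0.
have FG1 : \forall x \near (0 : V), G' (F' (F x)) = F x /\ F' (G' (F x)) = F x.
  exact: (smooth_germ_cvg0 sF F0 FG').
have FG2 : \forall x \near (0 : V), G (F (G' x)) = G' x /\ F (G (G' x)) = G' x.
  exact: (smooth_germ_cvg0 sG' G'0 FG).
near=> x; have [E1 _] : G' (F' (F x)) = F x /\ F' (G' (F x)) = F x by near: x.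
have [_ E2] : G (F (G' x)) = G' x /\ F (G (G' x)) = G' x by near: x.
have [E3 _] : G (F x) = x /\ F (G x) = x by near: x.
have [_ E4] : G' (F' x) = x /\ F' (G' x) = x by near: x.
by rewrite E1 E2.
Unshelve. all: by end_near. Qed.

Lemma inverse_germs_comp_rV m (F G F' G' : 'rV[R]_m -> 'rV[R]_m) :
  inverse_germs F G -> inverse_germs F' G' -> inverse_germs (F' \o F) (G \o G').
Proof. by apply: inverse_germs_comp => A B; exact: smooth_germ_comp_rV. Qed.

Lemma inverse_germs_comp_line (F G F' G' : R -> R) :
  inverse_germs F G -> inverse_germs F' G' -> inverse_germs (F' \o F) (G \o G').
Proof. by apply: inverse_germs_comp => A B; exact: smooth_germ_comp_line. Qed.

Lemma inverse_germsC (V : normedModType R) (F G : V -> V) :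
  inverse_germs F G -> inverse_germs G F.
Proof.
by move=> [sF sG F0 G0 FG]; split=> //; apply: filterS FG => x [].
Qed.

End Diffeomorphisms.

(** * Functions of one variable *)

Section LineGerms.
Context {R : realType}.
Implicit Types u w : R -> R.

Definition tcoef (n : nat) (u : R -> R) : R :=
  iter n (fun w : R -> R => 'D_1 w) u 0 / n`!%:R.

Lemma smooth_germ_line : smooth_germ (fun t : R => t).
Proof. by apply: (@smooth_germ_linear R R R idfun) => x; exact: cvg_id. Qed.

Lemma smooth_germ_monomial c n : smooth_germ (fun t : R => c * t ^+ n).
Proof. by apply: smooth_germZ; apply: smooth_germX; exact: smooth_germ_line. Qed.

Lemma near0W (V : normedModType R) (P : V -> Prop) :
  (forall x, P x) -> \forall x \near (0 : V), P x.
Proof. exact: nearW. Qed.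

Lemma derive_pow n (t : R) : 'D_1 (fun s : R => s ^+ n) t = n%:R * t ^+ n.-1.
Proof. by rewrite exp_derive /GRing.scale/= mulr1. Qed.

Lemma near_deriveM (V : normedModType R) (F G : V -> R) v :
  smooth_germ F -> smooth_germ G ->
  \forall x \near (0 : V), 'D_v (fun y => F y * G y) x = F x * 'D_v G x + G x * 'D_v F x.
Proof.
move=> /smooth_germ_derivable dF /smooth_germ_derivable dG.
by apply: filterS2 dF dG => x dF dG; rewrite deriveM.
Qed.

Lemma near_deriveD (V W : normedModType R) (F G : V -> W) v :
  smooth_germ F -> smooth_germ G ->
  \forall x \near (0 : V), 'D_v (fun y => F y + G y) x = 'D_v F x + 'D_v G x.
Proof.
move=> /smooth_germ_derivable dF /smooth_germ_derivable dG.
by apply: filterS2 dF dG => x dF dG; rewrite deriveD.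
Qed.

Lemma near_deriveZ (V : normedModType R) (F : V -> R) v c :
  smooth_germ F ->
  \forall x \near (0 : V), 'D_v (fun y => c * F y) x = c * 'D_v F x.
Proof.
move=> sF; have := near_deriveM v (smooth_germ_cst V c) sF.
by apply: filterS => x ->; rewrite derive_cst mulr0 addr0.
Qed.

Lemma near_derive_sum (V : normedModType R) (I : finType) (P : pred I) (F : I -> V -> R) v :
  (forall i, smooth_germ (F i)) ->
  \forall x \near (0 : V), 'D_v (fun y => \sum_(i | P i) F i y) x = \sum_(i | P i) 'D_v (F i) x.
Proof.
move=> sF; elim: (index_enum I) => [|i r IH].
  have -> : (fun y => \sum_(i <- [::] | P i) F i y) = (fun _ : V => 0 : R).
    by apply/funext => y; rewrite big_nil.
  by apply: near0W => x; rewrite big_nil derive_cst.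
case: (boolP (P i)) => Pi; last first.
  have -> : (fun y => \sum_(i <- i :: r | P i) F i y) = (fun y => \sum_(i <- r | P i) F i y).
    by apply/funext => y; rewrite big_cons (negbTE Pi).
  by apply: filterS IH => x ->; rewrite big_cons (negbTE Pi).
have -> : (fun y => \sum_(i <- i :: r | P i) F i y) =
    (fun y => F i y + \sum_(i <- r | P i) F i y).
  by apply/funext => y; rewrite big_cons Pi.
have := near_deriveD v (sF i) (@smooth_germ_sum R V I r P F (fun i _ => sF i)).
by apply: filterS2 IH => x E ->; rewrite big_cons Pi E.
Qed.

Lemma near_iter_derive n u w : (\forall t \near (0 : R), u t = w t) ->
  \forall t \near (0 : R), iter n (fun w : R -> R => 'D_1 w) u t =
     iter n (fun w : R -> R => 'D_1 w) w t.
Proof. by move=> uw; elim: n => //= n IH; exact: near_derive. Qed.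

Lemma tcoef_ext n u w : (\forall t \near (0 : R), u t = w t) -> tcoef n u = tcoef n w.
Proof. by move=> /(near_iter_derive n)/nbhs_singleton E; rewrite /tcoef E. Qed.

Lemma tcoef0 u : tcoef 0 u = u 0.
Proof. by rewrite /tcoef/= divr1. Qed.

Lemma tcoef_derive n u : tcoef n ('D_1 u) = n.+1%:R * tcoef n.+1 u.
Proof.
rewrite /tcoef -iterSr factS natrM invfM mulrCA; congr (_ * _).
by rewrite mulrA mulfV ?mul1r// pnatr_eq0.
Qed.

Lemma tcoefD n u w : smooth_germ u -> smooth_germ w ->
  tcoef n (fun t => u t + w t) = tcoef n u + tcoef n w.
Proof.
elim: n u w => [|n IH] u w su sw; first by rewrite !tcoef0.
apply: (mulfI (_ : n.+1%:R != 0 :> R)); first by rewrite pnatr_eq0.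
rewrite mulrDr -!tcoef_derive -IH; try exact: smooth_germ_derive.
by apply: tcoef_ext; exact: near_deriveD.
Qed.

Lemma tcoefZ n c u : smooth_germ u -> tcoef n (fun t => c * u t) = c * tcoef n u.
Proof.
elim: n u => [|n IH] u su; first by rewrite !tcoef0.
apply: (mulfI (_ : n.+1%:R != 0 :> R)); first by rewrite pnatr_eq0.
rewrite [RHS]mulrCA -!tcoef_derive -IH; last exact: smooth_germ_derive.
by apply: tcoef_ext; exact: near_deriveZ.
Qed.

Lemma tcoef_zero n : tcoef n (fun=> 0) = 0.
Proof.
have := tcoefZ n 0 (@smooth_germ_cst R R R 0).
rewrite [RHS]mul0r => E; rewrite -[RHS]E.
by apply: tcoef_ext; apply: near0W => t; rewrite mul0r.
Qed.

Lemma tcoef_sum n (I : finType) (P : pred I) (F : I -> R -> R) :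
  (forall i, smooth_germ (F i)) ->
  tcoef n (fun t => \sum_(i | P i) F i t) = \sum_(i | P i) tcoef n (F i).
Proof.
move=> sF; elim: (index_enum I) => [|i r IH].
  rewrite big_nil -[RHS](tcoef_zero n); apply: tcoef_ext.
  by apply: near0W => t; rewrite big_nil.
rewrite big_cons; case: (boolP (P i)) => Pi; last first.
  rewrite -IH; apply: tcoef_ext; apply: near0W => t.
  by rewrite big_cons (negbTE Pi).
rewrite -IH -tcoefD//; last by apply: smooth_germ_sum.
by apply: tcoef_ext; apply: near0W => t; rewrite big_cons Pi.
Qed.

Lemma tcoef_mulX n u : smooth_germ u ->
  tcoef n (fun t => t * u t) = if n is n'.+1 then tcoef n' u else 0.
Proof.
elim: n u => [|n IH] u su; first by rewrite tcoef0 mul0r.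
apply: (mulfI (_ : n.+1%:R != 0 :> R)); first by rewrite pnatr_eq0.
rewrite -tcoef_derive; have sDu := smooth_germ_derive (1 : R) su.
have sl := smooth_germ_line.
have -> : tcoef n ('D_1 (fun t : R => t * u t)) = tcoef n (fun t => t * 'D_1 u t + u t).
  apply: tcoef_ext; have := near_deriveM (1 : R) sl su; apply: filterS => t ->.
  by rewrite derive_id mulr1.
rewrite tcoefD//; last exact: smooth_germM.
rewrite IH//; case: n {IH} => [|n]; first by rewrite add0r mul1r.
by rewrite tcoef_derive -[n.+2%:R]natr1 mulrDl mul1r.
Qed.

Lemma tcoef_mulXn n k u : smooth_germ u ->
  tcoef n (fun t => t ^+ k * u t) = if (k <= n)%N then tcoef (n - k) u else 0.
Proof.
move=> su; elim: k n => [|k IH] n.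
  by rewrite subn0; apply: tcoef_ext; apply: near0W => t; rewrite mul1r.
have -> : tcoef n (fun t => t ^+ k.+1 * u t) = tcoef n (fun t => t * (t ^+ k * u t)).
  by apply: tcoef_ext; apply: near0W => t; rewrite exprS mulrA.
rewrite tcoef_mulX; last first.
  by apply: smooth_germM su; apply: smooth_germX; exact: smooth_germ_line.
by case: n => [|n]; rewrite ?ltn0// IH ltnS subSS.
Qed.

Lemma tcoef_monomial n k c : tcoef n (fun t => c * t ^+ k) = c * (n == k)%:R.
Proof.
have -> : tcoef n (fun t => c * t ^+ k) = tcoef n (fun t => t ^+ k * c).
  by apply: tcoef_ext; apply: near0W => t; rewrite mulrC.
rewrite tcoef_mulXn; last exact: smooth_germ_cst.
have tc0 j : tcoef j (fun=> c) = if j is 0%N then c else 0.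
  case: j => [|j]; first by rewrite tcoef0.
  apply: (mulfI (_ : j.+1%:R != 0 :> R)); first by rewrite pnatr_eq0.
  rewrite -tcoef_derive mulr0 -[RHS](tcoef_zero j); apply: tcoef_ext.
  by apply: near0W => t; rewrite derive_cst.
case: ltngtP => [kn|nk|->]; rewrite ?mulr0 ?mulr1 ?subnn ?tc0//.
by rewrite -(subnSK kn).
Qed.

Lemma near_constant u : smooth_germ u -> (\forall t \near (0 : R), 'D_1 u t = 0) ->
  \forall t \near (0 : R), u t = u 0.
Proof.
move=> su Du.
have /nbhs_ballP[d /= d0 Hd] : \forall t \near (0 : R), 'D_1 u t = 0 /\ derivable u t 1.
  by apply: filterI => //; apply: filterS (smooth_germ_derivable su) => t; exact.
have inb (a t : R) : `|a| <= `|t| -> ball (0 : R) d t -> ball (0 : R) d a.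
  by rewrite -!ball_normE/= !sub0r !normrN; exact: le_lt_trans.
have D0 (a : R) : ball (0 : R) d a -> is_derive a 1 u (0 : R).
  by move=> /Hd[E Da]; apply: DeriveDef.
apply/nbhs_ballP; exists d => //= t td.
have aux (a b : R) : a <= b -> (forall c, a <= c <= b -> ball (0 : R) d c) -> u b = u a.
  move=> ab cd.
  have [c _] : exists2 c, c \in `[a, b]%R & u b - u a = (fun=> 0) c * (b - a).
    apply: MVT_segment => // [c|].
      by rewrite in_itv/= => /andP[ac cb]; apply/D0/cd; rewrite !ltW.
    apply: derivable_within_continuous => c; rewrite in_itv/= => /cd/D0[].
    by [].
  by rewrite mul0r => /eqP; rewrite subr_eq0 => /eqP.
have [t0|t0] := leP 0 t.
  apply: aux => // c /andP[c0 ct]; apply: inb td.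
  by rewrite !ger0_norm.
apply/esym; apply: aux; first exact: ltW.
move=> c /andP[tc c0]; apply: inb td.
by rewrite !ler0_norm ?lerN2// ltW.
Qed.

(** Differentiating the equation gives the one of degree [n] for ['D_1 u], whence an induction. The
    conclusion is an exact monomial: the equation excludes flat terms. *)
Lemma euler_line n u : smooth_germ u ->
  (\forall t \near (0 : R), t * 'D_1 u t = n%:R * u t) ->
  exists c, \forall t \near (0 : R), u t = c * t ^+ n.
Proof.
elim: n u => [|n IH] u su E.
  (* At [t = 0] the equation says nothing about the derivative; its value there is recovered as the
     first Taylor coefficient of [t * 'D_1 u t], which vanishes near 0. *)
  exists (u 0); have D0 : \forall t \near (0 : R), 'D_1 u t = 0.
    have D00 : 'D_1 u 0 = 0.
      rewrite -(tcoef0 ('D_1 u)) -(tcoef_mulX 1 (smooth_germ_derive (1 : R) su)).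
      by rewrite -[RHS](tcoef_zero 1); apply: tcoef_ext; apply: filterS E => t ->; rewrite mul0r.
    apply: filterS E => t; rewrite mul0r => /eqP; rewrite mulf_eq0 => /orP[/eqP ->//|/eqP//].
  by apply: filterS (near_constant su D0) => t ->; rewrite mulr1.
have sDu := smooth_germ_derive (1 : R) su.
have [c Hc] : exists c, \forall t \near (0 : R), 'D_1 u t = c * t ^+ n.
  apply: IH => //; have := near_derive (1 : R) E.
  have := near_deriveZ (1 : R) n.+1%:R su; have := near_deriveM (1 : R) smooth_germ_line sDu.
  apply: filterS3 => t -> ->; rewrite derive_id mulr1 -natr1 mulrDl mul1r => /addIr//.
exists (c / n.+1%:R); apply: filterS2 E Hc => t + Ht; rewrite Ht => E.
apply: (mulfI (_ : n.+1%:R != 0 :> R)); first by rewrite pnatr_eq0.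
by rewrite -E exprS [RHS]mulrA (mulrC _ (c / _)) divfK ?pnatr_eq0// mulrCA.
Qed.

(** The degree may be negative. In that case [t ^+ (k - n) * u t] solves the equation of degree 0,
    so it is constant, and it vanishes at 0. The clause [c = 0] keeps the formula correct when the
    subtraction of naturals is truncated. *)
Lemma euler_line_sub n k u : smooth_germ u ->
  (\forall t \near (0 : R), t * 'D_1 u t = (n%:R - k%:R) * u t) ->
  exists2 c, \forall t \near (0 : R), u t = c * t ^+ (n - k) & ((n < k)%N -> c = 0).
Proof.
move=> su E; have [kn|nk] := leqP k n.
  have [c Hc] : exists c, \forall t \near (0 : R), u t = c * t ^+ (n - k).
    by apply: euler_line => //; rewrite natrB.
  by exists c => //; rewrite ltnNge kn.
exists 0 => //; set j := (k - n)%N.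
have j0 : (0 < j)%N by rewrite subn_gt0.
have sp : smooth_germ (fun t : R => t ^+ j).
  by apply: smooth_germX; exact: smooth_germ_line.
have sw := smooth_germM sp su.
have [c Hc] : exists c, \forall t \near (0 : R), t ^+ j * u t = c * t ^+ 0.
  apply: (euler_line (n := 0)) => //.
  have := near_deriveM (1 : R) sp su; apply: filterS2 E => t E ->.
  rewrite mul0r derive_pow.
  have -> : t * (t ^+ j * 'D_1 u t + u t * (j%:R * t ^+ j.-1)) =
      t ^+ j * (t * 'D_1 u t) + j%:R * u t * (t * t ^+ j.-1).
    by set D := 'D_1 u t; ring.
  rewrite E -exprS prednK// /j natrB; last exact: ltnW.
  by ring.
have c0 : c = 0.
  by have := nbhs_singleton Hc; rewrite expr0n (gtn_eqF j0) mul0r mulr1 => <-.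
apply: filterS2 E Hc => t E; rewrite c0 !mul0r => /eqP.
rewrite mulf_eq0 expf_eq0 j0/= => /orP[/eqP t0|/eqP//]; move: E.
rewrite t0 mul0r => /esym/eqP; rewrite mulf_eq0 subr_eq0 eqr_nat.
by rewrite (ltn_eqF nk) => /eqP.
Qed.

End LineGerms.

(** * Taylor coefficients and weights *)

Section IteratedDerivatives.
Context {R : realType}.
Implicit Types V W : normedModType R.

Lemma near_iter_derive_eq V W (F G : V -> W) vs : (\forall x \near (0 : V), F x = G x) ->
  \forall x \near (0 : V), iter_derive vs F x = iter_derive vs G x.
Proof. by move=> FG; elim: vs => //= v vs IH; exact: near_derive. Qed.

Lemma smooth_germ_iter_derive V W (F : V -> W) vs :
  smooth_germ F -> smooth_germ (iter_derive vs F).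
Proof. by move=> sF; elim: vs => //= v vs IH; exact: (smooth_germ_derive v IH). Qed.

Lemma iter_derive_cat V W (F : V -> W) vs ws :
  iter_derive (vs ++ ws) F = iter_derive vs (iter_derive ws F).
Proof. by rewrite /iter_derive foldr_cat. Qed.

Lemma iter_derive_rcons V (F : V -> R) vs v : smooth_germ F ->
  \forall x \near (0 : V), iter_derive (rcons vs v) F x = iter_derive (v :: vs) F x.
Proof.
move=> sF; elim: vs => [|w vs IH]; first exact: near0W.
have := near_schwarz w v (smooth_germ_iter_derive vs sF).
by apply: filterS2 (near_derive w IH) => x /= -> ->.
Qed.

Lemma iter_derive_perm V (F : V -> R) vs ws : smooth_germ F -> perm_eq vs ws ->
  \forall x \near (0 : V), iter_derive vs F x = iter_derive ws F x.
Proof.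
move=> sF; elim: vs ws => [|v vs IH] ws.
  by move/perm_size => /esym/eqP; rewrite size_eq0 => /eqP ->; exact: near0W.
move=> vws; have vw : v \in ws by rewrite -(perm_mem vws) inE eqxx.
case/splitPr: vw vws => w1 w2 vws.
have {}vws : perm_eq vs (w1 ++ w2).
  by move: vws; rewrite perm_sym -cat1s perm_catCA/= perm_cons perm_sym.
have := near_derive v (IH _ vws).
have := iter_derive_rcons w1 v (smooth_germ_iter_derive w2 sF).
apply: filterS2 => x E1 E2.
rewrite -cat_rcons iter_derive_cat E1 [LHS]E2 /=.
by rewrite iter_derive_cat.
Qed.

End IteratedDerivatives.

Section TaylorCoefficients.
Context {R : realType} {m : nat}.
Local Notation Rm := 'rV[R]_m.
Implicit Types (al : 'I_m -> nat) (g : Rm -> R).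

Lemma taylor_coef_ext al be g g' : al =1 be -> (\forall x \near (0 : Rm), g x = g' x) ->
  taylor_coef al g = taylor_coef be g'.
Proof.
move=> /funext -> gg'; rewrite /taylor_coef.
by rewrite (nbhs_singleton (near_iter_derive_eq _ gg')).
Qed.

Lemma taylor_coef0 g : taylor_coef (fun=> 0%N) g = g 0.
Proof.
rewrite /taylor_coef big1// divr1.
by rewrite (_ : flatten _ = [::])//; elim: (enum 'I_m).
Qed.

Lemma taylor_coef_lin al g g' (a b : R) : smooth_germ g -> smooth_germ g' ->
  taylor_coef al (fun x => a * g x + b * g' x) = a * taylor_coef al g + b * taylor_coef al g'.
Proof.
move=> sg sg'; rewrite /taylor_coef !mulrA -mulrDl; congr (_ / _).
move: (flatten _) => vs.
suff E : \forall x \near (0 : Rm), iter_derive vs (fun x => a * g x + b * g' x) x =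
    a * iter_derive vs g x + b * iter_derive vs g' x by exact: nbhs_singleton E.
elim: vs => [|v vs IH]; first exact: near0W.
have s1 := smooth_germ_iter_derive vs sg; have s2 := smooth_germ_iter_derive vs sg'.
have E : \forall x \near (0 : Rm),
    'D_v (fun y => a * iter_derive vs g y + b * iter_derive vs g' y) x =
    a * 'D_v (iter_derive vs g) x + b * 'D_v (iter_derive vs g') x.
  have := near_deriveD v (smooth_germZ a s1) (smooth_germZ b s2).
  have := near_deriveZ v a s1; have := near_deriveZ v b s2.
  by apply: filterS3 => x -> -> ->.
by apply: filterS2 (near_derive v IH) E => x /= -> ->.
Qed.

Lemma taylor_coef_partial al i g : smooth_germ g ->
  taylor_coef al (partial i g) =
  (al i).+1%:R * taylor_coef (fun j => al j + (j == i))%N g.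
Proof.
move=> sg; rewrite /taylor_coef.
have FE : (\prod_(j < m) (al j + (j == i))`! = (al i).+1 * \prod_(j < m) (al j)`!)%N.
  rewrite (bigD1 i)//= [in RHS](bigD1 i)//= eqxx addn1 factS mulnA; congr (_ * _)%N.
  by apply: eq_bigr => j /negbTE ->; rewrite addn0.
rewrite FE natrM invfM [RHS]mulrCA [X in _ = _ * X]mulrA mulfV ?pnatr_eq0// mul1r; congr (_ / _).
rewrite -[partial i g]/(iter_derive [:: basis_vec i] g) -iter_derive_cat.
set vs := _ ++ _; set ws := flatten _.
suff P : perm_eq vs ws by exact: (nbhs_singleton (iter_derive_perm sg P)).
rewrite {}/vs {}/ws.
(* Partial derivatives commute, so it is enough that each direction occurs equally often in the two
   lists. *)
apply/seq.permP => p; rewrite count_cat !count_flatten -!map_comp !sumnE !big_map.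
rewrite -enumT !big_enum/= addn0.
rewrite (eq_bigr _ (fun j _ => count_nseq p (al j) (basis_vec j))).
rewrite [RHS](eq_bigr (fun j => p (basis_vec j) * al j + p (basis_vec j) * (j == i)))%N; last first.
  by move=> j _; rewrite /= count_nseq mulnDr.
rewrite [RHS]big_split/=; congr (_ + _)%N.
rewrite (bigD1 i)//= eqxx muln1 big1 ?addn0// => j /negbTE ->.
by rewrite muln0.
Qed.

End TaylorCoefficients.

Lemma is_derive_bigsum (R : realType) (V : normedModType R) (I : Type) (s : seq I)
    (P : pred I) (F dF : I -> V -> R) x v :
  (forall i, P i -> is_derive x v (F i) (dF i x)) ->
  is_derive x v (fun y => \sum_(i <- s | P i) F i y) (\sum_(i <- s | P i) dF i x).
Proof.
move=> FdF; elim: s => [|i s IH].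
  rewrite big_nil (_ : (fun y => _) = fun=> 0); first exact: is_derive_cst.
  by apply/funext => y; rewrite big_nil.
rewrite big_cons; case: (boolP (P i)) => Pi.
  rewrite (_ : (fun y => _) = F i + fun y => \sum_(i <- s | P i) F i y).
    by apply: is_deriveD => //; exact: FdF.
  by apply/funext => y; rewrite big_cons Pi.
rewrite (_ : (fun y => _) = fun y => \sum_(i <- s | P i) F i y)//.
by apply/funext => y; rewrite big_cons (negbTE Pi).
Qed.

(** * Weighted-homogeneous parts of Taylor series *)

Section WeightedParts.
Context {R : realType} {m : nat}.
Local Notation Rm := 'rV[R]_m.
Implicit Types (g : Rm -> R) (x : Rm).
Variable lam : 'I_m -> nat.
Hypothesis lam_gt0 : forall i, (0 < lam i)%N.

Definition monom (al : 'I_m -> nat) (x : Rm) : R := \prod_(i < m) x 0 i ^+ al i.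

Lemma smooth_germ_monom al : smooth_germ (monom al).
Proof.
by apply: smooth_germ_prod => i _; apply: smooth_germX; exact: smooth_germ_coord.
Qed.

(** On the line through [x] in the direction [j] the monomial is a constant times a power of one
    variable. *)
Lemma is_derive_monom al j (x : Rm) :
  is_derive x (basis_vec j) (monom al)
    ((al j)%:R * x 0 j ^+ (al j).-1 * \prod_(i < m | i != j) x 0 i ^+ al i).
Proof.
set C := \prod_(i < m | i != j) x 0 i ^+ al i.
have E : (fun t : R => monom al (t *: basis_vec j + x)) =
    (C \o* (fun t : R => (t *: 1 + x 0 j) ^+ al j)).
  apply/funext => t; rewrite /monom (bigD1 j)//= !mxE !eqxx; congr (_ * _).
  by apply: eq_bigr => i ij; rewrite !mxE eqxx (negbTE ij) mulr0 add0r.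
have [D1 D2] := derive_line (monom al) (basis_vec j) x 0.
rewrite scale0r add0r E in D1 D2.
apply: DeriveDef.
  apply: diff_derivable; apply: (Ck_differentiable (U := setT) (n := 0)) => //.
  apply: Ck_prod; first exact: openT.
  move=> i _; elim: (al i) => [|n IH].
    by apply: Ck_ext openT _ (Ck_cst setT 0 (1 : R)) => y _; rewrite expr0.
  have [L eL cL] := @rV_coord_linear R m i.
  have cc : Ck setT 0 (fun y : Rm => y 0 i) by rewrite eL; exact: Ck_linear.
  by apply: Ck_ext openT _ (CkM openT cc IH) => y _; rewrite exprS.
have [P1 P2] := derive_line (fun y : R => y ^+ al j) 1 (x 0 j) 0.
rewrite scale0r add0r in P1 P2.
have dP : derivable (fun y : R => y ^+ al j) (x 0 j) 1 by exact: exprn_derivable.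
rewrite -D1 deriveMr; last exact: P2.
by rewrite P1 derive_pow mulrC.
Qed.

Lemma partial_monom al j (x : Rm) : partial j (monom al) x =
  (al j)%:R * x 0 j ^+ (al j).-1 * \prod_(i < m | i != j) x 0 i ^+ al i.
Proof. by have [_ <-] := is_derive_monom al j x. Qed.

Lemma coord_partial_monom al j (x : Rm) :
  x 0 j * partial j (monom al) x = (al j)%:R * monom al x.
Proof.
rewrite partial_monom /monom [in RHS](bigD1 j)//=.
case: (al j) => [|n]; first by rewrite !mul0r mulr0.
by rewrite !mulrA exprS; congr (_ * _); rewrite [in RHS]mulrA [x 0 j * _]mulrC.
Qed.

Lemma partial_monomS al j (x : Rm) :
  partial j (monom (fun i => al i + (i == j))%N) x = (al j).+1%:R * monom al x.
Proof.
rewrite partial_monom eqxx addn1/= /monom [in RHS](bigD1 j)//= mulrA; congr (_ * _).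
by apply: eq_bigr => i /negbTE ->; rewrite addn0.
Qed.

(** Here [c] is the weight of the differentials that [g] multiplies, so this is the part of degree
    [r - c] of the function [g]. Keeping [r] and [c] apart leaves the range of the exponents
    unchanged under differentiation, which only increases [c]. *)
Definition qpart (r c : nat) (g : Rm -> R) (x : Rm) : R :=
  \sum_(al : {ffun 'I_m -> 'I_r.+1} | (\sum_(i < m) lam i * al i + c == r)%N)
    taylor_coef (fun i => al i) g * monom (fun i => al i) x.

Lemma std_quasi_partE k r (w : kform R m k) x I :
  std_quasi_part lam r w x I = qpart r (\sum_(l < k) lam (I l))%N (fun y => w y I) x.
Proof. by []. Qed.

Lemma smooth_germ_qpart r c g : smooth_germ (qpart r c g).
Proof.
apply: smooth_germ_sum => al _; apply: smooth_germZ; exact: smooth_germ_monom.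
Qed.

Lemma qpart_ext r c g g' x : (\forall y \near (0 : Rm), g y = g' y) ->
  qpart r c g x = qpart r c g' x.
Proof.
by move=> gg'; apply: eq_bigr => al _; congr (_ * _); exact: taylor_coef_ext.
Qed.

Lemma qpart_lin r c g g' a b x : smooth_germ g -> smooth_germ g' ->
  qpart r c (fun y => a * g y + b * g' y) x = a * qpart r c g x + b * qpart r c g' x.
Proof.
move=> sg sg'; rewrite /qpart !mulr_sumr -big_split; apply: eq_bigr => al _ /=.
by rewrite taylor_coef_lin// mulrDl !mulrA.
Qed.

Lemma partial_qpart_sum r c g j x : partial j (qpart r c g) x =
  \sum_(al : {ffun 'I_m -> 'I_r.+1} | (\sum_(i < m) lam i * al i + c == r)%N)
    taylor_coef (fun i => al i) g * partial j (monom (fun i => al i)) x.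
Proof.
have H : is_derive x (basis_vec j) (qpart r c g)
  (\sum_(al : {ffun 'I_m -> 'I_r.+1} | (\sum_(i < m) lam i * al i + c == r)%N)
    taylor_coef (fun i => al i) g * partial j (monom (fun i => al i)) x).
  apply: (@is_derive_bigsum R Rm _ _ _
    (fun (al : {ffun 'I_m -> 'I_r.+1}) x => taylor_coef (fun i => al i) g * monom (fun i => al i) x)
    (fun (al : {ffun 'I_m -> 'I_r.+1}) x =>
    taylor_coef (fun i => al i) g * partial j (monom (fun i => al i)) x)) => al _.
  have [dm _] := is_derive_monom (fun i => al i) j x.
  have := is_deriveZ (taylor_coef (fun i => al i) g) (derivableP dm).
  by [].
by have [_ <-] := H.
Qed.

(** Monomials are eigenvectors of the Euler field for their weight, and those in the sum all have
    weight [r - c]. *)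
Lemma qpart_euler r c g x :
  \sum_(i < m) (lam i)%:R * x 0 i * partial i (qpart r c g) x =
  (r%:R - c%:R) * qpart r c g x.
Proof.
under eq_bigr do rewrite partial_qpart_sum mulr_sumr.
rewrite exchange_big /= /qpart mulr_sumr; apply: eq_bigr => al /eqP al_r.
have -> : r%:R - c%:R = \sum_(i < m) (lam i * al i)%:R :> R.
  by rewrite -natr_sum -[in LHS]al_r natrD addrK.
rewrite mulrCA mulr_suml mulr_sumr; apply: eq_bigr => i _.
set T := taylor_coef _ _; move: T => T.
rewrite [LHS]mulrCA natrM -!mulrA; congr (_ * (_ * _)).
exact: coord_partial_monom.
Qed.

(** Differentiation lowers the exponent of [x_j] by one; the sum is reindexed by this shift, and the
    coefficients agree by [taylor_coef_partial]. *)
Lemma partial_qpart r c g j x : smooth_germ g ->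
  partial j (qpart r c g) x = qpart r (c + lam j)%N (partial j g) x.
Proof.
move=> sg; rewrite partial_qpart_sum.
pose up (be : {ffun 'I_m -> 'I_r.+1}) : {ffun 'I_m -> 'I_r.+1} :=
  [ffun i => inord (be i + (i == j))].
pose dn (al : {ffun 'I_m -> 'I_r.+1}) : {ffun 'I_m -> 'I_r.+1} :=
  [ffun i => inord (al i - (i == j))].
(* Monomials free of [x_j] have zero derivative; on the others [up] and [dn] are inverse to each
   other. *)
rewrite (bigID (fun al : {ffun 'I_m -> 'I_r.+1} => al j == 0 :> nat))/= big1 ?add0r; last first.
  by move=> al /andP[_ /eqP alj]; rewrite partial_monom alj !mul0r mulr0.
have dnE al i : dn al i = (al i - (i == j))%N :> nat.
  by rewrite ffunE inordK// (leq_ltn_trans (leq_subr _ _)).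
(* The raised exponent stays within ['I_r.+1]: since [lam j] is positive, [be j + 1] is at most
   [lam j * be j + lam j], hence at most [r]. *)
have upE (be : {ffun 'I_m -> 'I_r.+1}) i :
    (\sum_(i < m) lam i * be i + (c + lam j) == r)%N -> up be i = (be i + (i == j))%N :> nat.
  move=> /eqP be_r; rewrite ffunE inordK// ltnS.
  have [->|_] := eqVneq i j; last by rewrite addn0 -ltnS.
  rewrite -[X in (_ <= X)%N]be_r (bigD1 j)//= addn1 -addnA.
  apply: (@leq_trans (lam j * be j + lam j)); last first.
    by rewrite leq_add2l addnA leq_addl.
  by rewrite -mulnSr leq_pmull.
have weight (al be : 'I_m -> nat) : (forall i, al i = be i + (i == j))%N ->
    (\sum_(i < m) lam i * al i = \sum_(i < m) lam i * be i + lam j)%N.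
  move=> ab; rewrite (eq_bigr (fun i => lam i * be i + lam i * (i == j)))%N; last first.
    by move=> i _; rewrite ab mulnDr.
  rewrite big_split/=; congr (_ + _)%N.
  by rewrite (bigD1 j)//= eqxx muln1 big1 ?addn0// => i /negbTE ->; rewrite muln0.
rewrite (reindex_onto up dn); last first.
  move=> al /andP[_ alj]; apply/ffunP => i; apply/val_inj.
  rewrite /= ffunE inordK dnE; first last.
    have [->|_] := eqVneq i j; last by rewrite subn0 addn0.
    by rewrite subnK// lt0n.
  have [->|_] := eqVneq i j; last by rewrite subn0 addn0.
  by rewrite subnK// lt0n.
rewrite /qpart; apply: eq_big => [be|be].
  apply/idP/idP.
    move=> /andP[/andP[/eqP w upj] /eqP dnup].
    have e i : up be i = (be i + (i == j))%N :> nat.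
      have := congr1 (fun h : {ffun 'I_m -> 'I_r.+1} => h i : nat) dnup.
      rewrite dnE => <-; rewrite subnK//.
      by have [->|//] := eqVneq i j; rewrite lt0n.
    by apply/eqP; rewrite addnA addnAC -(weight _ _ e).
  move=> w; have e i := upE be i w.
  rewrite (weight _ _ e) -addnA [(lam j + c)%N]addnC w/= e eqxx addn1/=.
  by apply/eqP/ffunP => i; apply/val_inj; rewrite /= dnE e addnK.
move=> /andP[/andP[/eqP w upj] /eqP dnup].
have e i : up be i = (be i + (i == j))%N :> nat.
  have := congr1 (fun h : {ffun 'I_m -> 'I_r.+1} => h i : nat) dnup.
  rewrite dnE => <-; rewrite subnK//.
  by have [->|//] := eqVneq i j; rewrite lt0n.
have -> : (fun i => up be i : nat) = (fun i => be i + (i == j))%N by apply/funext => i.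
by rewrite partial_monomS taylor_coef_partial// mulrCA mulrA.
Qed.

Lemma qpart_gt r c g x : (r < c)%N -> qpart r c g x = 0.
Proof.
move=> rc; rewrite /qpart big_pred0// => al; apply: contraTF rc => /eqP <-.
by rewrite -leqNgt leq_addl.
Qed.

Lemma qpart_diag r g x : qpart r r g x = g 0.
Proof.
rewrite /qpart (bigD1 [ffun=> ord0])/=; last first.
  rewrite big1 ?add0n ?eqxx// => i _; rewrite ffunE; exact: muln0.
rewrite [X in _ + X]big1 ?addr0; last first.
  move=> al /andP[/eqP w /eqP al0]; case: al0.
  apply/ffunP => i; rewrite ffunE; apply/val_inj => /=; apply/eqP.
  move: w => /(congr1 (subn^~ r)); rewrite addnK subnn => /eqP.
  rewrite sum_nat_eq0 => /forallP/(_ i)/=.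
  by rewrite muln_eq0 (gtn_eqF (lam_gt0 i)).
have -> : (fun i => ([ffun=> ord0] : {ffun 'I_m -> 'I_r.+1}) i : nat) = fun=> 0%N.
  by apply/funext => i; rewrite ffunE.
by rewrite taylor_coef0 /monom big1 ?mulr1.
Qed.

End WeightedParts.

(** * The Euler equation with weights *)

Section WeightedHomogeneity.
Context {R : realType} {m : nat}.
Local Notation Rm := 'rV[R]_m.
Implicit Types (g q : Rm -> R) (x : Rm).
Variable lam : 'I_m -> nat.

(** The degree is real: the degree of a quasi-homogeneous field is a priori any real number, and
    degrees of coefficients of forms may be negative. *)
Definition whomogeneous (e : R) (q : Rm -> R) : Prop := smooth_germ q /\
  \forall x \near (0 : Rm), \sum_(i < m) (lam i)%:R * (x : Rm) 0 i * partial i q x = e * q x.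

Lemma sum_delta (u l : 'I_m -> R) j : \sum_(i < m) u i * (l i * (i == j)%:R) = l j * u j.
Proof.
rewrite (bigD1 j)//= big1 ?addr0 ?eqxx ?mulr1 1?mulrC// => i /negbTE ->.
by rewrite !mulr0.
Qed.

Lemma smooth_germ_partial i g : smooth_germ g -> smooth_germ (partial i g).
Proof. exact: smooth_germ_derive. Qed.


Lemma whomogeneous_coord i : whomogeneous (lam i)%:R (fun x : Rm => x 0 i).
Proof.
split; first exact: smooth_germ_coord.
apply: near0W => x; rewrite (bigD1 i)//= big1 ?addr0; last first.
  by move=> j ji; rewrite /partial derive_coord_basis (negbTE ji) mulr0.
by rewrite /partial derive_coord_basis eqxx mulr1.
Qed.

Lemma whomogeneous_qpart r c g : whomogeneous (r%:R - c%:R) (qpart lam r c g).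
Proof.
by split; [exact: smooth_germ_qpart|apply: near0W => x; exact: qpart_euler].
Qed.

Lemma whomogeneousD e q1 q2 : whomogeneous e q1 -> whomogeneous e q2 ->
  whomogeneous e (fun x => q1 x + q2 x).
Proof.
move=> [s1 E1] [s2 E2]; split; first exact: smooth_germD.
have := near_forall (fun i => near_deriveD (basis_vec i) s1 s2).
apply: filterS3 E1 E2 => x E1 E2 D; rewrite mulrDr -E1 -E2 -big_split.
by apply: eq_bigr => i _; rewrite /partial D mulrDr.
Qed.

Lemma whomogeneousM e1 e2 q1 q2 : whomogeneous e1 q1 -> whomogeneous e2 q2 ->
  whomogeneous (e1 + e2) (fun x => q1 x * q2 x).
Proof.
move=> [s1 E1] [s2 E2]; split; first exact: smooth_germM.
have := near_forall (fun i => near_deriveM (basis_vec i) s1 s2).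
apply: filterS3 E1 E2 => x E1 E2 D.
have -> : (e1 + e2) * (q1 x * q2 x) = q2 x * (e1 * q1 x) + q1 x * (e2 * q2 x) by ring.
rewrite -E1 -E2 !mulr_sumr -big_split; apply: eq_bigr => i _.
by rewrite /partial D mulrDr/= addrC; congr (_ + _); exact: mulrCA.
Qed.

Lemma whomogeneous_eq e e' q q' : e = e' -> q =1 q' ->
  whomogeneous e q -> whomogeneous e' q'.
Proof. by move=> <- /funext <-. Qed.

Lemma whomogeneousZ e c q : whomogeneous e q -> whomogeneous e (fun x => c * q x).
Proof.
move=> [s1 E1]; split; first exact: smooth_germZ.
have := near_forall (fun i => near_deriveZ (basis_vec i) c s1).
apply: filterS2 E1 => x E1 D; rewrite mulrCA -E1 mulr_sumr.
by apply: eq_bigr => i _; rewrite /partial D mulrCA.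
Qed.

Lemma whomogeneous0 e : whomogeneous e (fun=> 0).
Proof.
split; first exact: smooth_germ_cst.
by apply: near0W => x; rewrite mulr0 big1// => i _; rewrite /partial derive_cst mulr0.
Qed.

Lemma whomogeneous_sum e (I : Type) (s : seq I) (P : pred I) (F : I -> Rm -> R) :
  (forall i, P i -> whomogeneous e (F i)) ->
  whomogeneous e (fun x => \sum_(i <- s | P i) F i x).
Proof.
move=> hF; elim: s => [|i s IH].
  by apply: whomogeneous_eq (whomogeneous0 e) => // x; rewrite big_nil.
case: (boolP (P i)) => Pi.
  by apply: whomogeneous_eq (whomogeneousD (hF _ Pi) IH) => // x; rewrite big_cons Pi.
by apply: whomogeneous_eq IH => // x; rewrite big_cons (negbTE Pi).
Qed.

(** Differentiate the Euler equation in [x_j]: the second derivatives are exchanged by symmetry, and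
    differentiating the factor [x_j] itself produces the shift [lam j]. *)
Lemma whomogeneous_partial e q j : whomogeneous e q ->
  whomogeneous (e - (lam j)%:R) (partial j q).
Proof.
move=> [sq E]; have sp i := smooth_germ_partial i sq; split=> //.
have sx i : smooth_germ (fun x : Rm => (lam i)%:R * x 0 i).
  by apply: smooth_germZ; exact: smooth_germ_coord.
have st i : smooth_germ (fun x : Rm => (lam i)%:R * x 0 i * partial i q x).
  by apply: smooth_germM.
have D1 := near_forall (fun i => near_deriveM (basis_vec j) (sx i) (sp i)).
have D2 := near_derive_sum predT (basis_vec j) st.
have D3 := near_derive (basis_vec j) E.
have D4 := near_deriveZ (basis_vec j) e sq.
have D5 := near_forall (fun i => near_schwarz (basis_vec j) (basis_vec i) sq).
have D6 := near_forall (fun i => near_deriveZ (basis_vec j) (lam i)%:R (@smooth_germ_coord R m i)).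
near=> x.
have D1x : forall i, 'D_(basis_vec j) (fun y : Rm => (lam i)%:R * y 0 i * partial i q y) x =
  (lam i)%:R * x 0 i * 'D_(basis_vec j) (partial i q) x +
  partial i q x * 'D_(basis_vec j) (fun y : Rm => (lam i)%:R * y 0 i) x by near: x.
have D2x : 'D_(basis_vec j) (fun y : Rm => \sum_(i < m) (lam i)%:R * y 0 i * partial i q y) x =
  \sum_(i < m) 'D_(basis_vec j) (fun y : Rm => (lam i)%:R * y 0 i * partial i q y) x by near: x.
have D3x : 'D_(basis_vec j) (fun y : Rm => \sum_(i < m) (lam i)%:R * y 0 i * partial i q y) x =
  'D_(basis_vec j) (fun y => e * q y) x by near: x.
have D4x : 'D_(basis_vec j) (fun y => e * q y) x = e * 'D_(basis_vec j) q x by near: x.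
have D5x : forall i, 'D_(basis_vec j) ('D_(basis_vec i) q) x =
    'D_(basis_vec i) ('D_(basis_vec j) q) x by near: x.
have D6x : forall i, 'D_(basis_vec j) (fun y : Rm => (lam i)%:R * y 0 i) x =
    (lam i)%:R * 'D_(basis_vec j) (fun y : Rm => y 0 i) x by near: x.
have E1 : e * partial j q x =
    \sum_(i < m) 'D_(basis_vec j) (fun y : Rm => (lam i)%:R * y 0 i * partial i q y) x.
  exact: (etrans (esym D4x) (etrans (esym D3x) D2x)).
have E2 : e * partial j q x =
    \sum_(i < m) (lam i)%:R * x 0 i * partial i (partial j q) x + (lam j)%:R * partial j q x.
  rewrite E1.
  rewrite (eq_bigr (fun i => (lam i)%:R * x 0 i * 'D_(basis_vec j) (partial i q) x +
    partial i q x * 'D_(basis_vec j) (fun y : Rm => (lam i)%:R * y 0 i) x)); last first.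
    by move=> i _; exact: D1x.
  rewrite big_split.
  have S1 : \sum_(i < m) (lam i)%:R * x 0 i * 'D_(basis_vec j) (partial i q) x =
      \sum_(i < m) (lam i)%:R * x 0 i * partial i (partial j q) x.
    by apply: eq_bigr => i _; exact: (f_equal (fun z => _ * z) (D5x i)).
  have S2 : \sum_(i < m) partial i q x * 'D_(basis_vec j) (fun y : Rm => (lam i)%:R * y 0 i) x =
      (lam j)%:R * partial j q x.
    apply: etrans (sum_delta (fun i => partial i q x) (fun i => (lam i)%:R) j).
    apply: eq_bigr => i _.
    apply: (f_equal (fun z => _ * z)); rewrite (D6x i); apply: (f_equal (fun z => _ * z)).
    by rewrite /basis_vec derive_coord_basis eq_sym.
  exact: (f_equal2 (fun y z : R => y + z) S1 S2).
apply: etrans (esym (mulrBl _ _ _)); apply: (etrans (esym (addrK ((lam j)%:R * partial j q x) _))).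
exact: (f_equal (fun z => z - _) (esym E2)).
Unshelve. all: by end_near. Qed.

End WeightedHomogeneity.

(** * Restriction of functions to the curve *)

Section QuasiHomogeneousCurve.
Context {R : realType} {m : nat}.
Local Notation Rm := 'rV[R]_m.
Implicit Types (g q : Rm -> R) (x : Rm).
Variables (lam : 'I_m -> nat) (f : R -> Rm) (A : Rm).
Hypothesis lam_gt0 : forall i, (0 < lam i)%N.
Hypothesis f_smooth : smooth_germ f.
Hypothesis fE : \forall t \near (0 : R), forall i, f t 0 i = A 0 i * t ^+ lam i.

Lemma curve0 : f 0 = 0.
Proof.
apply/rowP => i; rewrite (nbhs_singleton fE i) mxE expr0n.
by rewrite (gtn_eqF (lam_gt0 i)) mulr0.
Qed.

Lemma smooth_germ_on_curve g : smooth_germ g -> smooth_germ (g \o f).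
Proof. by move=> sg; exact: (smooth_germ_comp curve0 f_smooth sg). Qed.

Lemma near_curve (P : Rm -> Prop) : (\forall x \near (0 : Rm), P x) ->
  \forall t \near (0 : R), P (f t).
Proof. exact: (smooth_germ_cvg0 f_smooth curve0). Qed.

Lemma near_derive_curve_coord : \forall t \near (0 : R), forall i,
  t * 'D_1 (fun s => f s 0 i) t = (lam i)%:R * f t 0 i.
Proof.
apply: (@near_forall R R 'I_m (fun i t => t * 'D_1 (fun s => f s 0 i) t =
  (lam i)%:R * f t 0 i)) => i.
have Ei : \forall t \near (0 : R), f t 0 i = A 0 i * t ^+ lam i.
  by apply: filterS fE => t.
have := near_deriveZ (1 : R) (A 0 i) (smooth_germX (lam i) (@smooth_germ_line R)).
apply: filterS3 Ei (near_derive (1 : R) Ei) => t Et -> ->.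
rewrite derive_pow Et mulrCA [RHS]mulrCA; congr (_ * _).
by rewrite mulrCA -exprS prednK.
Qed.

(** The curve carries [t d/dt] to the Euler field. *)
Lemma curve_euler g : smooth_germ g -> \forall t \near (0 : R),
  t * 'D_1 (g \o f) t = \sum_(i < m) (lam i)%:R * f t 0 i * partial i g (f t).
Proof.
move=> sg; have := near_derive_comp (1 : R) curve0 f_smooth sg.
apply: filterS2 near_derive_curve_coord => t E ->.
rewrite mulr_sumr; apply: eq_bigr => i _.
by rewrite -E /GRing.scale/= mulrA.
Qed.

Lemma whomogeneous_curve e q : whomogeneous lam e q ->
  \forall t \near (0 : R), t * 'D_1 (q \o f) t = e * (q \o f) t.
Proof.
move=> [sq E]; have := near_curve E.
by apply: filterS2 (curve_euler sq) => t -> /= ->.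
Qed.

(** Since [f t] is [A] dilated with the weights, the coefficient of [t^n] in [g (f t)] is the part
    of degree [n] of [g] evaluated at [A]. The Euler field reduces order [n] to the orders
    [n - lam i] of the partial derivatives, so no Taylor series has to be substituted; [c] varies in
    the induction. *)
Lemma tcoef_curve n c r g : smooth_germ g -> (n + c)%N = r ->
  tcoef n (g \o f) = qpart lam r c g A.
Proof.
elim/ltn_ind: n c g => -[|n] IH c g sg.
  by rewrite add0n => ->; rewrite tcoef0 /= curve0 qpart_diag.
move=> ncr; apply: (mulfI (_ : n.+1%:R != 0 :> R)); first by rewrite pnatr_eq0.
rewrite -tcoef_derive.
have su := smooth_germ_on_curve sg.
rewrite -(tcoef_mulX n.+1 (smooth_germ_derive (1 : R) su)).
have sp i : smooth_germ (partial i g \o f).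
  by apply: smooth_germ_on_curve; exact: smooth_germ_partial.
have E : \forall t \near (0 : R), t * 'D_1 (g \o f) t =
    \sum_(i < m) (lam i)%:R * A 0 i * (t ^+ lam i * (partial i g \o f) t).
  apply: filterS2 fE (curve_euler sg) => t Et ->.
  by apply: eq_bigr => i _; rewrite Et !mulrA.
have sl := @smooth_germ_line R.
rewrite (tcoef_ext _ E) tcoef_sum; last first.
  by move=> i; apply: smooth_germZ; apply: smooth_germM => //; exact: smooth_germX.
have -> : n.+1%:R = r%:R - c%:R :> R by rewrite -ncr natrD addrK.
rewrite -qpart_euler; apply: eq_bigr => i _.
rewrite tcoefZ; last by apply: smooth_germM => //; exact: smooth_germX.
congr (_ * _); rewrite tcoef_mulXn// partial_qpart//; case: leqP => lin.
  apply: IH; last by rewrite [(c + _)%N]addnC addnA subnK.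
    by rewrite ltn_subrL lam_gt0.
  exact: smooth_germ_partial.
by rewrite qpart_gt// -ncr addnC ltn_add2l.
Qed.

Lemma qpart_curve r c g : \forall t \near (0 : R),
  qpart lam r c g (f t) = t ^+ (r - c) * qpart lam r c g A.
Proof.
apply: filterS fE => t Et; rewrite /qpart mulr_sumr; apply: eq_bigr => al /eqP w.
rewrite mulrCA; congr (_ * _).
rewrite (_ : (r - c)%N = \sum_(i < m) lam i * al i)%N; last by rewrite -[X in (X - c)%N]w addnK.
rewrite /monom expr_sum -big_split; apply: eq_bigr => i _.
by rewrite Et exprMn exprM mulrC.
Qed.

(** On [f] a part is a monomial whose coefficient is a Taylor coefficient of [g \o f]. In particular
    the parts of a function vanishing on [f] vanish on [f], which makes them act on restrictions. *)
Lemma qpart_vanishes r c g : smooth_germ g ->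
  (forall n, (n + c)%N = r -> tcoef n (g \o f) = 0) ->
  \forall t \near (0 : R), qpart lam r c g (f t) = 0.
Proof.
move=> sg g0; apply: filterS (qpart_curve r c g) => t ->.
have [cr|rc] := leqP c r; last by rewrite qpart_gt// mulr0.
by rewrite -(tcoef_curve sg (subnK cr)) g0 ?mulr0// subnK.
Qed.

End QuasiHomogeneousCurve.

(** * Differential forms and algebraic restrictions *)

(* Unification diverges when it is allowed to unfold [derive]. *)
Opaque derive.

Section FormAlgebra.
Context {R : realType} {m : nat}.
Local Notation Rm := 'rV[R]_m.
Implicit Types (eta : 'I_m -> Rm -> R) (w : kform R m 2) (F G : Rm -> Rm) (x : Rm).

Definition pr (i j : 'I_m) : {ffun 'I_2 -> 'I_m} := [ffun l => if l == ord0 then i else j].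
Definition sg (i : 'I_m) : {ffun 'I_1 -> 'I_m} := [ffun=> i].

Lemma prE (I : {ffun 'I_2 -> 'I_m}) : I = pr (I ord0) (I ord_max).
Proof.
apply/ffunP => l; rewrite ffunE; case: eqP => [-> //|]; case: l => -[|[|//]] p ne.
  by case: ne; apply/val_inj.
by congr (I _); apply/val_inj.
Qed.

Lemma pr0 i j : pr i j ord0 = i. Proof. by rewrite ffunE. Qed.
Lemma pr1 i j : pr i j ord_max = j. Proof. by rewrite ffunE. Qed.

Lemma sgE (I : {ffun 'I_1 -> 'I_m}) : I = sg (I ord0).
Proof. by apply/ffunP => l; rewrite ffunE ord1. Qed.

Definition form1 (eta : 'I_m -> Rm -> R) : kform R m 1 := fun x I => eta (I ord0) x.

Lemma form1E (b : kform R m 1) : b = form1 (fun i x => b x (sg i)).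
Proof. by apply/funext => x; apply/funext => I; rewrite /form1 -sgE. Qed.

Definition smooth1 eta := forall i, smooth_germ (eta i).

Definition d1 eta (k l : 'I_m) (x : Rm) : R := partial k (eta l) x - partial l (eta k) x.

Lemma ext_d_form1 eta x I : ext_d (form1 eta) x I = d1 eta (I ord0) (I ord_max) x.
Proof.
rewrite /ext_d /form1 !big_ord_recl big_ord0 addr0 /d1 /= expr0 mul1r expr1 mulN1r.
congr (_ - _).
  apply: (f_equal (fun g => partial _ g x)); apply/funext => y; rewrite ffunE.
  by congr (eta (I _) y); apply/val_inj.
have -> : lift ord0 ord0 = ord_max :> 'I_2 by apply/val_inj.
apply: (f_equal (fun g => partial _ g x)); apply/funext => y; rewrite ffunE.
by congr (eta (I _) y); apply/val_inj.
Qed.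

Lemma form_germ1 eta : smooth1 eta <-> form_germ (form1 eta).
Proof.
split=> [se|[se _] i]; last first.
  by have := se (sg i); apply: smooth_germ_eq => x; rewrite /form1 ffunE.
split=> [I|]; first exact: se.
apply: near0W => x s I; have -> : s = 1%g by apply/permP => i; rewrite !ord1.
by rewrite odd_perm1 expr0 mul1r /form1 ffunE perm1.
Qed.

Lemma form_germ2 w : (forall i j, smooth_germ (fun x => w x (pr i j))) ->
  (\forall x \near (0 : Rm), forall i j, w x (pr j i) = - w x (pr i j)) -> form_germ w.
Proof.
move=> sw aw; split=> [I|]; first by rewrite (prE I).
apply: filterS aw => x aw s I.
have -> : [ffun l => I (s l)] = pr (I (s ord0)) (I (s ord_max)).
  by rewrite [LHS]prE !ffunE.
have [s0|s0] := eqVneq (s ord0) ord0.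
  have s1 : s ord_max = ord_max.
    have : s ord_max != s ord0 by rewrite (inj_eq perm_inj).
    by rewrite s0; case: (s ord_max) => -[|[|//]] p // _; apply/val_inj.
  have -> : s = 1%g.
    apply/permP => -[[|[|//]] p]; rewrite perm1.
      by rewrite (_ : Ordinal p = ord0)//; apply/val_inj.
    by rewrite (_ : Ordinal p = ord_max)//; apply/val_inj.
  by rewrite !perm1 odd_perm1 expr0 mul1r -prE.
have s01 : s ord0 = ord_max.
  by move: s0; case: (s ord0) => -[|[|//]] p // _; apply/val_inj.
have s1 : s ord_max = ord0.
  have : s ord_max != s ord0 by rewrite (inj_eq perm_inj).
  by rewrite s01; case: (s ord_max) => -[|[|//]] p // _; apply/val_inj.
have -> : s = tperm ord0 ord_max.
  apply/permP => -[[|[|//]] p].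
    by rewrite (_ : Ordinal p = ord0) ?tpermL//; apply/val_inj.
  by rewrite (_ : Ordinal p = ord_max) ?tpermR//; apply/val_inj.
by rewrite tpermL tpermR odd_tperm/= expr1 mulN1r aw -prE.
Qed.

Lemma form_germ2_anti w : form_germ w ->
  \forall x \near (0 : Rm), forall i j, w x (pr j i) = - w x (pr i j).
Proof.
move=> [_]; apply: filterS => x aw i j.
have := aw (tperm ord0 ord_max) (pr i j); rewrite odd_tperm/= expr1 mulN1r => <-.
by congr (w x _); rewrite [RHS]prE !ffunE tpermL tpermR.
Qed.

Lemma smooth_d1 eta k l : smooth1 eta -> smooth_germ (d1 eta k l).
Proof. by move=> se; apply: smooth_germB; exact: smooth_germ_partial. Qed.

Definition dform eta : kform R m 2 := ext_d (form1 eta).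

Lemma dformE eta x I : dform eta x I = d1 eta (I ord0) (I ord_max) x.
Proof. exact: ext_d_form1. Qed.

Lemma form_germ_dform eta : smooth1 eta -> form_germ (dform eta).
Proof.
move=> se; apply: form_germ2 => [i j|].
  by apply: smooth_germ_eq (smooth_d1 i j se) => x; rewrite dformE pr0 pr1.
by apply: near0W => x i j; rewrite !dformE !pr0 !pr1 /d1 opprB.
Qed.

Lemma ext_d2 w x (I : {ffun 'I_3 -> 'I_m}) :
  let a := I ord0 in let b := I (lift ord0 ord0) in let c := I (lift ord0 (lift ord0 ord0)) in
  ext_d w x I = partial a (fun y => w y (pr b c)) x - partial b (fun y => w y (pr a c)) x +
    partial c (fun y => w y (pr a b)) x.
Proof.
pose o1 : 'I_3 := lift ord0 ord0; pose o2 : 'I_3 := lift ord0 (lift ord0 ord0).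
have sum3 (T : 'I_3 -> R) : \sum_(l < 3) (-1) ^+ l * T l = T ord0 - T o1 + T o2.
  rewrite !big_ord_recl big_ord0 /bump/= -/o1 -/o2; ring.
have TE (l : 'I_3) : [ffun j => I (lift l j)] = pr (I (lift l ord0)) (I (lift l ord_max)).
  by rewrite [LHS]prE !ffunE.
have e0 : lift ord0 (ord0 : 'I_2) = o1 by apply/val_inj.
have e1 : lift ord0 (ord_max : 'I_2) = o2 by apply/val_inj.
have e2 : lift o1 (ord0 : 'I_2) = ord0 by apply/val_inj.
have e3 : lift o1 (ord_max : 'I_2) = o2 by apply/val_inj.
have e4 : lift o2 (ord0 : 'I_2) = ord0 by apply/val_inj.
have e5 : lift o2 (ord_max : 'I_2) = o1 by apply/val_inj.
by rewrite /ext_d sum3 !TE e0 e1 e2 e3 e4 e5.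
Qed.

Lemma closed_formP w : closed_form w <-> form_germ w /\
  \forall x \near (0 : Rm), forall a b c,
    partial a (fun y => w y (pr b c)) x - partial b (fun y => w y (pr a c)) x +
    partial c (fun y => w y (pr a b)) x = 0.
Proof.
split=> -[gw H]; split=> //; apply: filterS H => x H.
  move=> a b c; pose I : {ffun 'I_3 -> 'I_m} := [ffun l : 'I_3 => nth a [:: a; b; c] l].
  by have := H I; rewrite ext_d2 /= !ffunE.
by move=> I; rewrite ext_d2; exact: H.
Qed.

Lemma closed_dform eta : smooth1 eta -> closed_form (dform eta).
Proof.
move=> se; apply/closed_formP; split; first exact: form_germ_dform.
have sp i j := smooth_germ_partial i (se j).
have dB a b c := near_deriveD (basis_vec a) (sp b c) (smooth_germN (sp c b)).
have dN a b c := near_deriveZ (basis_vec a) (-1) (sp b c).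
have E : \forall x \near (0 : Rm), forall a b c, partial a (fun y => dform eta y (pr b c)) x =
    partial a (partial b (eta c)) x - partial a (partial c (eta b)) x.
  apply: near_forall => a; apply: near_forall => b; apply: near_forall => c.
  have -> : (fun y => dform eta y (pr b c)) = d1 eta b c.
    by apply/funext => y; rewrite dformE pr0 pr1.
  apply: filterS2 (dB a b c) (dN a c b) => x E1 E2.
  apply: (etrans E1); rewrite -mulN1r -E2.
  apply: (f_equal (fun g => _ + derive g x _)); apply/funext => y.
  by rewrite mulN1r.
have S : \forall x \near (0 : Rm), forall a b c,
    partial a (partial b (eta c)) x = partial b (partial a (eta c)) x.
  apply: near_forall => a; apply: near_forall => b; apply: near_forall => c.
  exact: (near_schwarz (basis_vec a) (basis_vec b) (se c)).
apply: filterS2 E S => x E S a b c; rewrite !E (S b a) (S c a) (S c b).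
move: (partial _ _ x) (partial _ _ x) (partial _ _ x) => u v z.
ring.
Qed.

End FormAlgebra.

(** * Linear calculus of algebraic restrictions *)

Section SameRestriction.
Context {R : realType} {m : nat}.
Local Notation Rm := 'rV[R]_m.
Implicit Types (eta be : 'I_m -> Rm -> R) (w al : kform R m 2) (F G : Rm -> Rm) (x : Rm).
Implicit Types f : R -> Rm.

Definition vanish1 f eta := forall i, \forall t \near (0 : R), eta i (f t) = 0.


Lemma same_restrictionP f w1 w2 : same_restriction f w1 w2 <->
  exists al be, [/\ form_germ al, smooth1 be, vanishes_on f al, vanish1 f be &
    \forall x \near (0 : Rm), forall I, w1 x I - w2 x I = al x I + dform be x I].
Proof.
split=> [[al [b [ga gb va vb E]]]|[al [be [ga gb va vb E]]]].
  exists al, (fun i x => b x (sg i)); split=> //.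
  - by apply/form_germ1; rewrite -form1E.
  - by move=> i; apply: filterS vb => t; exact.
  - by rewrite /dform -form1E.
exists al, (form1 be); split=> //; first exact/form_germ1.
by apply: filterS (near_forall vb) => t vt I; exact: vt.
Qed.

Lemma form_germ_lin k (a b : R) (w1 w2 : kform R m k) :
  form_germ w1 -> form_germ w2 -> form_germ (fun x I => a * w1 x I + b * w2 x I).
Proof.
move=> [s1 a1] [s2 a2]; split=> [I|].
  by apply: smooth_germD; exact: smooth_germZ.
by apply: filterS2 a1 a2 => x E1 E2 s I; rewrite E1 E2 mulrDr !(mulrCA (_ ^+ _)).
Qed.

Lemma near_d1_lin (a b : R) be1 be2 : smooth1 be1 -> smooth1 be2 ->
  \forall x \near (0 : Rm), forall k l,
    d1 (fun i x => a * be1 i x + b * be2 i x) k l x = a * d1 be1 k l x + b * d1 be2 k l x.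
Proof.
move=> s1 s2; apply: near_forall => k; apply: near_forall => l.
have D p q : \forall x \near (0 : Rm), partial p (fun x => a * be1 q x + b * be2 q x) x =
    a * partial p (be1 q) x + b * partial p (be2 q) x.
  have := near_deriveD (basis_vec p) (smooth_germZ a (s1 q)) (smooth_germZ b (s2 q)).
  have := near_deriveZ (basis_vec p) a (s1 q).
  have := near_deriveZ (basis_vec p) b (s2 q).
  by apply: filterS3 => x E1 E2 E3; apply: (etrans E3); rewrite E1 E2.
apply: filterS2 (D k l) (D l k) => x E1 E2; rewrite /d1 E1 E2.
by move: (partial _ _ _) (partial _ _ _) (partial _ _ _) (partial _ _ _) => *; ring.
Qed.

Lemma near_dform_lin (a b : R) be1 be2 : smooth1 be1 -> smooth1 be2 ->
  \forall x \near (0 : Rm), forall I,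
    dform (fun i x => a * be1 i x + b * be2 i x) x I = a * dform be1 x I + b * dform be2 x I.
Proof.
by move=> s1 s2; apply: filterS (near_d1_lin a b s1 s2) => x E I; rewrite !dformE E.
Qed.

(** Forms with zero restriction are a linear space; symmetry and transitivity are obtained from this
    lemma by suitable combinations with reflexivity. *)
Lemma same_restriction_lin f (a b : R) w1 w2 w1' w2' :
  same_restriction f w1 w1' -> same_restriction f w2 w2' ->
  same_restriction f (fun x I => a * w1 x I + b * w2 x I) (fun x I => a * w1' x I + b * w2' x I).
Proof.
move=> /same_restrictionP[al1 [be1 [ga1 gb1 va1 vb1 E1]]].
move=> /same_restrictionP[al2 [be2 [ga2 gb2 va2 vb2 E2]]].
apply/same_restrictionP; exists (fun x I => a * al1 x I + b * al2 x I).
exists (fun i x => a * be1 i x + b * be2 i x); split.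
- exact: form_germ_lin.
- by move=> i; apply: smooth_germD; exact: smooth_germZ.
- by apply: filterS2 va1 va2 => t v1 v2 I; rewrite v1 v2 !mulr0 addr0.
- by move=> i; apply: filterS2 (vb1 i) (vb2 i) => t -> ->; rewrite !mulr0 addr0.
- apply: filterS3 E1 E2 (near_dform_lin a b gb1 gb2) => x E1 E2 E3 I.
  rewrite E3 opprD addrACA -!mulrBr E1 E2.
  by move: (dform _ _ _) (dform _ _ _) => *; ring.
Qed.

Lemma form_germ_zero k : form_germ (@zero_form R m k).
Proof.
split=> [I|]; first exact: smooth_germ_cst.
by apply: near0W => x s I; rewrite mulr0.
Qed.

Lemma near_dform0 : forall x I, dform (fun _ (_ : Rm) => 0) x I = 0.
Proof. by move=> x I; rewrite dformE /d1 /partial !derive_cst subr0. Qed.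

Lemma same_restriction_near f w1 w2 :
  (\forall x \near (0 : Rm), forall I, w1 x I = w2 x I) -> same_restriction f w1 w2.
Proof.
move=> E; apply/same_restrictionP; exists (@zero_form R m 2), (fun _ _ => 0); split.
- exact: form_germ_zero.
- by move=> i; exact: smooth_germ_cst.
- by apply: (@near0W R R) => t I.
- by move=> i; apply: (@near0W R R) => t.
- by apply: filterS E => x E I; rewrite E subrr near_dform0 addr0.
Qed.

Lemma same_restriction_refl f w : same_restriction f w w.
Proof. by apply: same_restriction_near; exact: near0W. Qed.

Lemma same_restriction_ext f w1 w2 w1' w2' :
  (forall x I, w1 x I = w1' x I) -> (forall x I, w2 x I = w2' x I) ->
  same_restriction f w1 w2 -> same_restriction f w1' w2'.
Proof.
move=> E1 E2.
have -> : w1 = w1' by apply/funext => x; apply/funext => I.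
by have -> : w2 = w2' by apply/funext => x; apply/funext => I.
Qed.

Lemma same_restriction_sym f w1 w2 :
  same_restriction f w1 w2 -> same_restriction f w2 w1.
Proof.
move=> H; have := same_restriction_lin (-1) 1 H
  (same_restriction_refl f (fun x I => w1 x I + w2 x I)).
by apply: same_restriction_ext => x I; ring.
Qed.

Lemma same_restriction_trans f w1 w2 w3 :
  same_restriction f w1 w2 -> same_restriction f w2 w3 -> same_restriction f w1 w3.
Proof.
move=> H1 H2; have H := same_restriction_lin 1 1 H1 H2.
have := same_restriction_lin 1 (-1) H (same_restriction_refl f w2).
by apply: same_restriction_ext => x I; ring.
Qed.

Lemma same_restriction_sum f (I : Type) (s : seq I) (P : pred I) (c : I -> R)
    (w w' : I -> kform R m 2) :
  (forall i, P i -> same_restriction f (w i) (w' i)) ->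
  same_restriction f (fun x J => \sum_(i <- s | P i) c i * w i x J)
    (fun x J => \sum_(i <- s | P i) c i * w' i x J).
Proof.
move=> H; elim: s => [|i s IH].
  by apply: same_restriction_near; apply: near0W => x J; rewrite !big_nil.
case: (boolP (P i)) => Pi.
  have := same_restriction_lin (c i) 1 (H i Pi) IH.
  by apply: same_restriction_ext => x J; rewrite big_cons Pi mul1r.
by apply: same_restriction_ext IH => x J; rewrite big_cons (negbTE Pi).
Qed.

Lemma dform_vanish f be : smooth1 be -> vanish1 f be ->
  same_restriction f (dform be) (@zero_form R m 2).
Proof.
move=> sb vb; apply/same_restrictionP; exists (@zero_form R m 2), be; split=> //.
- exact: form_germ_zero.
- by apply: (@near0W R R) => t I.
- by apply: near0W => x I; rewrite subr0 add0r.
Qed.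

End SameRestriction.

(** * Pullback of 2-forms and of restrictions *)

Section Pullback.
Context {R : realType} {m : nat}.
Local Notation Rm := 'rV[R]_m.
Implicit Types (eta be : 'I_m -> Rm -> R) (w al : kform R m 2) (F G : Rm -> Rm) (x : Rm).

Definition mx2 w x : 'M[R]_m := \matrix_(i, j) w x (pr i j).

Lemma mx2E w x I : w x I = mx2 w x (I ord0) (I ord_max).
Proof. by rewrite mxE -prE. Qed.

Lemma sum_ffun2 (P : {ffun 'I_2 -> 'I_m} -> R) :
  \sum_(J : {ffun 'I_2 -> 'I_m}) P J = \sum_(i < m) \sum_(j < m) P (pr i j).
Proof.
rewrite pair_bigA /= (reindex (fun p : 'I_m * 'I_m => pr p.1 p.2))//.
exists (fun J : {ffun 'I_2 -> 'I_m} => (J ord0, J ord_max)) => [[i j] _|J _] /=.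
  by rewrite pr0 pr1.
by rewrite -prE.
Qed.

(** A 2-form at a point is a matrix, and pullback acts on it by congruence with the Jacobian;
    functoriality then becomes matrix algebra. *)
Lemma mx2_pullback F w x : mx2 (pullback F w) x = jac F x *m mx2 w (F x) *m (jac F x)^T.
Proof.
apply/matrixP => k l; rewrite !mxE /pullback sum_ffun2 exchange_big; apply: eq_bigr => b _.
rewrite !mxE mulr_suml; apply: eq_bigr => a _.
rewrite !big_ord_recl big_ord0 mulr1 pr0.
rewrite (_ : lift ord0 ord0 = ord_max); last by apply/val_inj.
rewrite !pr1 !pr0 !mxE -/(partial _ _) -/(component F _) mulrAC; congr (_ * _ * _).
Qed.

End Pullback.

Section PullbackTheory.
Context {R : realType} {m : nat}.
Local Notation Rm := 'rV[R]_m.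
Implicit Types (eta be : 'I_m -> Rm -> R) (w al : kform R m 2) (F G : Rm -> Rm) (x : Rm).

Lemma pullbackE F w x I : pullback F w x I =
  (jac F x *m mx2 w (F x) *m (jac F x)^T) (I ord0) (I ord_max).
Proof. by rewrite mx2E mx2_pullback. Qed.

Lemma near_mx2_anti w : form_germ w -> \forall x \near (0 : Rm), (mx2 w x)^T = - mx2 w x.
Proof.
move=> /form_germ2_anti; apply: filterS => x aw.
by apply/matrixP => i j; rewrite !mxE aw.
Qed.

Lemma smooth_germ_jac F i j : smooth_germ F -> smooth_germ (fun x => jac F x i j).
Proof.
move=> /smooth_germ_rVP /(_ j) /(smooth_germ_derive (delta_mx 0 i)).
by apply: smooth_germ_eq => x; rewrite mxE.
Qed.

Lemma form_germ_pullback F w : smooth_germ F -> F 0 = 0 -> form_germ w ->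
  form_germ (pullback F w).
Proof.
move=> sF F0 gw; apply: form_germ2 => [i j|].
  have : smooth_germ (fun x => \sum_a (\sum_b jac F x i b * w (F x) (pr b a)) * jac F x j a).
    apply: smooth_germ_sum => a _; apply: smooth_germM; last exact: smooth_germ_jac.
    apply: smooth_germ_sum => b _; apply: smooth_germM; first exact: smooth_germ_jac.
    exact: (smooth_germ_comp F0 sF (gw.1 (pr b a))).
  apply: smooth_germ_eq => x; rewrite pullbackE pr0 pr1 mxE; apply: eq_bigr => a _.
  by rewrite !mxE; congr (_ * _); apply: eq_bigr => b _; rewrite !mxE.
have := smooth_germ_cvg0 sF F0 (near_mx2_anti gw); apply: filterS => x aw i j.
rewrite !pullbackE !pr0 !pr1.
rewrite -[in LHS](trmxK (jac F x *m _ *m _)) mxE !trmx_mul trmxK aw.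
by rewrite mulNmx mulmxN mulmxA mxE.
Qed.

Lemma near_jac_comp F G : smooth_germ F -> F 0 = 0 -> smooth_germ G -> G 0 = 0 ->
  \forall x \near (0 : Rm), jac (F \o G) x = jac G x *m jac F (G x).
Proof.
move=> sF F0 sG G0; have sFj j := (smooth_germ_rVP F).1 sF j.
have D i j := near_derive_comp (delta_mx 0 i) G0 sG (sFj j).
have := near_forall (fun i => near_forall (D i)); apply: filterS => x E.
apply/matrixP => i j; rewrite [RHS]mxE [LHS]mxE; apply: (etrans (E i j)).
by apply: eq_bigr => b _; rewrite !mxE.
Qed.

Lemma near_pullback_comp F G w : smooth_germ F -> F 0 = 0 -> smooth_germ G -> G 0 = 0 ->
  \forall x \near (0 : Rm), forall I, pullback G (pullback F w) x I = pullback (F \o G) w x I.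
Proof.
move=> sF F0 sG G0; apply: filterS (near_jac_comp sF F0 sG G0) => x J I.
by rewrite !pullbackE J mx2_pullback trmx_mul !mulmxA.
Qed.

Lemma near_jac_id F : (\forall x \near (0 : Rm), F x = x) ->
  \forall x \near (0 : Rm), jac F x = 1%:M.
Proof.
move=> Fid; have D i j : \forall x \near (0 : Rm), jac F x i j = (i == j)%:R.
  have : \forall x \near (0 : Rm), F x 0 j = x 0 j by apply: filterS Fid => x ->.
  move=> /(near_derive (delta_mx 0 i)); apply: filterS => x E.
  by rewrite mxE E derive_coord_basis.
apply: filterS (near_forall (fun i => near_forall (D i))) => x J.
by apply/matrixP => i j; rewrite J mxE.
Qed.

Lemma near_jac_sym F : smooth_germ F -> \forall x \near (0 : Rm), forall k l b,
  partial k (fun y => jac F y l b) x = partial l (fun y => jac F y k b) x.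
Proof.
move=> sF; apply: near_forall => k; apply: near_forall => l; apply: near_forall => b.
have := near_schwarz (basis_vec k) (basis_vec l) ((smooth_germ_rVP F).1 sF b).
have e i : (fun y => jac F y i b) = 'D_(basis_vec i) (fun y => F y 0 b).
  by apply/funext => y; rewrite mxE.
by apply: filterS => x E; rewrite /partial !e.
Qed.

Lemma near_pullback_id F w : (\forall x \near (0 : Rm), F x = x) ->
  \forall x \near (0 : Rm), forall I, pullback F w x I = w x I.
Proof.
move=> Fid; apply: filterS2 Fid (near_jac_id Fid) => x Fx J I.
by rewrite pullbackE J mul1mx trmx1 mulmx1 -mx2E Fx.
Qed.

Lemma near_pullback_ext F w1 w2 : smooth_germ F -> F 0 = 0 ->
  (\forall x \near (0 : Rm), forall I, w1 x I = w2 x I) ->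
  \forall x \near (0 : Rm), forall I, pullback F w1 x I = pullback F w2 x I.
Proof.
move=> sF F0 /(smooth_germ_cvg0 sF F0); apply: filterS => x E I.
by apply: eq_bigr => J _; rewrite E.
Qed.

Lemma pullback_lin F (a b : R) w1 w2 x I :
  pullback F (fun x I => a * w1 x I + b * w2 x I) x I =
  a * pullback F w1 x I + b * pullback F w2 x I.
Proof.
rewrite /pullback !mulr_sumr -big_split; apply: eq_bigr => J _ /=.
by move: (\prod_(l < 2) _) => u; ring.
Qed.

Lemma pullback_sum F (I : Type) (s : seq I) (P : pred I) (c : I -> R)
    (w : I -> kform R m 2) x J :
  pullback F (fun x J => \sum_(i <- s | P i) c i * w i x J) x J =
  \sum_(i <- s | P i) c i * pullback F (w i) x J.
Proof.
rewrite /pullback; under eq_bigr do rewrite mulr_sumr.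
rewrite exchange_big; apply: eq_bigr => i _; rewrite mulr_sumr.
by apply: eq_bigr => K _; rewrite mulrCA.
Qed.

Definition pullback1 F eta : 'I_m -> Rm -> R :=
  fun i x => \sum_j jac F x i j * eta j (F x).

Lemma smooth1_pullback1 F eta : smooth_germ F -> F 0 = 0 -> smooth1 eta ->
  smooth1 (pullback1 F eta).
Proof.
move=> sF F0 se i; apply: smooth_germ_sum => j _; apply: smooth_germM.
  exact: smooth_germ_jac.
exact: (smooth_germ_comp F0 sF (se j)).
Qed.

(** The second derivatives [H] of [F] are symmetric and cancel in the antisymmetrisation; what
    remains is the congruence by the Jacobian. *)
Lemma near_dform_pullback1 F eta : smooth_germ F -> F 0 = 0 -> smooth1 eta ->
  \forall x \near (0 : Rm), forall I, dform (pullback1 F eta) x I = pullback F (dform eta) x I.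
Proof.
move=> sF F0 se; have sJ i j := smooth_germ_jac i j sF.
have sc j : smooth_germ (eta j \o F) := smooth_germ_comp F0 sF (se j).
pose H k l b x := partial k (fun y => jac F y l b) x.
have D : \forall x \near (0 : Rm), forall k l, partial k (pullback1 F eta l) x =
    \sum_b (jac F x l b * \sum_a jac F x k a * partial a (eta b) (F x) +
      eta b (F x) * H k l b x).
  apply: near_forall => k; apply: near_forall => l.
  have st b : smooth_germ (fun x => jac F x l b * (eta b \o F) x) by exact: smooth_germM.
  have E1 := near_derive_sum predT (basis_vec k) st.
  have E2 := near_forall (fun b => near_deriveM (basis_vec k) (sJ l b) (sc b)).
  have E3 := near_forall (fun b => near_derive_comp (basis_vec k) F0 sF (se b)).
  apply: filterS3 E1 E2 E3 => x E1 E2 E3; apply: (etrans E1); apply: eq_bigr => b _.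
  apply: (etrans (E2 b)); rewrite (E3 b).
  apply: (f_equal (fun z => _ * z + _)); apply: eq_bigr => a _.
  by rewrite /GRing.scale/= mxE.
have S : \forall x \near (0 : Rm), forall k l b, H k l b x = H l k b x := near_jac_sym sF.
apply: filterS2 D S => x D S I; rewrite dformE /d1 !D pullbackE.
move: (I ord0) (I ord_max) => k l.
rewrite -sumrB (eq_bigr (fun b => jac F x l b * (\sum_a jac F x k a * partial a (eta b) (F x)) -
  jac F x k b * (\sum_a jac F x l a * partial a (eta b) (F x)))); last first.
  move=> b _; rewrite (S k l b).
  by move: (H l k b x) (\sum_a _) (\sum_a _) => *; ring.
rewrite sumrB mxE; under [X in _ = X]eq_bigr do rewrite !mxE mulr_suml.
rewrite (eq_bigr (fun b => \sum_a jac F x k a * jac F x l b * partial a (eta b) (F x))); last first.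
  by move=> b _; rewrite mulr_sumr; apply: eq_bigr => a _; rewrite mulrCA mulrA.
rewrite [X in _ - X](eq_bigr (fun b => \sum_a jac F x k b * jac F x l a * partial a (eta b) (F x))); last first.
  by move=> b _; rewrite mulr_sumr; apply: eq_bigr => a _; rewrite mulrA.
rewrite [X in _ - X]exchange_big -sumrB; apply: eq_bigr => b _.
rewrite -sumrB; apply: eq_bigr => a _. 
have jE p q : 'D_(delta_mx 0 p) (fun y => F y 0 q) x = jac F x p q by rewrite [RHS]mxE.
rewrite jE [mx2 _ _ _ _]mxE dformE pr0 pr1 /d1.
by move: (partial _ _ _) (partial _ _ _) => *; ring.
Qed.

(** [F] carries [f2] into a reparametrisation of [f1], so forms vanishing on [f1] pull back to forms
    vanishing on [f2]. This serves for the coordinate changes as well as for the tangent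
    diffeomorphism. *)
Lemma same_restriction_pullback (f1 f2 : R -> Rm) (s : R -> R) F w1 w2 :
  smooth_germ F -> F 0 = 0 -> smooth_germ s -> s 0 = 0 ->
  (\forall t \near (0 : R), F (f2 t) = f1 (s t)) ->
  same_restriction f1 w1 w2 -> same_restriction f2 (pullback F w1) (pullback F w2).
Proof.
move=> sF F0 ss s0 Ff /same_restrictionP[al [be [ga sb va vb E]]].
apply/same_restrictionP; exists (pullback F al), (pullback1 F be); split.
- exact: form_germ_pullback.
- exact: smooth1_pullback1.
- apply: filterS2 Ff (smooth_germ_cvg0 ss s0 va) => t Ft vt I.
  by rewrite /pullback big1// => J _; rewrite Ft vt mulr0.
- have := smooth_germ_cvg0 ss s0 (near_forall vb).
  move=> v i; apply: filterS2 Ff v => t Ft vt.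
  by rewrite /pullback1 big1// => j _; rewrite Ft vt mulr0.
- have := near_pullback_ext sF F0 E; apply: filterS2 (near_dform_pullback1 sF F0 sb) => x D E' I.
  rewrite D; have := E' I.
  have -> : pullback F (fun x I => w1 x I - w2 x I) x I = pullback F w1 x I - pullback F w2 x I.
    have := pullback_lin F 1 (-1) w1 w2 x I; rewrite mul1r mulN1r => <-.
    by apply: eq_bigr => J _; rewrite mul1r mulN1r.
  move=> ->; have := pullback_lin F 1 1 al (dform be) x I; rewrite !mul1r => <-.
  by apply: eq_bigr => J _; rewrite !mul1r.
Qed.

End PullbackTheory.

(** * Homogeneous parts of closed forms and their primitives *)

Section Potential.
Context {R : realType} {m : nat}.
Local Notation Rm := 'rV[R]_m.
Implicit Types (eta be : 'I_m -> Rm -> R) (w al : kform R m 2) (x : Rm).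
Variable lam : 'I_m -> nat.
Hypothesis lam_gt0 : forall i, (0 < lam i)%N.

Lemma std_quasi_part2 r w x I : std_quasi_part lam r w x I =
  qpart lam r (lam (I ord0) + lam (I ord_max))%N (fun y => w y I) x.
Proof.
rewrite std_quasi_partE !big_ord_recl big_ord0 addn0.
by rewrite (_ : lift ord0 ord0 = ord_max)//; apply/val_inj.
Qed.

Lemma qpart_opp r c (g : Rm -> R) x : smooth_germ g ->
  qpart lam r c (fun y => - g y) x = - qpart lam r c g x.
Proof.
move=> sg; have := qpart_lin lam r c (-1) 0 x sg sg; rewrite mulN1r mul0r addr0 => <-.
by congr qpart; apply/funext => y; rewrite mulN1r mul0r addr0.
Qed.

Lemma qpart_zero r c x : qpart lam r c (fun _ : Rm => 0) x = 0.
Proof.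
have s0 := @smooth_germ_cst R Rm R 0.
have E := qpart_lin lam r c 0 0 x s0 s0.
apply: etrans (etrans E _); last by rewrite !mul0r addr0.
by apply: qpart_ext; apply: near0W => y; rewrite !mul0r addr0.
Qed.

Lemma qpart_ext0 r c (g : Rm -> R) x : (\forall y \near (0 : Rm), g y = 0) ->
  qpart lam r c g x = 0.
Proof. by move=> g0; rewrite (qpart_ext _ _ _ _ g0) qpart_zero. Qed.

Lemma std_quasi_part_anti r w x i j : form_germ w ->
  std_quasi_part lam r w x (pr j i) = - std_quasi_part lam r w x (pr i j).
Proof.
move=> gw; rewrite !std_quasi_part2 !pr0 !pr1 addnC -qpart_opp; last exact: gw.1.
apply: qpart_ext; have := form_germ2_anti gw; apply: filterS => y E.
exact: E.
Qed.

Lemma form_germ_std_quasi_part r w : form_germ w -> form_germ (std_quasi_part lam r w).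
Proof.
move=> gw; apply: form_germ2 => [i j|].
  exact: smooth_germ_qpart.
by apply: near0W => x i j; exact: std_quasi_part_anti.
Qed.


(** Each derivative adds the weight of the missing index, so the three terms are parts with the same
    total weight [W], and the expression is the part of the closedness equation of [w]. *)
Lemma closed_std_quasi_part r w x a b c : closed_form w ->
  partial a (fun y => std_quasi_part lam r w y (pr b c)) x -
  partial b (fun y => std_quasi_part lam r w y (pr a c)) x +
  partial c (fun y => std_quasi_part lam r w y (pr a b)) x = 0.
Proof.
move=> cw; have [gw _] := cw.
pose W := (lam a + lam b + lam c)%N.
have P p q u : (lam q + lam u + lam p)%N = W ->
    partial p (fun y => std_quasi_part lam r w y (pr q u)) x =
    qpart lam r W (partial p (fun y => w y (pr q u))) x.
  move=> <-; rewrite -partial_qpart//; last exact: gw.1.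
  apply: (f_equal (fun g => partial p g x)); apply/funext => y.
  by rewrite std_quasi_part2 pr0 pr1.
rewrite (P a b c); last by rewrite /W addnC addnA.
rewrite (P b a c); last by rewrite /W addnAC.
rewrite (P c a b)//.
have sp p q u := smooth_germ_partial p (gw.1 (pr q u)).
have s1 := smooth_germD (smooth_germZ 1 (sp a b c)) (smooth_germZ (-1) (sp b a c)).
have e1 := qpart_lin lam r W 1 (-1) x (sp a b c) (sp b a c).
have e2 := qpart_lin lam r W 1 1 x s1 (sp c a b).
move: e2; rewrite e1 !mul1r mulN1r => <-.
apply: qpart_ext0; have [_] := (closed_formP w).1 cw; apply: filterS => y E.
by rewrite !mul1r mulN1r; exact: E.
Qed.

(** Cartan's formula for the Euler field: contracting a closed form of quasi-degree [r]
    with it and dividing by [r] gives a primitive. *)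
Lemma std_quasi_part_potential r w : closed_form w -> exists eta,
  [/\ smooth1 eta, forall l, whomogeneous lam (r%:R - (lam l)%:R) (eta l) &
    \forall x \near (0 : Rm), forall I, std_quasi_part lam r w x I = dform eta x I].
Proof.
move=> cw; have [gw _] := cw.
pose W i j x := std_quasi_part lam r w x (pr i j).
have hW i j : whomogeneous lam (r%:R - (lam i + lam j)%:R) (W i j).
  have := whomogeneous_qpart lam r (lam i + lam j) (fun y => w y (pr i j)).
  by apply: whomogeneous_eq => // x; rewrite /W std_quasi_part2 pr0 pr1.
have sW i j := (hW i j).1.
pose eta l x := r%:R^-1 * \sum_i (lam i)%:R * (x 0 i * W i l x).
have hterm i l : whomogeneous lam (r%:R - (lam l)%:R) (fun x : Rm => x 0 i * W i l x).
  apply: whomogeneous_eq (whomogeneousM (whomogeneous_coord lam i) (hW i l)) => //.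
  by rewrite natrD; ring.
have heta l : whomogeneous lam (r%:R - (lam l)%:R) (eta l).
  by apply/whomogeneousZ/whomogeneous_sum => i _; exact/whomogeneousZ/hterm.
exists eta; split=> // [l|]; first exact: (heta l).1.
(* In degree 0 the part is zero because weights are positive, and [eta] is zero because the inverse
   of 0 is 0. *)
have [r0|r0] := posnP r.
  apply: near0W => x I; rewrite std_quasi_part2 qpart_gt ?r0 ?addn_gt0 ?lam_gt0//.
  rewrite dformE /d1 (_ : eta = fun _ _ => 0) ?/partial ?derive_cst ?subr0//.
  by apply/funext => l; apply/funext => y; rewrite /eta r0 invr0 mul0r.
have rn0 : r%:R != 0 :> R by rewrite pnatr_eq0 -lt0n.
have st i l := (hterm i l).1.
have D : \forall x \near (0 : Rm), forall k l, partial k (eta l) x =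
    r%:R^-1 * ((lam k)%:R * W k l x + \sum_i (lam i)%:R * x 0 i * partial k (W i l) x).
  apply: near_forall => k; apply: near_forall => l.
  have sz i : smooth_germ (fun x : Rm => (lam i)%:R * (x 0 i * W i l x)).
    exact: smooth_germZ.
  have E1 := near_deriveZ (basis_vec k) r%:R^-1
    (@smooth_germ_sum R Rm _ (index_enum 'I_m) predT _ (fun i _ => sz i)).
  have E2 := near_derive_sum predT (basis_vec k) sz.
  have E3 := near_forall (fun i => near_deriveZ (basis_vec k) (lam i)%:R (st i l)).
  have E4 := near_forall (fun i =>
    near_deriveM (basis_vec k) (@smooth_germ_coord R m i) (sW i l)).
  apply: filterS3 E1 E2 (filterI E3 E4) => x {}E1 {}E2 [{}E3 {}E4].
  apply: (etrans E1); apply: (f_equal (fun z => _ * z)); apply: (etrans E2).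
  have -> : (lam k)%:R * W k l x = \sum_i W i l x * ((lam i)%:R * (i == k)%:R).
    by rewrite sum_delta.
  rewrite -big_split; apply: eq_bigr => i _; apply: (etrans (E3 i)); rewrite (E4 i).
  rewrite /basis_vec derive_coord_basis [k == i]eq_sym.
  rewrite /= -/(basis_vec k) /partial.
  by move: (derive (W i l) x _) (W i l x) => z z2; ring.
have hWn := near_forall (fun i => near_forall (fun j => (hW i j).2)).
apply: filterS2 D hWn => x D hWx I; rewrite dformE /d1 !D.
rewrite {1}(prE I); move: (I ord0) (I ord_max) => k l.
rewrite -/(W k l x).
have anti i j : W j i x = - W i j x by exact: std_quasi_part_anti.
have cl i : partial i (W k l) x = partial k (W i l) x - partial l (W i k) x.
  have := closed_std_quasi_part r x i k l cw => /eqP.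
  by rewrite -addrA addr_eq0 opprD opprK => /eqP.
(* By closedness the derivatives combine into the Euler derivative of [W k l], equal to
   [r - lam k - lam l] times it; the two remaining terms contribute [lam k + lam l], leaving the
   factor [r]. *)
rewrite -mulrBr opprD addrACA -sumrB.
rewrite (eq_bigr (fun i => (lam i)%:R * x 0 i * partial i (W k l) x)); last first.
  by move=> i _; rewrite cl mulrBr.
rewrite (hWx k l) (anti k l) natrD.
by move: (W k l x) => z; field.
Qed.

End Potential.

(** * Quasi-homogeneous parts of restrictions *)

Section QuasiParts.
Context {R : realType} {m : nat}.
Local Notation Rm := 'rV[R]_m.
Implicit Types (eta be th : 'I_m -> Rm -> R) (w al : kform R m 2) (x : Rm).
Variables (lam : 'I_m -> nat) (f : R -> Rm) (A : Rm).
Hypothesis lam_gt0 : forall i, (0 < lam i)%N.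
Hypothesis f_smooth : smooth_germ f.
Hypothesis fE : \forall t \near (0 : R), forall i, f t 0 i = A 0 i * t ^+ lam i.

Definition qpart1 r th : 'I_m -> Rm -> R := fun i => qpart lam r (lam i) (th i).

Lemma smooth1_qpart1 r th : smooth1 (qpart1 r th).
Proof. by move=> i; exact: smooth_germ_qpart. Qed.

Lemma dform_qpart1 r th x I : smooth1 th -> dform (qpart1 r th) x I =
  qpart lam r (lam (I ord0) + lam (I ord_max))%N (d1 th (I ord0) (I ord_max)) x.
Proof.
move=> sth; rewrite dformE; move: (I ord0) (I ord_max) => k l.
have sp i j := smooth_germ_partial i (sth j).
rewrite /d1 /qpart1 !partial_qpart// [(lam l + lam k)%N]addnC.
have := qpart_lin lam r (lam k + lam l)%N 1 (-1) x (sp k l) (sp l k).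
rewrite mul1r mulN1r => <-; congr (qpart lam r _ _ x).
by apply/funext => y; rewrite mul1r mulN1r.
Qed.

(** Taking parts commutes with [d] and preserves vanishing on [f], so it can be applied to both
    witnesses [al] and [be]. *)
Lemma same_restriction_qpart1 r th : smooth1 th ->
  same_restriction f (dform th) (@zero_form R m 2) ->
  same_restriction f (dform (qpart1 r th)) (@zero_form R m 2).
Proof.
move=> sth /same_restrictionP[al [be [ga sb va vb E]]]; apply/same_restrictionP.
exists (std_quasi_part lam r al), (qpart1 r be); split.
- exact: form_germ_std_quasi_part.
- exact: smooth1_qpart1.
- have H i j : \forall t \near (0 : R), std_quasi_part lam r al (f t) (pr i j) = 0.
    have H : \forall t \near (0 : R),
        qpart lam r (lam i + lam j) (fun y => al y (pr i j)) (f t) = 0.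
      apply: (@qpart_vanishes R m lam f A) => // [|n _]; first exact: ga.1.
      rewrite -[RHS](@tcoef_zero R n); apply: tcoef_ext.
      by apply: filterS va => t vt; exact: vt.
    by apply: filterS H => t; rewrite std_quasi_part2 pr0 pr1.
  have := near_forall (fun i => near_forall (H i)).
  by apply: filterS => t Ht I; rewrite (prE I).
- move=> i; apply: (@qpart_vanishes R m lam f A) => // n _.
  by rewrite -[RHS](@tcoef_zero R n); apply: tcoef_ext; exact: (vb i).
- apply: near0W => x I; rewrite subr0 !dform_qpart1// std_quasi_part2.
  have sd := smooth_d1 (I ord0) (I ord_max) sb.
  have := qpart_lin lam r (lam (I ord0) + lam (I ord_max))%N 1 1 x (ga.1 I) sd.
  rewrite !mul1r => <-; apply: qpart_ext; apply: filterS E => y /(_ I).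
  by rewrite subr0 !dformE !mul1r.
Qed.

Lemma qpart1_curve r th i : smooth1 th -> \forall t \near (0 : R),
  qpart1 r th i (f t) =
  if (lam i <= r)%N then tcoef (r - lam i) (th i \o f) * t ^+ (r - lam i) else 0.
Proof.
move=> sth; have := qpart_curve fE r (lam i) (th i); apply: filterS => t E.
rewrite /qpart1 E; case: leqP => lr; last by rewrite qpart_gt// mulr0.
by rewrite -(@tcoef_curve R m lam f A lam_gt0 f_smooth fE (r - lam i) (lam i))// ?subnK// mulrC.
Qed.

Section Basis.
Variables (p : nat) (a : 'I_p -> kform R m 2) (delta : 'I_p -> nat).
Variable E : 'I_p -> 'I_m -> Rm -> R.
Hypothesis E_smooth : forall j, smooth1 (E j).
Hypothesis E_hom : forall j l, whomogeneous lam ((delta j)%:R - (lam l)%:R) (E j l).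
Hypothesis aE : forall j, same_restriction f (a j) (dform (E j)).
Hypothesis a_free : forall c : 'I_p -> R,
  same_restriction f (lin_comb predT c a) (@zero_form R m 2) -> forall j, c j = 0.

Lemma potential_curve j l : exists2 c, \forall t \near (0 : R),
  E j l (f t) = c * t ^+ (delta j - lam l) & ((delta j < lam l)%N -> c = 0).
Proof.
have [sE _] := E_hom j l.
apply: (@euler_line_sub R _ _ (E j l \o f)).
  exact: (smooth_germ_on_curve lam_gt0 f_smooth fE).
exact: (whomogeneous_curve lam_gt0 f_smooth fE (E_hom j l)).
Qed.

Lemma near_dform_sum (P : pred 'I_p) (b : 'I_p -> R) : \forall x \near (0 : Rm), forall I,
  dform (fun i y => \sum_(j < p | P j) b j * E j i y) x I =
  \sum_(j < p | P j) b j * dform (E j) x I.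
Proof.
have H k l : \forall x \near (0 : Rm),
    partial k (fun y => \sum_(j < p | P j) b j * E j l y) x =
    \sum_(j < p | P j) b j * partial k (E j l) x.
  have E1 := near_derive_sum P (basis_vec k) (fun j => smooth_germZ (b j) (E_smooth j l)).
  have E2 := near_forall
    (fun j => near_deriveZ (basis_vec k) (b j) (E_smooth j l)).
  apply: filterS2 E1 E2 => x {}E1 {}E2; apply: (etrans E1).
  by apply: eq_bigr => j _; exact: E2.
have := near_forall (fun k => near_forall (H k)); apply: filterS => x {}H I.
rewrite dformE /d1 !H -sumrB; apply: eq_bigr => j _.
by rewrite dformE /d1 mulrBr.
Qed.

Lemma smooth1_comb (P : pred 'I_p) (b : 'I_p -> R) :
  smooth1 (fun i y => \sum_(j < p | P j) b j * E j i y).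
Proof. by move=> i; apply: smooth_germ_sum => j _; apply: smooth_germZ; exact: E_smooth. Qed.

Lemma lin_comb_potential (P : pred 'I_p) (b : 'I_p -> R) :
  same_restriction f (lin_comb P b a) (dform (fun i y => \sum_(j < p | P j) b j * E j i y)).
Proof.
apply: (same_restriction_trans (w2 := fun x I => \sum_(j < p | P j) b j * dform (E j) x I)).
  by apply: same_restriction_sum => j _; exact: aE.
apply: same_restriction_sym; apply: same_restriction_near; exact: near_dform_sum.
Qed.

(** The difference [th] of [eta] and [B], the combination of the [E j], has zero restriction, hence
    so has its part of degree [r]. On [f] that part equals [- C], because [eta] contributes nothing
    in degree [r] and each [E j] is a monomial there. So [dform C] has zero restriction and freeness
    applies. *)
Lemma part_coef eta (b : 'I_p -> R) r : smooth1 eta ->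
  same_restriction f (dform eta) (lin_comb predT b a) ->
  (forall i n, (n + lam i)%N = r -> tcoef n (eta i \o f) = 0) ->
  forall j, delta j = r -> b j = 0.
Proof.
move=> seta Heta eta0.
pose B i y := \sum_(j < p) b j * E j i y.
have sB : smooth1 B := smooth1_comb predT b.
pose th i y := 1 * eta i y + (-1) * B i y.
have sth : smooth1 th by move=> i; apply: smooth_germD; exact: smooth_germZ.
have th0 : same_restriction f (dform th) (@zero_form R m 2).
  apply: (same_restriction_trans (w2 := fun x I => 1 * dform eta x I + -1 * dform B x I)).
    by apply: same_restriction_near; exact: near_dform_lin.
  have H := same_restriction_trans Heta (lin_comb_potential predT b).
  have := same_restriction_lin 1 (-1) H (same_restriction_refl f (dform B)).
  by apply: same_restriction_ext => x I //; rewrite mul1r mulN1r subrr.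
have := same_restriction_qpart1 r sth th0 => thr0.
pose C i y := \sum_(j < p | delta j == r) b j * E j i y.
have sC : smooth1 C := smooth1_comb (fun j => delta j == r) b.
(* Both summands are polynomials in [t] on the curve, so this vanishing is exact even though [eta]
   is known only through Taylor coefficients. *)
have vC : vanish1 f (fun i y => 1 * qpart1 r th i y + 1 * C i y).
  move=> i; have Hc : forall j, {c | (\forall t \near (0 : R),
      E j i (f t) = c * t ^+ (delta j - lam i)) & ((delta j < lam i)%N -> c = 0)}.
    by move=> j; apply: cid2; exact: potential_curve.
  pose c j := s2val (Hc j).
  have cE j : \forall t \near (0 : R), E j i (f t) = c j * t ^+ (delta j - lam i) := s2valP (Hc j).
  have c0 j : (delta j < lam i)%N -> c j = 0 := s2valP' (Hc j).
  have sEf j : smooth_germ (E j i \o f).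
    by apply: (smooth_germ_on_curve lam_gt0 f_smooth fE); exact: E_smooth.
  have cEn := near_forall cE.
  have tB n : (n + lam i)%N = r -> tcoef n (B i \o f) = \sum_(j < p | delta j == r) b j * c j.
    move=> nr; rewrite (@tcoef_sum R n _ predT (fun j t => b j * (E j i \o f) t)); last first.
      by move=> j; exact: smooth_germZ.
    rewrite [RHS]big_mkcond; apply: eq_bigr => j _; rewrite tcoefZ//.
    rewrite (tcoef_ext n (cE j)) tcoef_monomial.
    have [dr|/eqP dr] := eqVneq (delta j) r; first by rewrite dr -nr addnK eqxx mulr1.
    have [dl|ld] := ltnP (delta j) (lam i); first by rewrite c0// mul0r mulr0.
    rewrite (_ : n == _ = false) ?mulr0//; apply/negP => /eqP nd.
    by apply: dr; rewrite -nr nd subnK.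
  apply: filterS2 (qpart1_curve r i sth) cEn => t -> cEt.
  have -> : C i (f t) = \sum_(j < p | delta j == r) b j * (c j * t ^+ (delta j - lam i)).
    by apply: eq_bigr => j _; rewrite cEt.
  case: leqP => lr.
    have nr := subnK lr; rewrite (@tcoef_ext R _ _ (fun t => 1 * (eta i \o f) t + -1 * (B i \o f) t)).
      have se : smooth_germ (eta i \o f) := smooth_germ_on_curve lam_gt0 f_smooth fE (seta i).
      have sBf : smooth_germ (B i \o f) := smooth_germ_on_curve lam_gt0 f_smooth fE (sB i).
      rewrite tcoefD; try exact: smooth_germZ.
      rewrite !tcoefZ// eta0// tB// mulr0 add0r mulN1r !mul1r mulNr mulr_suml.
      rewrite addrC; apply/eqP; rewrite subr_eq0; apply/eqP; apply: eq_bigr => j /eqP dr.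
      by rewrite dr mulrA.
    exact: near0W.
  rewrite mulr0 add0r mul1r big1// => j /eqP dr.
  by rewrite c0 ?mul0r ?mulr0// dr.
have CC : same_restriction f (dform C) (@zero_form R m 2).
  have sq := smooth1_qpart1 r th.
  have H : same_restriction f (fun x I => 1 * dform (qpart1 r th) x I + 1 * dform C x I)
      (@zero_form R m 2).
    apply: same_restriction_trans (dform_vanish _ vC); last first.
      by move=> i; apply: smooth_germD; apply: smooth_germZ.
    apply: same_restriction_sym; apply: same_restriction_near; exact: near_dform_lin.
  have := same_restriction_lin 1 (-1) H thr0.
  apply: same_restriction_ext => x I; last by rewrite /zero_form !mulr0 addr0.
  by move: (dform _ x I) (dform _ x I) => u v; ring.
have := same_restriction_trans (lin_comb_potential (fun j => delta j == r) b) CC.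
move=> H j dj.
suff /(_ j) : forall j, (if delta j == r then b j else 0) = 0 by rewrite dj eqxx.
apply: a_free; apply: same_restriction_ext H => // x I; rewrite /lin_comb big_mkcond.
by apply: eq_bigr => i _; case: ifP => //; rewrite mul0r.
Qed.

(** Nothing is assumed on [eta] beyond degree [D]: an expansion in the basis is given, and
    [part_coef] removes its terms of degree at most [D] one by one. *)
Lemma restriction_high eta D : smooth1 eta ->
  (exists c, same_restriction f (dform eta) (lin_comb predT c a)) ->
  (forall i n, (n + lam i <= D)%N -> tcoef n (eta i \o f) = 0) ->
  exists b, same_restriction f (dform eta) (lin_comb (fun j => (D < delta j)%N) b a).
Proof.
move=> seta [c Hc] eta0; exists c; apply: (same_restriction_trans Hc).
apply: same_restriction_near; apply: near0W => x I; rewrite /lin_comb [RHS]big_mkcond.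
apply: eq_bigr => j _; case: ltnP => // jD.
rewrite (part_coef seta Hc _ (erefl (delta j))) ?mul0r// => i n nr.
by apply: eta0; rewrite nr.
Qed.

End Basis.
End QuasiParts.

(** * Congruences modulo powers of [t] *)

Section Congruences.
Context {R : realType}.
Implicit Types (u v : R -> R) (N : nat).

(** The quotient is required to be smooth, so that congruences can be multiplied and determine the
    Taylor coefficients below [N]. *)
Definition modt N u v := exists2 P : R -> R, smooth_germ P &
  \forall t \near (0 : R), u t - v t = t ^+ N * P t.

Lemma modt_near N u v : (\forall t \near (0 : R), u t = v t) -> modt N u v.
Proof.
move=> uv; exists (fun=> 0); first exact: smooth_germ_cst.
by apply: filterS uv => t ->; rewrite subrr mulr0.
Qed.

Lemma modt_trans N u v w : modt N u v -> modt N v w -> modt N u w.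
Proof.
move=> [P sP HP] [Q sQ HQ]; exists (fun t => P t + Q t); first exact: smooth_germD.
by apply: filterS2 HP HQ => t HP HQ; rewrite mulrDr -HP -HQ subrKA.
Qed.

Lemma modtD N u v u' v' : modt N u v -> modt N u' v' ->
  modt N (fun t => u t + u' t) (fun t => v t + v' t).
Proof.
move=> [P sP HP] [Q sQ HQ]; exists (fun t => P t + Q t); first exact: smooth_germD.
by apply: filterS2 HP HQ => t HP HQ; rewrite mulrDr -HP -HQ opprD addrACA.
Qed.

Lemma modtM N u v u' v' : smooth_germ u' -> smooth_germ v -> modt N u v -> modt N u' v' ->
  modt N (fun t => u t * u' t) (fun t => v t * v' t).
Proof.
move=> su' sv [P sP HP] [Q sQ HQ]; exists (fun t => P t * u' t + v t * Q t).
  by apply: smooth_germD; exact: smooth_germM.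
apply: filterS2 HP HQ => t HP HQ.
have -> : t ^+ N * (P t * u' t + v t * Q t) = (t ^+ N * P t) * u' t + v t * (t ^+ N * Q t).
  by ring.
by rewrite -HP -HQ; ring.
Qed.

Lemma modtZ N c u v : modt N u v -> modt N (fun t => c * u t) (fun t => c * v t).
Proof.
move=> [P sP HP]; exists (fun t => c * P t); first exact: smooth_germZ.
by apply: filterS HP => t HP; rewrite -mulrBr HP mulrCA.
Qed.

Lemma modt_sum N (I : Type) (s : seq I) (Q : pred I) (u v : I -> R -> R) :
  (forall i, Q i -> modt N (u i) (v i)) ->
  modt N (fun t => \sum_(i <- s | Q i) u i t) (fun t => \sum_(i <- s | Q i) v i t).
Proof.
move=> H; elim: s => [|i s IH].
  by apply: modt_near; apply: near0W => t; rewrite !big_nil.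
have E (w : I -> R -> R) : (fun t => \sum_(i <- i :: s | Q i) w i t) =
    (fun t => if Q i then w i t + \sum_(i <- s | Q i) w i t else \sum_(i <- s | Q i) w i t).
  by apply/funext => t; rewrite big_cons.
rewrite !E; case: (boolP (Q i)) => Qi //.
by apply: modtD => //; exact: H.
Qed.

Lemma modtX N k u v : modt N u v ->
  modt (k + N) (fun t => t ^+ k * u t) (fun t => t ^+ k * v t).
Proof.
move=> [P sP HP]; exists P => //.
by apply: filterS HP => t HP; rewrite -mulrBr HP exprD mulrA.
Qed.

Lemma modtW N N' u v : (N' <= N)%N -> modt N u v -> modt N' u v.
Proof.
move=> NN [P sP HP]; exists (fun t => t ^+ (N - N') * P t).
  by apply: smooth_germM => //; apply: smooth_germX; exact: smooth_germ_line.
by apply: filterS HP => t ->; rewrite mulrA -exprD subnKC.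
Qed.

Lemma modt_ext N u v u' v' : (\forall t \near (0 : R), u t = u' t) ->
  (\forall t \near (0 : R), v t = v' t) -> modt N u v -> modt N u' v'.
Proof.
move=> E1 E2 [P sP HP]; exists P => //.
by apply: filterS3 E1 E2 HP => t -> ->.
Qed.

Lemma modt_tcoef N n u : modt N u (fun=> 0) -> (n < N)%N -> tcoef n u = 0.
Proof.
move=> [P sP HP] nN.
rewrite (@tcoef_ext R n u (fun t => t ^+ N * P t)); last first.
  by apply: filterS HP => t <-; rewrite subr0.
by rewrite tcoef_mulXn// leqNgt nN.
Qed.

Lemma modt_binomial D z M :
  modt (D + D) (fun t => (1 + z * t ^+ D) ^+ M) (fun t => 1 + M%:R * z * t ^+ D).
Proof.
have sT := smooth_germ_monomial z D.
have s1 : smooth_germ (fun t : R => 1 + z * t ^+ D).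
  by apply: smooth_germD => //; exact: smooth_germ_cst.
elim: M => [|M IH].
  by apply: modt_near; apply: near0W => t; rewrite !mul0r addr0.
have H := modtM (smooth_germX M s1) s1 (modt_near (D + D) (near0W (fun t => erefl))) IH.
apply: modt_trans (modt_ext _ (near0W (fun t => erefl)) H) _.
  by apply: near0W => t; rewrite exprS.
exists (fun=> M%:R * z ^+ 2); first exact: smooth_germ_cst.
apply: near0W => t; rewrite exprD -natr1.
by move: (t ^+ D) => T; ring.
Qed.

Lemma modt_linear_part D (c : nat -> R) n :
  modt (D + D) (fun t => \sum_(i < n.+2) c i * (t ^+ D) ^+ i)
    (fun t => c 0%N + c 1%N * t ^+ D).
Proof.
exists (fun t => \sum_(i < n) c i.+2 * (t ^+ D) ^+ i).
  apply: smooth_germ_sum => i _; apply: smooth_germZ; do 2!apply: smooth_germX.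
  exact: smooth_germ_line.
have E (a b S : R) : a + (b + S) - (a + b) = S by ring.
apply: near0W => t; rewrite !big_ord_recl expr0 mulr1 /bump/= expr1 E.
by rewrite mulr_sumr exprD; apply: eq_bigr => i _; rewrite !exprS; ring.
Qed.

(** A nonzero Taylor coefficient reveals the eigenvalue: this is how a real degree is recognised as
    an integer. *)
Lemma tcoef_eulerE n e u : smooth_germ u ->
  (\forall t \near (0 : R), t * 'D_1 u t = e * u t) -> (n%:R - e) * tcoef n u = 0.
Proof.
move=> su E; have := tcoef_ext n E.
rewrite tcoefZ// tcoef_mulX; last exact: smooth_germ_derive.
rewrite mulrBl => <-; case: n => [|n]; first by rewrite mul0r subrr.
by rewrite tcoef_derive subrr.
Qed.

Lemma monomial_eq0 c n : (\forall t \near (0 : R), c * t ^+ n = 0) -> c = 0.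
Proof.
by move=> /(tcoef_ext n); rewrite tcoef_monomial eqxx mulr1 tcoef_zero.
Qed.

End Congruences.

(** * Contraction, Lie derivative and restrictions *)

Section Contraction.
Context {R : realType} {m : nat}.
Local Notation Rm := 'rV[R]_m.
Implicit Types (eta be : 'I_m -> Rm -> R) (w al : kform R m 2) (x : Rm) (X : Rm -> Rm).
Implicit Types f : R -> Rm.

Definition contr X w : 'I_m -> Rm -> R := fun i x => \sum_j X x 0 j * w x (pr j i).

Definition lie1 X eta : 'I_m -> Rm -> R := fun i x =>
  \sum_j X x 0 j * partial j (eta i) x + \sum_j partial i (component X j) x * eta j x.

Lemma smooth_germ_component X j : smooth_germ X -> smooth_germ (component X j).
Proof. by move=> /smooth_germ_rVP /(_ j). Qed.

Lemma smooth1_contr X w : smooth_germ X -> form_germ w -> smooth1 (contr X w).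
Proof.
move=> sX gw i; apply: smooth_germ_sum => j _; apply: smooth_germM; last exact: gw.1.
exact: (smooth_germ_component j sX).
Qed.

Lemma smooth1_lie1 X eta : smooth_germ X -> smooth1 eta -> smooth1 (lie1 X eta).
Proof.
move=> sX se i; have sXj j := smooth_germ_component j sX.
apply: smooth_germD; apply: smooth_germ_sum => j _.
  exact: smooth_germM (sXj j) (smooth_germ_partial j (se i)).
exact: smooth_germM (smooth_germ_partial i (sXj j)) (se j).
Qed.

Lemma near_dform_exact (phi : Rm -> R) : smooth_germ phi ->
  \forall x \near (0 : Rm), forall I, dform (fun i => partial i phi) x I = 0.
Proof.
move=> sphi; have S i j := near_schwarz (basis_vec i) (basis_vec j) sphi.
have := near_forall (fun i => near_forall (S i)); apply: filterS => x E I.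
by rewrite dformE /d1; apply/eqP; rewrite subr_eq0; apply/eqP; exact: E.
Qed.

(** Cartan's formula: [lie1 X eta] is the contraction of [d eta] plus the differential of
    [phi = eta(X)], and [d] kills the latter. *)
Lemma near_dform_contr X eta : smooth_germ X -> smooth1 eta ->
  \forall x \near (0 : Rm), forall I, dform (contr X (dform eta)) x I = dform (lie1 X eta) x I.
Proof.
move=> sX se; pose phi (x : Rm) := \sum_j X x 0 j * eta j x.
have sXj j := smooth_germ_component j sX.
have st j : smooth_germ (fun x : Rm => X x 0 j * eta j x).
  by apply: smooth_germM => //; exact: sXj.
have sphi : smooth_germ phi by exact: smooth_germ_sum.
have E : \forall x \near (0 : Rm), forall i,
    contr X (dform eta) i x = 1 * lie1 X eta i x + -1 * partial i phi x.
  apply: near_forall => i.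
  have E1 := near_derive_sum predT (basis_vec i) st.
  have E2 := near_forall (fun j => near_deriveM (basis_vec i) (sXj j) (se j)).
  apply: filterS2 E1 E2 => x E1 E2.
  have {}E1 : partial i phi x = \sum_j X x 0 j * partial i (eta j) x +
      \sum_j partial i (component X j) x * eta j x.
    apply: (etrans E1); rewrite -big_split; apply: eq_bigr => j _.
    by apply: (etrans (E2 j)); rewrite /= [eta j x * _]mulrC.
  rewrite E1 /contr /lie1 mul1r mulN1r opprD addrACA subrr addr0.
  rewrite -sumrN -big_split; apply: eq_bigr => j _.
  by rewrite dformE pr0 pr1 /d1 /= mulrBr addrC.
have H : \forall x \near (0 : Rm), forall I, dform (contr X (dform eta)) x I =
    dform (fun i x => 1 * lie1 X eta i x + -1 * partial i phi x) x I.
  have D k l : \forall x \near (0 : Rm), partial k (contr X (dform eta) l) x =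
      partial k (fun x => 1 * lie1 X eta l x + -1 * partial l phi x) x.
    by apply: near_derive; apply: filterS E => x; exact.
  have := near_forall (fun k => near_forall (D k)); apply: filterS => x {}D I.
  by rewrite !dformE /d1 !D.
have sl := smooth1_lie1 sX se.
have sp i : smooth_germ (partial i phi) := smooth_germ_partial i sphi.
apply: filterS3 H (near_dform_lin 1 (-1) sl sp) (near_dform_exact sphi) => x {}H L Z I.
by rewrite H L Z mulr0 addr0 mul1r.
Qed.

Lemma near_dform_ext be1 be2 : (\forall x \near (0 : Rm), forall i, be1 i x = be2 i x) ->
  \forall x \near (0 : Rm), forall I, dform be1 x I = dform be2 x I.
Proof.
move=> E; have D k l : \forall x \near (0 : Rm), partial k (be1 l) x = partial k (be2 l) x.
  by apply: near_derive; apply: filterS E => x; exact.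
have := near_forall (fun k => near_forall (D k)); apply: filterS => x {}D I.
by rewrite !dformE /d1 !D.
Qed.

(** [L_X be] vanishes on [f] when [be] does, because [X] is tangent to [f]. *)
Lemma vanish1_lie1 f X be : liftable f X -> smooth_germ f -> f 0 = 0 -> smooth1 be ->
  vanish1 f be -> vanish1 f (lie1 X be).
Proof.
move=> [sX [g [sg Xf]]] sf f0 sb vb i.
have D0 : \forall t \near (0 : R), 'D_1 (be i \o f) t = 0.
  have := near_derive (1 : R) (vb i); apply: filterS => t E.
  by apply: (etrans E); exact: derive_cst.
have dfc := smooth_germ_differentiable sf.
apply: filterS3 Xf (filterI (near_forall vb) dfc)
  (filterI D0 (near_derive_comp (1 : R) f0 sf (sb i))) => t Xt [v df] [D1 D2].
rewrite /lie1 [X in _ + X]big1 ?addr0; last by move=> j _; rewrite v mulr0.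
transitivity (g t * 'D_1 (be i \o f) t); last by rewrite D1 mulr0.
rewrite D2 mulr_sumr; apply: eq_bigr => j _.
rewrite -Xt derive1E mxE -derive_coord//.
by rewrite /GRing.scale/= mulrA.
Qed.

(** For closed forms this says that the Lie derivative acts on restrictions. The contraction of [al]
    vanishes on [f]; that of [dform be] has the same differential as [lie1 X be], which vanishes on
    [f] by liftability. *)
Lemma same_restriction_contr f X w1 w2 : liftable f X -> smooth_germ f -> f 0 = 0 ->
  form_germ w1 -> form_germ w2 -> same_restriction f w1 w2 ->
  same_restriction f (dform (contr X w1)) (dform (contr X w2)).
Proof.
move=> lX sf f0 g1 g2 /same_restrictionP[al [be [ga sb va vb E]]].
have sX := lX.1.
have s1 := smooth1_contr sX g1; have s2 := smooth1_contr sX g2.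
have sa := smooth1_contr sX ga; have sdb := smooth1_contr sX (form_germ_dform sb).
have E1 : \forall x \near (0 : Rm), forall i, contr X w1 i x =
    1 * contr X w2 i x + 1 * (1 * contr X al i x + 1 * contr X (dform be) i x).
  apply: filterS E => x E i; rewrite /contr !mul1r -!big_split; apply: eq_bigr => j _ /=.
  by rewrite -!mulrDr -E addrC subrK.
have sab : smooth1 (fun i x => 1 * contr X al i x + 1 * contr X (dform be) i x).
  by move=> i; apply: smooth_germD; exact: smooth_germZ.
have L1 := near_dform_lin 1 1 s2 sab.
have L2 := near_dform_lin 1 1 sa sdb.
have va1 : vanish1 f (contr X al).
  by move=> i; apply: filterS va => t v; rewrite /contr big1// => j _; rewrite v mulr0.
have vl := vanish1_lie1 lX sf f0 sb vb.
have H1 := dform_vanish sa va1.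
have H2 := dform_vanish (smooth1_lie1 sX sb) vl.
have H3 := same_restriction_lin 1 1 H1 H2.
have H4 := same_restriction_lin 1 1 (same_restriction_refl f (dform (contr X w2))) H3.
apply: same_restriction_trans (same_restriction_trans _ H4) _.
  apply: same_restriction_near.
  apply: filterS3 (near_dform_ext E1) L1 (filterI L2 (near_dform_contr sX sb)).
  by move=> x {}E1 {}L1 [{}L2 C] I; rewrite E1 L1 L2 C.
by apply: same_restriction_near; apply: near0W => x I; rewrite !mulr0 !addr0 mulr0 addr0 mul1r.
Qed.

(** Cartan's formula again: the derivative of [w] along [X] is rewritten by closedness as the
    difference of two contracted derivatives. *)
Lemma near_lie_form_closed X w : smooth_germ X -> closed_form w ->
  \forall x \near (0 : Rm), forall I, lie_form X w x I = dform (contr X w) x I.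
Proof.
move=> sX cw; have [gw _] := cw.
have sXj j := smooth_germ_component j sX.
have D k l : \forall x \near (0 : Rm), partial k (contr X w l) x =
    \sum_j (X x 0 j * partial k (fun y => w y (pr j l)) x + w x (pr j l) * partial k (component X j) x).
  have st j : smooth_germ (fun x : Rm => X x 0 j * w x (pr j l)).
    by apply: smooth_germM; [exact: sXj|exact: gw.1].
  have E1 := near_derive_sum predT (basis_vec k) st.
  have E2 := near_forall (fun j => near_deriveM (basis_vec k) (sXj j) (gw.1 (pr j l))).
  apply: filterS2 E1 E2 => x E1 E2; apply: (etrans E1).
  by apply: eq_bigr => j _; exact: (E2 j).
have dw I := smooth_germ_differentiable (gw.1 I).
have dws : \forall x \near (0 : Rm), forall k l, differentiable (fun y => w y (pr k l)) x.
  by apply: near_forall => k; apply: near_forall => l; exact: dw.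
have DD := near_forall (fun k => near_forall (D k)).
apply: filterS3 DD ((closed_formP w).1 cw).2 (filterI dws (form_germ2_anti gw)) => x {}DD cl [{}dws an] I.
rewrite dformE /d1 !DD /lie_form.
move: (prE I); set k := I ord0; set l := I ord_max => EI.
rewrite [in LHS]EI derive_rV// !big_ord_recl big_ord0 addr0.
rewrite (_ : lift ord0 ord0 = ord_max :> 'I_2); last by apply/val_inj.
have e1 j : [ffun l' : 'I_2 => if l' == ord0 then j else I l'] = pr j l.
  by rewrite [LHS]prE !ffunE.
have e2 j : [ffun l' : 'I_2 => if l' == ord_max then j else I l'] = pr k j.
  by rewrite [LHS]prE !ffunE.
rewrite -/k -/l -sumrB.
rewrite [X in _ + (X + _)](eq_bigr (fun j => partial k (component X j) x * w x (pr j l))); last first.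
  by move=> j _; rewrite -EI e1.
rewrite [X in _ + (_ + X)](eq_bigr (fun j => partial l (component X j) x * w x (pr k j))); last first.
  by move=> j _; rewrite -EI e2.
rewrite -!big_split; apply: eq_bigr => j _ /=.
have := cl j k l; rewrite /GRing.scale/= (an k j).
rewrite -/(partial j (fun y => w y (pr k l)) x).
move: (partial k (component X j) x) (partial l (component X j) x) => u v.
move: (partial j _ x) (partial k _ x) (partial l _ x) => p q s' H.
have -> : p = q - s' by rewrite -[LHS]subr0 -H; ring.
ring.
Qed.

End Contraction.

(** * A diffeomorphism tangent to a liftable field *)

Section TangentDiffeomorphism.
Context {R : realType} {m : nat}.
Local Notation Rm := 'rV[R]_m.
Implicit Types (q : Rm -> R) (x : Rm).
Variables (lam : 'I_m -> nat) (f : R -> Rm) (A : Rm).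
Hypothesis lam_gt0 : forall i, (0 < lam i)%N.
Hypothesis f_smooth : smooth_germ f.
Hypothesis fE : \forall t \near (0 : R), forall i, f t 0 i = A 0 i * t ^+ lam i.
Variables (X : Rm -> Rm) (D : nat).
Hypothesis D_gt0 : (0 < D)%N.
Hypothesis X_smooth : smooth_germ X.
Hypothesis X_hom : forall i, whomogeneous lam (lam i + D)%:R (component X i).

(** Homogeneity alone gives monomials [C i * t ^+ (lam i + D)]; tangency to [f] forces the vector
    [C] to be proportional to the velocity coefficients [lam i * A_i]. *)
Lemma liftable_curve : liftable f X -> exists b, \forall t \near (0 : R), forall i,
  X (f t) 0 i = b * (lam i)%:R * A 0 i * t ^+ (lam i + D).
Proof.
move=> [_ [g [sg Xf]]].
have HC i : exists c, \forall t \near (0 : R), X (f t) 0 i = c * t ^+ (lam i + D).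
  apply: (@euler_line R _ (component X i \o f)).
    apply: (smooth_germ_on_curve lam_gt0 f_smooth fE); exact: (X_hom i).1.
  exact: (whomogeneous_curve lam_gt0 f_smooth fE (X_hom i)).
have [C HCi] := choice HC; have {}HC := near_forall HCi.
have sfi i := (smooth_germ_rVP f).1 f_smooth i.
have L : \forall t \near (0 : R), forall i, t * (C i * t ^+ (lam i + D)) =
    g t * ((lam i)%:R * (A 0 i * t ^+ lam i)).
  have df := smooth_germ_differentiable f_smooth.
  apply: filterS3 Xf (filterI HC df) (filterI fE (near_derive_curve_coord lam_gt0 fE)).
  move=> t Xt [Ct dft] [ft Dt] i.
  by rewrite -Ct -Xt mxE derive1E -derive_coord// mulrCA Dt ft.
(* The unknown factor [g t] is eliminated between the components [i] and [j]. *)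
have H i j : C i * ((lam j)%:R * A 0 j) = C j * ((lam i)%:R * A 0 i).
  apply/eqP; rewrite -subr_eq0; apply/eqP.
  apply: (@monomial_eq0 R _ (1 + lam i + lam j + D)%N).
  apply: filterS L => t Lt; have Li := Lt i; have Lj := Lt j.
  have E : (t * (C i * t ^+ (lam i + D))) * ((lam j)%:R * (A 0 j * t ^+ lam j)) =
      (t * (C j * t ^+ (lam j + D))) * ((lam i)%:R * (A 0 i * t ^+ lam i)).
    by rewrite Li Lj; ring.
  move/eqP: E; rewrite -subr_eq0 => /eqP <-; rewrite !exprD expr1.
  by move: (t ^+ lam i) (t ^+ lam j) (t ^+ D) => *; ring.
(* A nonzero component of [A] determines [b]. If [A = 0] the curve is constant, all [C i] vanish and
   [b = 0] works. *)
have [[i0 Ai0]|A0] := pselect (exists i0, A 0 i0 != 0).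
  exists (C i0 / ((lam i0)%:R * A 0 i0)).
  have n0 : (lam i0)%:R * A 0 i0 != 0.
    by rewrite mulf_neq0// pnatr_eq0 -lt0n.
  apply: filterS HC => t Ct i; rewrite Ct; congr (_ * _).
  have E (a n u v : R) : n != 0 -> a / n * u * v * n = a * (u * v) by move=> ?; field.
  by apply: (mulIf n0); rewrite H E.
exists 0; apply: filterS HC => t Ct i; rewrite Ct !mul0r.
have Ai j : A 0 j = 0.
  by apply/eqP; apply/negPn/negP => Aj; apply: A0; exists j.
suff -> : C i = 0 by rewrite mul0r.
apply: (@monomial_eq0 R _ (lam i + D).+1); apply: filterS L => t' /(_ i).
by rewrite Ai mul0r !mulr0 exprS mulrCA => ->.
Qed.

Variables (b eps : R).
Hypothesis Xf : \forall t \near (0 : R), forall i,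
  X (f t) 0 i = b * (lam i)%:R * A 0 i * t ^+ (lam i + D).

Definition along q : Rm -> R := fun x => \sum_j component X j x * partial j q x.

Lemma whomogeneous_along e q : whomogeneous lam e q -> whomogeneous lam (e + D%:R) (along q).
Proof.
move=> hq; apply: whomogeneous_sum => j _.
apply: whomogeneous_eq (whomogeneousM (X_hom j) (whomogeneous_partial j hq)) => //.
by rewrite natrD; ring.
Qed.

(** On the curve [X] is [b t^D] times the Euler field, hence acts on [q \o f] as [b t^D] times
    [t d/dt]. *)
Lemma along_curve q c e : smooth_germ q ->
  (\forall t \near (0 : R), q (f t) = c * t ^+ e) ->
  \forall t \near (0 : R), along q (f t) = b * (e%:R * c) * t ^+ (e + D).
Proof.
move=> sq qf; have D1 := near_derive (1 : R) qf.
have D2 := near_deriveZ (1 : R) c (smooth_germX e (@smooth_germ_line R)).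
apply: filterS3 Xf (filterI fE (curve_euler lam_gt0 f_smooth fE sq)) (filterI D1 D2).
move=> t Xt [ft Et] [{}D1 {}D2].
have E : t * 'D_1 (q \o f) t = e%:R * c * t ^+ e.
  rewrite [X in _ * X]D1 D2 derive_pow; case: (e) => [|n]; first by rewrite !mul0r !mulr0.
  by rewrite /= exprS; ring.
have -> : b * (e%:R * c) * t ^+ (e + D) = b * t ^+ D * (e%:R * c * t ^+ e).
  by rewrite exprD; ring.
rewrite -E Et mulr_sumr; apply: eq_bigr => j _.
by rewrite /component Xt ft exprD; move: (partial _ _ _) => z; ring.
Qed.

Definition iterX n (i : 'I_m) : Rm -> R := iter n along (fun x => x 0 i).

Lemma whomogeneous_iterX n i : whomogeneous lam (lam i + n * D)%:R (iterX n i).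
Proof.
elim: n => [|n IH]; first by rewrite mul0n addn0; exact: whomogeneous_coord.
apply: whomogeneous_eq (whomogeneous_along IH) => //.
by rewrite -natrD mulSn [(D + _)%N]addnC addnA.
Qed.

(** The product of the exponents met when [X] is applied [n] times to [x_l] along the curve. *)
Definition rising n (l : 'I_m) : R := \prod_(q < n) (lam l + q * D)%:R.

Lemma rising_neq0 n l : rising n l != 0.
Proof.
apply/prodf_neq0 => q _; rewrite pnatr_eq0 addn_eq0 negb_and.
by rewrite -lt0n lam_gt0.
Qed.

Lemma iterX_curve n i : \forall t \near (0 : R),
  iterX n i (f t) = b ^+ n * rising n i * A 0 i * t ^+ (lam i + n * D).
Proof.
elim: n => [|n IH].
  by apply: filterS fE => t ft; rewrite /iterX/= ft /rising big_ord0 mul0n addn0 !mul1r.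
have := along_curve (whomogeneous_iterX n i).1 IH; apply: filterS => t E.
apply: (etrans E); rewrite /rising big_ord_recr/= mulSn [(D + _)%N]addnC addnA.
by rewrite exprS; congr (_ * _); ring.
Qed.

Definition kap (l : 'I_m) n : R := eps ^+ n * 'C(lam l, n)%:R / rising n l.

(** The weights [kap] make the binomial expansion of [(psi t) ^+ lam l] appear when [Phi l] is
    evaluated at [f t]. *)
Definition Phi : Rm -> Rm := fun x => \row_l \sum_(n < (lam l).+1) kap l n * iterX n l x.

Definition psi (t : R) : R := t * (1 + eps * b * t ^+ D).

Lemma smooth_germ_Phi : smooth_germ Phi.
Proof.
apply/smooth_germ_rVP => l.
have : smooth_germ (fun x => \sum_(n < (lam l).+1) kap l n * iterX n l x).
  by apply: smooth_germ_sum => n _; apply: smooth_germZ; exact: (whomogeneous_iterX n l).1.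
by apply: smooth_germ_eq => x; rewrite mxE.
Qed.

Lemma smooth_germ_psi : smooth_germ psi.
Proof.
apply: smooth_germM; first exact: smooth_germ_line.
by apply: smooth_germD; [exact: smooth_germ_cst|exact: smooth_germ_monomial].
Qed.

Lemma psi0 : psi 0 = 0. Proof. by rewrite /psi mul0r. Qed.

Lemma Phi_curve : \forall t \near (0 : R), Phi (f t) = f (psi t).
Proof.
have fpsi := smooth_germ_cvg0 smooth_germ_psi psi0 fE.
have Y := near_forall (fun l => near_forall
  (fun n : 'I_(lam l).+1 => iterX_curve n l)).
apply: filterS2 fpsi Y => t ft Yt; apply/rowP => l; rewrite mxE ft.
rewrite /psi exprMn exprDn mulrA mulr_sumr; apply: eq_bigr => n _.
rewrite Yt expr1n mul1r -mulr_natr /kap exprD !exprMn mulnC exprM.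
by move: (rising_neq0 n l) => r0; field.
Qed.

Lemma Phi0 : Phi 0 = 0.
Proof.
by have := nbhs_singleton Phi_curve; rewrite psi0 (curve0 lam_gt0 fE).
Qed.

Lemma diffeo_germ_psi : diffeo_germ psi.
Proof.
apply: diffeo_germ_line; [exact: smooth_germ_psi|exact: psi0|].
have <- : tcoef 1 psi = 'D_1 psi 0 by rewrite /tcoef/= divr1.
have -> : tcoef 1 psi = tcoef 1 (fun t => 1 * t ^+ 1 + (eps * b) * t ^+ D.+1).
  by apply: tcoef_ext; apply: near0W => t; rewrite /psi expr1 exprS; ring.
rewrite tcoefD; try exact: smooth_germ_monomial.
rewrite !tcoef_monomial eqxx mulr1; case: D D_gt0 => // d _.
by rewrite mulr0 addr0 oner_neq0.
Qed.

Lemma whomogeneous_at0 e q : whomogeneous lam e q -> e != 0 -> q 0 = 0.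
Proof.
move=> [_ /nbhs_singleton]; rewrite big1.
  by move=> /esym/eqP; rewrite mulf_eq0 => /orP[/eqP ->|/eqP//]; rewrite eqxx.
by move=> i _; rewrite mxE mulr0 mul0r.
Qed.

(** For [n > 0] the term [X^n(x_l)] has weight above [lam l >= lam i], so its [i]-th partial
    derivative is homogeneous of positive degree and vanishes at 0. *)
Lemma jac_Phi0 i l : (lam i <= lam l)%N -> jac Phi 0 i l = (i == l)%:R.
Proof.
move=> il; rewrite mxE.
have sY n := (whomogeneous_iterX n l).1.
have E : 'D_(delta_mx 0 i) (fun y => Phi y 0 l) 0 =
    \sum_(n < (lam l).+1) kap l n * partial i (iterX n l) 0.
  have -> : (fun y => Phi y 0 l) = (fun y => \sum_(n < (lam l).+1) kap l n * iterX n l y).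
    by apply/funext => y; rewrite mxE.
  have E1 := nbhs_singleton (near_derive_sum predT (delta_mx 0 i)
    (fun n : 'I_(lam l).+1 => smooth_germZ (kap l n) (sY n))).
  apply: (etrans E1); apply: eq_bigr => n _.
  exact: (nbhs_singleton (near_deriveZ (delta_mx 0 i) (kap l n) (sY n))).
apply: (etrans E); rewrite big_ord_recl big1 ?addr0; last first.
  move=> n _; rewrite (whomogeneous_at0 (whomogeneous_partial i (whomogeneous_iterX _ l))) ?mulr0//.
  rewrite subr_eq0 eqr_nat gtn_eqF// (leq_ltn_trans il)// -[X in (X < _)%N]addn0 ltn_add2l.
  by rewrite muln_gt0.
rewrite /partial derive_coord_basis /kap /rising big_ord0 bin0 expr0.
by rewrite !mul1r invr1 mul1r.
Qed.

(** The matrix is unipotent for the order of weights. Instead of sorting the indices, take a vector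
    of the left kernel and look at a nonzero coordinate of largest weight: [jac_Phi0] makes it
    zero. *)
Lemma jac_Phi0_unit : jac Phi 0 \in unitmx.
Proof.
rewrite -row_free_unit -kermx_eq0; apply/eqP/row_matrixP => r.
set v := row r _; rewrite row0; apply/eqP/negPn/negP => v0.
have vJ : v *m jac Phi 0 = 0 by apply/sub_kermxP; exact: row_sub.
have [i0 vi0] : exists i, v 0 i != 0.
  apply/existsP; apply: contraNT v0; rewrite negb_exists => /forallP v0.
  by apply/eqP/rowP => i; rewrite [RHS]mxE; apply/eqP; have := v0 i; rewrite negbK.
case: (@arg_maxnP _ i0 (fun i => v 0 i != 0) lam vi0) => l vl lmax.
move/negP: vl; apply; apply/eqP.
have := congr1 (fun u : 'rV[R]_m => u 0 l) vJ; rewrite [RHS]mxE [LHS]mxE => <-.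
rewrite (bigD1 l)//= jac_Phi0// eqxx mulr1 big1 ?addr0// => i il.
have [->|vi] := eqVneq (v 0 i) 0; first by rewrite mul0r.
by rewrite jac_Phi0 ?(negbTE il) ?mulr0//; exact: lmax.
Qed.

Lemma diffeo_germ_Phi : diffeo_germ Phi.
Proof.
exact: diffeo_germ_of_jac smooth_germ_Phi Phi0 jac_Phi0_unit.
Qed.

End TangentDiffeomorphism.

(** * First-order expansion of the pullback along the curve *)

Section PullbackEstimate.
Context {R : realType} {m : nat}.
Local Notation Rm := 'rV[R]_m.
Implicit Types (q : Rm -> R) (x : Rm).
Variables (lam : 'I_m -> nat) (f : R -> Rm) (A : Rm).
Hypothesis lam_gt0 : forall i, (0 < lam i)%N.
Hypothesis f_smooth : smooth_germ f.
Hypothesis fE : \forall t \near (0 : R), forall i, f t 0 i = A 0 i * t ^+ lam i.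
Variables (X : Rm -> Rm) (D : nat).
Hypothesis D_gt0 : (0 < D)%N.
Hypothesis X_smooth : smooth_germ X.
Hypothesis X_hom : forall i, whomogeneous lam (lam i + D)%:R (component X i).
Variables (b eps : R).
Hypothesis Xf : \forall t \near (0 : R), forall i,
  X (f t) 0 i = b * (lam i)%:R * A 0 i * t ^+ (lam i + D).

Lemma whomogeneous_sub_curve N M q : whomogeneous lam (N%:R - M%:R) q ->
  exists2 c, \forall t \near (0 : R), q (f t) = c * t ^+ (N - M) & ((N < M)%N -> c = 0).
Proof.
move=> hq; apply: (@euler_line_sub R _ _ (q \o f)).
  exact: (smooth_germ_on_curve lam_gt0 f_smooth fE hq.1).
exact: (whomogeneous_curve lam_gt0 f_smooth fE hq).
Qed.

(** Multiplication by [t ^+ M] clears an exponent [N - M] that may be negative, where truncated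
    subtraction would be wrong unless [c = 0]. *)
Lemma expr_sub_shift (c t : R) N M : ((N < M)%N -> c = 0) ->
  t ^+ M * (c * t ^+ (N - M)) = c * t ^+ N.
Proof.
have [MN|NM c0] := leqP M N; last by rewrite c0// !mul0r mulr0.
by rewrite mulrCA -exprD subnKC.
Qed.

Lemma along_coord l : along X (fun x : Rm => x 0 l) = component X l.
Proof.
apply/funext => x; rewrite /along.
rewrite -[RHS]mul1r -(sum_delta (fun j => component X j x) (fun=> 1)).
by apply: eq_bigr => j _; rewrite /partial /basis_vec derive_coord_basis mul1r.
Qed.

Section Potential.
Variables (delta : nat) (E : 'I_m -> Rm -> R).
Hypothesis E_hom : forall l, whomogeneous lam (delta%:R - (lam l)%:R) (E l).

(** Along the curve everything is a power of [t] times a polynomial in [t ^+ D], so the pullback can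
    be expanded in [t ^+ D]: its linear coefficient is [eps] times that of the Lie derivative, and
    the rest is divisible by [t ^+ (D + D)]. The factor [t ^+ lam i] avoids negative exponents. *)
Lemma pullback_expansion i : exists2 L : R,
  \forall t \near (0 : R), t ^+ lam i * lie1 X E i (f t) = L * t ^+ (delta + D) &
  modt (delta + (D + D))
    (fun t => t ^+ lam i * (pullback1 (Phi lam X D eps) E i (f t) - E i (f t)))
    (fun t => eps * L * t ^+ (delta + D)).
Proof.
have exe l : exists c, (\forall t \near (0 : R), E l (f t) = c * t ^+ (delta - lam l)) /\
    ((delta < lam l)%N -> c = 0).
  by have [c H1 H2] := whomogeneous_sub_curve (E_hom l); exists c.
have [e He] := choice exe.
have eE := near_forall (fun l => (He l).1); have e0 l := (He l).2.
have hY n l := whomogeneous_iterX X_hom n l.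
(* [G n l] is the coefficient on [f] of the [i]-th partial derivative of [X^n(x_l)], whose exponent
   [lam l + n * D - lam i] may be negative before multiplication. *)
have [G HG] : exists G : nat -> 'I_m -> R, forall n l, \forall t \near (0 : R),
    t ^+ lam i * partial i (iterX X n l) (f t) = G n l * t ^+ (lam l + n * D).
  have H (nl : nat * 'I_m) : exists c, \forall t \near (0 : R),
      t ^+ lam i * partial i (iterX X nl.1 nl.2) (f t) = c * t ^+ (lam nl.2 + nl.1 * D).
    have [c H1 H2] := whomogeneous_sub_curve (whomogeneous_partial i (hY nl.1 nl.2)).
    by exists c; apply: filterS H1 => t ->; rewrite expr_sub_shift.
  by have [G HG] := choice H; exists (fun n l => G (n, l)) => n l; exact: (HG (n, l)).
have G0 l : G 0%N l = (i == l)%:R.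
  apply/eqP; rewrite -subr_eq0; apply/eqP; apply: (@monomial_eq0 R _ (lam l)).
  apply: filterS (HG 0%N l) => t; rewrite /iterX/= /partial /basis_vec derive_coord_basis.
  rewrite mul0n addn0 mulrBl => <-; apply/eqP; rewrite subr_eq0; apply/eqP.
  by have [->|_] := eqVneq i l; rewrite ?mulr1 ?mul1r ?mulr0 ?mul0r.
(* The two summands are those of [lie1]: [X(E_i)] computed by [along_curve], and the terms [E_l]
   times the [i]-th partial derivative of [X_l = X(x_l)], whence [G 1 l]. *)
pose L := b * ((delta - lam i)%:R * e i) + \sum_l G 1%N l * e l.
exists L.
  have H1 := along_curve lam_gt0 f_smooth fE Xf (E_hom i).1 (He i).1.
  have H2 := near_forall (HG 1%N).
  apply: filterS3 H1 H2 eE => t H1 H2 Et.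
  rewrite /lie1 -/(along X (E i) (f t)) H1 mulrDr /L mulrDl; congr (_ + _).
    have -> : t ^+ lam i * (b * ((delta - lam i)%:R * e i) * t ^+ (delta - lam i + D)) =
        b * (delta - lam i)%:R * t ^+ D * (t ^+ lam i * (e i * t ^+ (delta - lam i))).
      by rewrite exprD; ring.
    by rewrite expr_sub_shift ?exprD; [ring|exact: e0].
  rewrite mulr_sumr mulr_suml; apply: eq_bigr => l _.
  have := H2 l; rewrite /iterX/= along_coord mul1n mulrA => ->; rewrite Et.
  have -> : G 1%N l * t ^+ (lam l + D) * (e l * t ^+ (delta - lam l)) =
      G 1%N l * t ^+ D * (t ^+ lam l * (e l * t ^+ (delta - lam l))).
    by rewrite exprD; ring.
  by rewrite expr_sub_shift ?exprD; [ring|exact: e0].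
pose z := eps * b.
pose kG n l := kap lam D eps l n * G n l.
(* The [l]-th term of the pullback becomes [t ^+ delta * (e l * (U l t * V l t))]: [U l] comes from
   evaluating [E l] at [f (psi t)], [V l] from the Jacobian of [Phi]. *)
pose U l (t : R) := (1 + z * t ^+ D) ^+ (delta - lam l).
pose V l (t : R) := \sum_(n < (lam l).+1) kG n l * (t ^+ D) ^+ n.
have smooth_binom M : smooth_germ (fun t : R => (1 + z * t ^+ D) ^+ M).
  apply: smooth_germX; apply: smooth_germD; [exact: smooth_germ_cst|exact: smooth_germ_monomial].
have smooth_aff u v : smooth_germ (fun t : R => u + v * t ^+ D).
  by apply: smooth_germD; [exact: smooth_germ_cst|exact: smooth_germ_monomial].
have sV l : smooth_germ (V l).
  apply: smooth_germ_sum => n _; apply: smooth_germZ; do 2!apply: smooth_germX.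
  exact: smooth_germ_line.
(* The sum has a linear term because [lam l] is positive. *)
have V1 l : modt (D + D) (V l) (fun t => kG 0%N l + kG 1%N l * t ^+ D).
  have H N : (0 < N)%N -> modt (D + D) (fun t => \sum_(n < N.+1) kG n l * (t ^+ D) ^+ n)
      (fun t => kG 0%N l + kG 1%N l * t ^+ D).
    by case: N => // N _; exact: (modt_linear_part D (fun n => kG n l)).
  exact: H.
have k0 l : kG 0%N l = (i == l)%:R.
  by rewrite /kG G0 /kap /rising big_ord0 bin0 expr0 !mul1r invr1 mul1r.
(* The binomial coefficient ['C(lam l, 1)] and [rising 1 l] are both [lam l] and cancel. *)
have k1 l : kG 1%N l = eps * G 1%N l.
  rewrite /kG /kap /rising big_ord1 bin1 mul0n addn0 expr1 mulfK//.
  by rewrite pnatr_eq0 -lt0n.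
have UV : modt (D + D) (fun t => \sum_l e l * (U l t * V l t))
    (fun t => e i + eps * L * t ^+ D).
  apply: modt_trans (modt_sum _ (fun l _ => modtZ (e l)
    (modtM (sV l) (smooth_aff 1 _) (modt_binomial D z (delta - lam l)) (V1 l)))) _.
  (* The quotient by [t ^+ (D + D)]: the product of the two linear coefficients is the only
     quadratic term. *)
  exists (fun=> \sum_l e l * ((delta - lam l)%:R * z * kG 1%N l)).
    exact: smooth_germ_cst.
  apply: near0W => t.
  have -> : e i + eps * L * t ^+ D = \sum_l (e l * (1 * (i == l)%:R) +
      e l * ((eps * b * (delta - lam l)%:R * t ^+ D) * (i == l)%:R) + eps * t ^+ D * (G 1%N l * e l)).
    rewrite !big_split/=; under eq_bigr do rewrite eq_sym.
    rewrite (sum_delta e (fun=> 1)).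
    under [X in _ = _ + X + _]eq_bigr do rewrite eq_sym.
    rewrite (sum_delta e (fun l => eps * b * (delta - lam l)%:R * t ^+ D)) -mulr_sumr.
    by rewrite mul1r /L; move: (\sum_l _) => S; ring.
  rewrite -sumrB mulr_sumr; apply: eq_bigr => l _; rewrite k0 k1 exprD /z.
  by move: (t ^+ D) ((i == l)%:R) (G 1%N l) => T d g; ring.
have psiE := smooth_germ_cvg0 (smooth_germ_psi D b eps) (psi0 D b eps) eE.
have jE : \forall t \near (0 : R), forall l, t ^+ lam i * jac (Phi lam X D eps) (f t) i l =
    t ^+ lam l * V l t.
  apply: near_forall => l.
  have sY n := (hY n l).1.
  have E1 : \forall x \near (0 : Rm), jac (Phi lam X D eps) x i l =
      \sum_(n < (lam l).+1) kap lam D eps l n * partial i (iterX X n l) x.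
    have Ea := near_derive_sum predT (delta_mx 0 i)
      (fun n : 'I_(lam l).+1 => smooth_germZ (kap lam D eps l n) (sY n)).
    have Eb := near_forall
      (fun n : 'I_(lam l).+1 => near_deriveZ (delta_mx 0 i) (kap lam D eps l n) (sY n)).
    apply: filterS2 Ea Eb => x Ea Eb; rewrite mxE.
    have -> : (fun y => Phi lam X D eps y 0 l) =
        (fun y => \sum_(n < (lam l).+1) kap lam D eps l n * iterX X n l y).
      by apply/funext => y; rewrite mxE.
    by apply: (etrans Ea); apply: eq_bigr => n _; exact: Eb.
  have Gt := near_forall (fun n : 'I_(lam l).+1 => HG n l).
  apply: filterS2 (near_curve lam_gt0 f_smooth fE E1) Gt => t -> Gt'.
  rewrite /V !mulr_sumr; apply: eq_bigr => n _; rewrite mulrCA Gt' /kG exprD mulnC exprM.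
  by ring.
have PE : \forall t \near (0 : R),
    t ^+ lam i * (pullback1 (Phi lam X D eps) E i (f t) - E i (f t)) =
    t ^+ delta * (\sum_l e l * (U l t * V l t) - e i).
  apply: filterS3 (filterI psiE eE) jE (Phi_curve lam_gt0 f_smooth fE X_hom eps Xf).
  move=> t [Ep Et] J Pt; rewrite !mulrBr; congr (_ - _); last first.
    by rewrite Et expr_sub_shift 1?mulrC//; exact: e0.
  rewrite /pullback1 !mulr_sumr; apply: eq_bigr => l _.
  rewrite [LHS]mulrA J Pt Ep /psi exprMn.
  have -> : t ^+ lam l * V l t * (e l * (t ^+ (delta - lam l) * (1 + eps * b * t ^+ D) ^+ (delta - lam l))) =
      (t ^+ lam l * (e l * t ^+ (delta - lam l))) * (U l t * V l t).
    by rewrite /U /z; ring.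
  rewrite expr_sub_shift; last exact: e0.
  by rewrite [e l * _]mulrC -mulrA.
apply: modt_ext (modtX delta (modtD UV (modt_near _ (near0W (fun t => erefl (- e i)))))).
  by apply: filterS PE => t ->.
by apply: near0W => t; rewrite exprD addrAC subrr add0r mulrCA.
Qed.

End Potential.
End PullbackEstimate.

(** * The normal form in quasi-homogeneous coordinates *)

Section NormalForm.
Context {R : realType} {m : nat}.
Local Notation Rm := 'rV[R]_m.
Variables (lam : 'I_m -> nat) (f : R -> Rm) (A : Rm).
Hypothesis lam_gt0 : forall i, (0 < lam i)%N.
Hypothesis f_smooth : smooth_germ f.
Hypothesis fE : \forall t \near (0 : R), forall i, f t 0 i = A 0 i * t ^+ lam i.
Variables (p : nat) (a : 'I_p -> kform R m 2) (delta : 'I_p -> nat).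
Variable E : 'I_p -> 'I_m -> Rm -> R.
Hypothesis E_hom : forall j l, whomogeneous lam ((delta j)%:R - (lam l)%:R) (E j l).
Hypothesis aE : forall j, same_restriction f (a j) (dform (E j)).
Hypothesis a_form : forall j, form_germ (a j).
Hypothesis a_free : forall c : 'I_p -> R,
  same_restriction f (lin_comb predT c a) (@zero_form R m 2) -> forall j, c j = 0.
Hypothesis a_span : forall eta, smooth1 eta ->
  exists c, same_restriction f (dform eta) (lin_comb predT c a).
Hypothesis delta_mono : forall i j : 'I_p, (i <= j)%N -> (delta i <= delta j)%N.
Variables (s k : 'I_p).
Hypothesis sk : (s < k)%N.
Hypothesis delta_s : forall j : 'I_p, (s < j)%N -> (delta s < delta j)%N.
Variables (c : 'I_p -> R) (r : R).
Hypotheses (c_neq0 : c s != 0) (r_neq0 : r != 0).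
Variables (X : Rm -> Rm) (d : R).
Hypothesis X_lift : liftable f X.
Hypothesis X_hom : forall i, whomogeneous lam ((lam i)%:R + d) (component X i).
Hypothesis Xa : same_restriction f (dform (contr X (a s))) (scale_form r (a k)).

Let E_smooth j : smooth1 (E j).
Proof. by move=> l; exact: (E_hom j l).1. Qed.

Lemma lie1_potential : same_restriction f (dform (lie1 X (E s))) (scale_form r (a k)).
Proof.
have sX := X_lift.1.
apply: same_restriction_trans Xa; apply: same_restriction_sym.
have f0 := curve0 lam_gt0 fE.
have := same_restriction_contr X_lift f_smooth f0 (a_form s) (form_germ_dform (E_smooth s)) (aE s).
move/same_restriction_trans; apply; apply: same_restriction_near.
exact: near_dform_contr.
Qed.

Lemma whomogeneous_lie1 i :
  whomogeneous lam ((delta s)%:R + d - (lam i)%:R) (lie1 X (E s) i).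
Proof.
apply: whomogeneousD; apply: whomogeneous_sum => j _.
  apply: whomogeneous_eq (whomogeneousM (X_hom j) (whomogeneous_partial j (E_hom s i))) => //.
  by ring.
apply: whomogeneous_eq (whomogeneousM (whomogeneous_partial i (X_hom j)) (E_hom s j)) => //.
by ring.
Qed.

(** If some coefficient of [lie1 X (E s)] on [f] is nonzero in quasi-degree [delta k], the Euler
    equation reads off [d]. Otherwise [part_coef] would give [r = 0]. *)
Lemma weight_of_field : d = (delta k - delta s)%:R.
Proof.
have sl := smooth1_lie1 X_lift.1 (E_smooth s).
have [[i [n [nk tn]]]|H] := pselect (exists i n, (n + lam i)%N = delta k /\
    tcoef n (lie1 X (E s) i \o f) != 0).
  have su := smooth_germ_on_curve lam_gt0 f_smooth fE (sl i).
  have := tcoef_eulerE n su (whomogeneous_curve lam_gt0 f_smooth fE (whomogeneous_lie1 i)).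
  move/eqP; rewrite mulf_eq0 (negbTE tn) orbF subr_eq0 => /eqP nE.
  rewrite natrB; last exact: ltnW (delta_s sk).
  by rewrite -nk natrD nE; ring.
suff r0 : (if k == k then r else 0) = 0 by move: r_neq0; rewrite eqxx in r0; rewrite r0 eqxx.
apply: (part_coef (b := fun j => if j == k then r else 0) lam_gt0 f_smooth fE
  E_smooth E_hom aE a_free sl _ _ (erefl (delta k))).
  apply: same_restriction_ext lie1_potential => // x I.
  rewrite /lin_comb /scale_form (bigD1 k)//= eqxx big1 ?addr0// => j /negbTE ->.
  by rewrite mul0r.
move=> i n nk; apply/eqP/negPn/negP => tn; apply: H; exists i, n.
by split.
Qed.

Let D := (delta k - delta s)%N.
Let D_gt0 : (0 < D)%N. Proof. by rewrite subn_gt0; exact: delta_s. Qed.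

Let X_homD i : whomogeneous lam (lam i + D)%:R (component X i).
Proof. by apply: whomogeneous_eq (X_hom i) => //; rewrite natrD weight_of_field. Qed.

Lemma normal_form_standard : exists (Phi : Rm -> Rm) (psi : R -> R) (b : 'I_p -> R),
  [/\ diffeo_germ Phi, diffeo_germ psi, \forall t \near (0 : R), Phi (f t) = f (psi t) &
    same_restriction f (pullback Phi (lin_comb (fun j : 'I_p => (s <= j)%N) c a))
      (add_form (lin_comb (fun j : 'I_p => (s <= j < k)%N) c a)
         (lin_comb (fun j : 'I_p => (k < j)%N) b a))].
Proof.
have [b Xf] := liftable_curve lam_gt0 f_smooth fE X_homD X_lift.
have sX := X_lift.1.
pose eps := - (c k / (c s * r)).
pose F := Phi lam X D eps; pose g := psi D b eps.
have dF : diffeo_germ F := diffeo_germ_Phi lam_gt0 f_smooth fE D_gt0 X_homD eps Xf.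
have dg : diffeo_germ g := diffeo_germ_psi D_gt0 b eps.
have Ff := Phi_curve lam_gt0 f_smooth fE X_homD eps Xf.
have sF : smooth_germ F := smooth_germ_Phi X_homD eps.
have F0 : F 0 = 0 := Phi0 lam_gt0 f_smooth fE X_homD eps Xf.
pose P := fun j : 'I_p => (s <= j)%N.
pose eta i x := \sum_(j < p | P j) c j * E j i x.
have seta : smooth1 eta := smooth1_comb E_smooth P c.
have aeta : same_restriction f (lin_comb P c a) (dform eta) := lin_comb_potential E_smooth aE P c.
have sPe := smooth1_pullback1 sF F0 seta.
have sl := smooth1_lie1 sX (E_smooth s).
pose th1 i x := 1 * pullback1 F eta i x + (-1) * eta i x.
have sth1 : smooth1 th1 by move=> i; apply: smooth_germD; exact: smooth_germZ.
pose th i x := 1 * th1 i x + (- (eps * c s)) * lie1 X (E s) i x.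
have sth : smooth1 th by move=> i; apply: smooth_germD; exact: smooth_germZ.
have th_high i n : (n + lam i <= delta k)%N -> tcoef n (th i \o f) = 0.
  move=> nk; have sthf := smooth_germ_on_curve lam_gt0 f_smooth fE (sth i).
  have -> : tcoef n (th i \o f) = tcoef (n + lam i) (fun t => t ^+ lam i * (th i \o f) t).
    by rewrite tcoef_mulXn// leq_addl addnK.
  apply: (@modt_tcoef R (delta k).+1); last by [].
  have HL j : {L : R | (\forall t \near (0 : R),
      t ^+ lam i * lie1 X (E j) i (f t) = L * t ^+ (delta j + D)) &
      modt (delta j + (D + D))
       (fun t => t ^+ lam i * (pullback1 F (E j) i (f t) - E j i (f t)))
       (fun t => eps * L * t ^+ (delta j + D))}.
    by apply: cid2; exact: (pullback_expansion lam_gt0 f_smooth fE X_homD eps Xf (E_hom j) i).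
  (* The contribution of [E j] to the remainder [th]; the first-order correction is made for [j = s]
     only. *)
  pose u j (t : R) := t ^+ lam i * (pullback1 F (E j) i (f t) - E j i (f t)) -
    (if j == s then eps * (t ^+ lam i * lie1 X (E j) i (f t)) else 0).
  have Hu j : P j -> modt (delta k).+1 (u j) (fun=> 0).
    move=> Pj; case: (HL j) => L HL1 HL2.
    rewrite /u; have [js|js] := eqVneq j s.
      (* For [j = s] the error starts at [delta s + D + D = delta k + D], beyond [delta k]. *)
      apply: (@modtW R (delta j + (D + D))).
        rewrite js addnA subnKC ?(ltnW (delta_s sk))//.
        by rewrite -addn1 leq_add2l.
      case: HL2 => Q sQ HQ; exists Q => //.
      by apply: filterS2 HL1 HQ => t -> <-; rewrite subr0 mulrA.
    (* For [j > s] even the first-order term is too high: [delta j] exceeds [delta s], and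
       [delta s + D = delta k]. *)
    have dj : (delta k < delta j + D)%N.
      have sj : (s < j)%N by rewrite ltn_neqAle; apply/andP; split=> //; rewrite eq_sym.
      rewrite -[X in (X < _)%N](subnKC (ltnW (delta_s sk))) ltn_add2r.
      exact: delta_s.
    apply: (@modtW R (delta j + D)); first exact: dj.
    case: HL2 => Q sQ HQ; exists (fun t => eps * L + t ^+ D * Q t).
      apply: smooth_germD; first exact: smooth_germ_cst.
      by apply: smooth_germM => //; apply: smooth_germX; exact: smooth_germ_line.
    apply: filterS HQ => t HQ; rewrite !subr0; move/eqP: HQ; rewrite subr_eq => /eqP ->.
    by rewrite !exprD; ring.
  apply: (modt_ext (u := fun t => \sum_(j < p | P j) c j * u j t) (v := fun=> \sum_(j < p | P j) c j * 0)).
  - apply: near0W => t; rewrite /th /th1 /pullback1 /eta /=.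
    have Ps : P s by rewrite /P.
    rewrite (eq_bigr (fun j => t ^+ lam i * (c j * pullback1 F (E j) i (f t)) -
      t ^+ lam i * (c j * E j i (f t)) - (if j == s then c s * eps * (t ^+ lam i * lie1 X (E s) i (f t)) else 0))); last first.
      move=> j _; rewrite /u; case: eqP => [->|_].
        by move: (pullback1 _ _ _ _) (lie1 _ _ _ _) => *; ring.
      by move: (pullback1 _ _ _ _) => *; ring.
    rewrite !sumrB -!mulr_sumr -big_mkcondr/= [X in _ - X = _](big_pred1 s); last first.
      by move=> j; apply: andb_idl => /eqP ->.
    have -> : \sum_(j < p | P j) c j * pullback1 F (E j) i (f t) =
        \sum_l jac F (f t) i l * \sum_(j < p | P j) c j * E j l (F (f t)).
      under eq_bigr do rewrite mulr_sumr.
      rewrite exchange_big; apply: eq_bigr => l _; rewrite mulr_sumr.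
      by apply: eq_bigr => j _; rewrite mulrCA.
    move: (\sum_l _) (\sum_(j < p | P j) _) (lie1 _ _ _ _) => *; ring.
  - by apply: near0W => t; rewrite big1// => j _; rewrite mulr0.
  - by apply: modt_sum => j Pj; apply: modtZ; exact: Hu.
have [b' Hb'] := restriction_high lam_gt0 f_smooth fE E_smooth E_hom aE a_free sth
  (a_span sth) th_high.
(* An index [j > k] may still have [delta j = delta k]; the remainder contributes nothing there and
   the coefficient stays [c j]. *)
pose bb j := c j + (if (delta k < delta j)%N then b' j else 0).
exists F, g, bb; split=> //.
have ss := smooth_germ_psi D b eps; have s0 := psi0 D b eps.
have H1 : same_restriction f (pullback F (lin_comb P c a)) (dform (pullback1 F eta)).
  apply: same_restriction_trans (same_restriction_pullback sF F0 ss s0 Ff aeta) _.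
  apply: same_restriction_sym; apply: same_restriction_near; exact: near_dform_pullback1.
have L1 := near_dform_lin 1 (-1) sPe seta.
have L2 := near_dform_lin 1 (- (eps * c s)) sth1 sl.
have H2 : same_restriction f (dform (pullback1 F eta))
    (fun x I => 1 * (1 * dform th x I + 1 * dform eta x I) +
      (eps * c s) * dform (lie1 X (E s)) x I).
  apply: same_restriction_near; apply: filterS2 L1 L2 => x L1 L2 I; rewrite L2 L1.
  by move: (dform (pullback1 F eta) x I) (dform eta x I) (dform (lie1 X (E s)) x I) => *; ring.
have H3 := same_restriction_lin 1 (eps * c s)
  (same_restriction_lin 1 1 Hb' (same_restriction_sym aeta)) lie1_potential.
apply: (same_restriction_trans H1); apply: (same_restriction_trans H2).
apply: same_restriction_ext H3 => x I //.
rewrite /add_form /scale_form /lin_comb !mul1r.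
have -> : eps * c s * (r * a k x I) = - (c k * a k x I).
  by rewrite /eps; field; rewrite c_neq0 r_neq0.
have -> : c k * a k x I = \sum_(j < p | j == k) c j * a j x I by rewrite big_pred1_eq.
rewrite [X in X + _ - _]big_mkcond [X in _ + X - _]big_mkcond [X in _ - X = _]big_mkcond.
rewrite [X in _ = X + _]big_mkcond [X in _ = _ + X]big_mkcond /= -big_split -sumrB -big_split; apply: eq_bigr => j _ /=.
have [jk|kj|/val_inj ->] := ltngtP j k.
- have -> : (delta k < delta j)%N = false.
    by apply/negbTE; rewrite -leqNgt; exact: delta_mono (ltnW jk).
  by rewrite andbT add0r -val_eqE/= (ltn_eqF jk) subr0 addr0.
- rewrite -val_eqE/= (gtn_eqF kj) andbF add0r subr0 /P (leq_trans (ltnW sk) (ltnW kj)) /bb.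
  by case: ifP => _ /=; ring.
- by rewrite ltnn eqxx /P (ltnW sk) andbF !addr0 add0r subrr.
Qed.

End NormalForm.

(** * Change of coordinates *)

Section ClosedPullback.
Context {R : realType} {m : nat}.
Local Notation Rm := 'rV[R]_m.
Implicit Types (w : kform R m 2) (F : Rm -> Rm) (x : Rm).

(** [near_dform_pullback1] covers exact forms only. Here the second derivatives of [F] are symmetric
    and cancel in the alternating sum, and the first derivatives assemble into the closedness
    equation of [w] at [F x]. *)
Lemma closed_form_pullback F w : smooth_germ F -> F 0 = 0 -> closed_form w ->
  closed_form (pullback F w).
Proof.
move=> sF F0 cw; have [gw cwx] := (closed_formP w).1 cw.
apply/closed_formP; split; first exact: form_germ_pullback.
have sJ i j := smooth_germ_jac i j sF.
have sw p q : smooth_germ ((fun y => w y (pr p q)) \o F) := smooth_germ_comp F0 sF (gw.1 (pr p q)).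
pose H k l b x := partial k (fun y => jac F y l b) x.
have S : \forall x \near (0 : Rm), forall k l b, H k l b x = H l k b x := near_jac_sym sF.
have D : \forall x \near (0 : Rm), forall a b c,
    partial a (fun y => pullback F w y (pr b c)) x =
    \sum_p \sum_q (H a b p x * jac F x c q * w (F x) (pr p q) +
      jac F x b p * H a c q x * w (F x) (pr p q) +
      jac F x b p * jac F x c q *
        \sum_u jac F x a u * partial u (fun y => w y (pr p q)) (F x)).
  apply: near_forall => a; apply: near_forall => b; apply: near_forall => c.
  pose T p q (x : Rm) := jac F x b p * (jac F x c q * w (F x) (pr p q)).
  have sT p q : smooth_germ (T p q).
    by apply: smooth_germM => //; apply: smooth_germM => //; exact: sw.
  have sTp p : smooth_germ (fun x => \sum_q T p q x) by exact: smooth_germ_sum.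
  have -> : (fun y => pullback F w y (pr b c)) = fun y => \sum_p \sum_q T p q y.
    apply/funext => y; rewrite pullbackE pr0 pr1 mxE exchange_big; apply: eq_bigr => q _.
    rewrite mxE mulr_suml [(jac F y)^T _ _]mxE; apply: eq_bigr => p _.
    by rewrite [mx2 _ _ _ _]mxE /T mulrA mulrAC.
  have E1 := near_derive_sum predT (basis_vec a) sTp.
  have E2 := near_forall (fun p => near_derive_sum predT (basis_vec a) (sT p)).
  have E3 := near_forall (fun p => near_forall (fun q =>
    near_deriveM (basis_vec a) (sJ b p) (smooth_germM (sJ c q) (sw p q)))).
  have E4 := near_forall (fun p => near_forall (fun q =>
    near_deriveM (basis_vec a) (sJ c q) (sw p q))).
  have E5 := near_forall (fun p => near_forall (fun q =>
    near_derive_comp (basis_vec a) F0 sF (gw.1 (pr p q)))).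
  apply: filterS3 (filterI E1 E2) (filterI E3 E4) E5 => x [{}E1 {}E2] [{}E3 {}E4] {}E5.
  apply: (etrans E1); apply: eq_bigr => p _; apply: (etrans (E2 p)); apply: eq_bigr => q _.
  apply: (etrans (E3 p q)); rewrite (E4 p q) (E5 p q).
  have -> : \sum_i 'D_(basis_vec a) (fun y => F y 0 i) x *:
      'D_(delta_mx 0 i) (fun y => w y (pr p q)) (F x) =
      \sum_u jac F x a u * partial u (fun y => w y (pr p q)) (F x).
    by apply: eq_bigr => u _; rewrite [jac F x a u]mxE.
  rewrite /H /partial /comp.
  move: (derive (fun y => jac F y b p) x _) (derive (fun y => jac F y c q) x _).
  move: (\sum_u _) => *; ring.
have an := smooth_germ_cvg0 sF F0 (form_germ2_anti gw).
have cl := smooth_germ_cvg0 sF F0 cwx.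
apply: filterS3 D S (filterI an cl) => x {}D {}S [{}an {}cl] a b c; rewrite !D.
(* [K] collects the second derivatives of [F] falling on the first Jacobian factor; by antisymmetry
   of [w] those on the second factor give [- K a c b]. [L] collects the derivatives of [w]. *)
pose K a b c := \sum_p \sum_q H a b p x * jac F x c q * w (F x) (pr p q).
pose L a b c := \sum_p \sum_q \sum_u jac F x a u * jac F x b p * jac F x c q *
  partial u (fun y => w y (pr p q)) (F x).
have split3 a' b' c' : \sum_p \sum_q (H a' b' p x * jac F x c' q * w (F x) (pr p q) +
      jac F x b' p * H a' c' q x * w (F x) (pr p q) +
      jac F x b' p * jac F x c' q *
        \sum_u jac F x a' u * partial u (fun y => w y (pr p q)) (F x)) =
    K a' b' c' - K a' c' b' + L a' b' c'.
  have -> : - K a' c' b' = \sum_p \sum_q jac F x b' p * H a' c' q x * w (F x) (pr p q).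
    rewrite /K exchange_big -sumrN; apply: eq_bigr => p _; rewrite -sumrN.
    by apply: eq_bigr => q _; rewrite (an p q); ring.
  rewrite /K /L -!big_split; apply: eq_bigr => p _; rewrite -!big_split; apply: eq_bigr => q _ /=.
  congr (_ + _); rewrite mulr_sumr; apply: eq_bigr => u _.
  by move: (partial _ _ _) => z; ring.
rewrite !split3.
have KS a' b' c' : K a' b' c' = K b' a' c'.
  by apply: eq_bigr => p _; apply: eq_bigr => q _; rewrite S.
pose M (G : 'I_m -> 'I_m -> 'I_m -> R) :=
  \sum_p \sum_q \sum_u jac F x a u * jac F x b p * jac F x c q * G p q u.
have Lb : L b a c = M (fun p q u => partial p (fun y => w y (pr u q)) (F x)).
  rewrite /L /M; under eq_bigr do rewrite exchange_big.
  rewrite exchange_big; under [RHS]eq_bigr do rewrite exchange_big.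
  apply: eq_bigr => u _; apply: eq_bigr => p _; apply: eq_bigr => q _.
  by rewrite [jac F x b u * _]mulrC.
have Lc : L c a b = M (fun p q u => partial q (fun y => w y (pr u p)) (F x)).
  rewrite /L /M exchange_big; apply: eq_bigr => p _; rewrite exchange_big; apply: eq_bigr => q _.
  by apply: eq_bigr => u _; congr (_ * _); rewrite -mulrA mulrC.
have Z : L a b c - L b a c + L c a b = 0.
  rewrite Lb Lc -sumrB -big_split big1// => p _ /=.
  rewrite -sumrB -big_split big1// => q _ /=.
  rewrite -sumrB -big_split big1// => u _ /=.
  by rewrite -mulrBr -mulrDr cl mulr0.
rewrite -[RHS]Z (KS b a c) (KS c a b) (KS c b a); ring.
Qed.

End ClosedPullback.

(** * The curve and the field in quasi-homogeneous coordinates *)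

Section ChangeOfCoordinates.
Context {R : realType} {m : nat}.
Local Notation Rm := 'rV[R]_m.
Implicit Types (w : kform R m 2) (F : Rm -> Rm) (x : Rm).
Variables (lam : 'I_m -> nat) (h h' : Rm -> Rm).
Hypothesis lam_gt0 : forall i, (0 < lam i)%N.
Hypothesis hh' : inverse_germs h h'.

Let sh : smooth_germ h. Proof. by case: hh'. Qed.
Let sh' : smooth_germ h'. Proof. by case: hh'. Qed.
Let h0 : h 0 = 0. Proof. by case: hh'. Qed.
Let h'0 : h' 0 = 0. Proof. by case: hh'. Qed.
Let hK : \forall x \near (0 : Rm), h' (h x) = x.
Proof. by case: hh' => _ _ _ _; apply: filterS => x []. Qed.
Let h'K : \forall x \near (0 : Rm), h (h' x) = x.
Proof. by case: hh' => _ _ _ _; apply: filterS => x []. Qed.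


Lemma jac_h'h : \forall y \near (0 : Rm), jac h' y *m jac h (h' y) = 1%:M.
Proof.
have H := near_jac_comp sh h0 sh' h'0.
by apply: filterS2 (near_jac_id h'K) H => y /= <- ->.
Qed.

Lemma jac_hh' : \forall x \near (0 : Rm), jac h x *m jac h' (h x) = 1%:M.
Proof.
have H := near_jac_comp sh' h'0 sh h0.
by apply: filterS2 (near_jac_id hK) H => y /= <- ->.
Qed.

Definition euler_row (y : Rm) : Rm := \row_i ((lam i)%:R * y 0 i).

Lemma near_euler_field : \forall y \near (0 : Rm),
  euler_field lam h h' y = euler_row (h y) *m jac h' (h y).
Proof.
have := smooth_germ_cvg0 sh h0 (smooth_germ_differentiable sh').
by apply: filterS => y dh'; rewrite /euler_field derive_jac.
Qed.

Lemma near_euler_jac : \forall y \near (0 : Rm),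
  euler_field lam h h' y *m jac h y = euler_row (h y).
Proof.
have H := smooth_germ_cvg0 sh h0 jac_h'h.
apply: filterS3 near_euler_field H hK => y -> J yK.
by move: J; rewrite yK -mulmxA => ->; rewrite mulmx1.
Qed.

Lemma smooth_germ_euler_row : smooth_germ euler_row.
Proof.
apply/smooth_germ_rVP => i.
apply: smooth_germ_eq (smooth_germZ (lam i)%:R (@smooth_germ_coord R m i)) => x.
by rewrite mxE.
Qed.

Lemma smooth_germ_mulmx_jac F G : smooth_germ F -> smooth_germ G ->
  smooth_germ (fun y => F y *m jac G y).
Proof.
move=> /smooth_germ_rVP sF sG; apply/smooth_germ_rVP => i.
have : smooth_germ (fun y => \sum_j F y 0 j * jac G y j i).
  by apply: smooth_germ_sum => j _; apply: smooth_germM => //; exact: smooth_germ_jac.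
by apply: smooth_germ_eq => y; rewrite mxE.
Qed.

Lemma smooth_germ_euler_field : smooth_germ (euler_field lam h h').
Proof.
have s1 : smooth_germ (fun z => euler_row z *m jac h' z).
  by apply: smooth_germ_mulmx_jac => //; exact: smooth_germ_euler_row.
apply: smooth_germ_ext (smooth_germ_comp_rV h0 sh s1).
by apply: filterS near_euler_field => y ->.
Qed.

Section Curve.
Variables (f : R -> Rm) (tau sigma : R -> R).
Hypothesis f_curve : curve_germ f.
Hypothesis tau_sigma : inverse_germs tau sigma.
Hypothesis f_hom : \forall u \near (0 : R),
  (tau u / derive1 tau u) *: derive1 f u = euler_field lam h h' (f u).

Let sf : smooth_germ f. Proof. by case: f_curve. Qed.
Let f0 : f 0 = 0. Proof. by case: f_curve. Qed.
Let st : smooth_germ tau. Proof. by case: tau_sigma. Qed.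
Let ss : smooth_germ sigma. Proof. by case: tau_sigma. Qed.
Let t0 : tau 0 = 0. Proof. by case: tau_sigma. Qed.
Let s0 : sigma 0 = 0. Proof. by case: tau_sigma. Qed.
Let tK : \forall x \near (0 : R), sigma (tau x) = x.
Proof. by case: tau_sigma => _ _ _ _; apply: filterS => x []. Qed.
Let sK : \forall x \near (0 : R), tau (sigma x) = x.
Proof. by case: tau_sigma => _ _ _ _; apply: filterS => x []. Qed.

Definition std_curve : R -> Rm := fun t => h (f (sigma t)).

Let fs0 : (f \o sigma) 0 = 0. Proof. by rewrite /= s0 f0. Qed.
Let sfs : smooth_germ (f \o sigma).
Proof. exact: smooth_germ_comp_curve s0 ss sf. Qed.

Lemma smooth_germ_std_curve : smooth_germ std_curve.
Proof. exact: smooth_germ_comp_rV fs0 sfs sh. Qed.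

Lemma near_derive_sigma : \forall t \near (0 : R),
  'D_1 sigma t * 'D_1 tau (sigma t) = 1.
Proof.
have H := near_derive_comp_line (1 : R) s0 ss st.
apply: filterS2 H (near_derive (1 : R) sK) => t H1 H2.
by apply: etrans (esym H1) (etrans H2 _); exact: derive_id.
Qed.

Lemma near_derive_std_curve : \forall t \near (0 : R),
  'D_1 std_curve t = 'D_1 sigma t *: ('D_1 f (sigma t) *m jac h (f (sigma t))).
Proof.
have H1 := near_derive_comp_line (1 : R) s0 ss sf.
have sc j : smooth_germ (fun y => h y 0 j) := (smooth_germ_rVP h).1 sh j.
have H2 := near_forall (fun j => near_derive_comp (1 : R) fs0 sfs (sc j)).
have H3 := smooth_germ_differentiable smooth_germ_std_curve.
have H4 := smooth_germ_differentiable sfs.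
apply: filterS3 (filterI H1 H3) H2 H4 => t [{}H1 {}H3] {}H2 {}H4.
apply/rowP => j; rewrite -derive_coord//; apply: (etrans (H2 j)).
rewrite [RHS]mxE [X in _ = _ * X]mxE mulr_sumr; apply: eq_bigr => i _.
rewrite derive_coord// H1 [X in X *: _]mxE [jac _ _ _ _]mxE.
by rewrite /GRing.scale/= mulrA.
Qed.

(** In the new coordinates the hypothesis becomes the Euler equation of degree [lam i] for each
    component, solved exactly by [euler_line]. *)
Lemma std_curveE : exists A : Rm, \forall t \near (0 : R), forall i,
  std_curve t 0 i = A 0 i * t ^+ lam i.
Proof.
have sci i : smooth_germ (fun t => std_curve t 0 i).
  exact: (smooth_germ_rVP _).1 smooth_germ_std_curve i.
have H : \forall t \near (0 : R), t *: 'D_1 std_curve t = euler_row (std_curve t).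
  have E1 := smooth_germ_cvg0 ss s0 f_hom.
  have E2 := smooth_germ_cvg0 sfs fs0 near_euler_jac.
  apply: filterS3 (filterI E1 E2) (filterI near_derive_std_curve near_derive_sigma) sK.
  move=> t [{}E1 {}E2] [-> D] tE; rewrite /std_curve -E2 /= -E1 tE !derive1E.
  rewrite -scalemxAl scalerA; congr (_ *: _); congr (t * _).
  (* The derivative of [tau] is nonzero because [tau \o sigma] is the identity near 0, so the
     quotient defining [t d/dt] is a genuine one. *)
  have n0 : 'D_1 tau (sigma t) != 0.
    by apply/eqP => z; move/eqP: D; rewrite z mulr0 eq_sym oner_eq0.
  by apply: (mulIf n0); rewrite D mulVf.
have ex i : exists c, \forall t \near (0 : R), std_curve t 0 i = c * t ^+ lam i.
  apply: euler_line => //.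
  apply: filterS2 H (smooth_germ_differentiable smooth_germ_std_curve) => t Ht dt.
  rewrite derive_coord//; have := congr1 (fun v : Rm => v 0 i) Ht.
  by rewrite /= [LHS]mxE [RHS]mxE.
have [A HA] := choice ex; exists (\row_i A i).
by apply: filterS (near_forall HA) => t At i; rewrite mxE.
Qed.

Definition push_field (X : Rm -> Rm) : Rm -> Rm := fun y => X (h' y) *m jac h (h' y).

Lemma smooth_germ_push_field X : smooth_germ X -> smooth_germ (push_field X).
Proof.
move=> sX; have s1 := smooth_germ_mulmx_jac sX sh.
exact: smooth_germ_comp_rV h'0 sh' s1.
Qed.

Lemma liftable_push_field X : liftable f X -> liftable std_curve (push_field X).
Proof.
move=> [sX [g [sg gX]]]; split; first exact: smooth_germ_push_field.
exists (fun t => g (sigma t) * 'D_1 tau (sigma t)); split.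
  apply: smooth_germM; first exact: (smooth_germ_comp_line s0 ss sg).
  exact: (smooth_germ_comp_line s0 ss (smooth_germ_derive (1 : R) st)).
have E1 := smooth_germ_cvg0 ss s0 gX.
have E2 := smooth_germ_cvg0 sfs fs0 hK.
apply: filterS3 (filterI E1 E2) near_derive_std_curve near_derive_sigma.
move=> t [{}E1 {}E2] Dt D; rewrite derive1E Dt scalerA -mulrA [_ * 'D_1 sigma t]mulrC D mulr1.
by rewrite /push_field /std_curve E2 /= -E1 derive1E scalemxAl.
Qed.

End Curve.

Section HomogeneousField.
Variables (X : Rm -> Rm) (d : R).
Hypothesis X_hom : quasihomogeneous_field lam h h' d X.

Let E := euler_field lam h h'.
Let sE : smooth_germ E := smooth_germ_euler_field.
Let sX : smooth_germ X. Proof. by case: X_hom. Qed.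

(** The bracket relation [[E, X] = d X] evaluated on the coordinate function [h_i], an
    eigenfunction of [E] for the eigenvalue [lam i]. *)
Lemma near_euler_push i : \forall x \near (0 : Rm),
  'D_(E x) (fun y => (X y *m jac h y) 0 i) x =
  ((lam i)%:R + d) * (X x *m jac h x) 0 i.
Proof.
have sj k : smooth_germ (fun y => jac h y k i) := smooth_germ_jac k i sh.
have sXk k : smooth_germ (fun y => X y 0 k) := (smooth_germ_rVP X).1 sX k.
have sEk k : smooth_germ (fun y => E y 0 k) := (smooth_germ_rVP E).1 sE k.
pose H j k x := partial j (fun y => jac h y k i) x.
have along_sum (Y : Rm -> Rm) : smooth_germ Y -> \forall x \near (0 : Rm), forall j,
    partial j (fun y => (Y y *m jac h y) 0 i) x =
    \sum_k (Y x 0 k * H j k x + jac h x k i * partial j (fun y => Y y 0 k) x).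
  move=> sY; apply: near_forall => j.
  have sYk k : smooth_germ (fun y => Y y 0 k) := (smooth_germ_rVP Y).1 sY k.
  have -> : (fun y => (Y y *m jac h y) 0 i) = (fun y => \sum_k Y y 0 k * jac h y k i).
    by apply/funext => y; rewrite mxE.
  have E1 := near_derive_sum predT (basis_vec j) (fun k => smooth_germM (sYk k) (sj k)).
  have E2 := near_forall (fun k => near_deriveM (basis_vec j) (sYk k) (sj k)).
  apply: filterS2 E1 E2 => x E1 E2; apply: (etrans E1); apply: eq_bigr => k _.
  exact: (E2 k).
have HS : \forall x \near (0 : Rm), forall j k, H j k x = H k j x.
  by apply: filterS (near_jac_sym sh) => x S j k; exact: S.
have sq (Y : Rm -> Rm) : smooth_germ Y -> smooth_germ (fun y => (Y y *m jac h y) 0 i).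
  by move=> sY; exact: (smooth_germ_rVP _).1 (smooth_germ_mulmx_jac sY sh) i.
have E_h : \forall x \near (0 : Rm), forall j,
    partial j (fun y => (E y *m jac h y) 0 i) x = (lam i)%:R * jac h x j i.
  apply: near_forall => j.
  have e : \forall y \near (0 : Rm), (E y *m jac h y) 0 i = (lam i)%:R * h y 0 i.
    by apply: filterS near_euler_jac => y ->; rewrite mxE.
  have := near_deriveZ (basis_vec j) (lam i)%:R ((smooth_germ_rVP h).1 sh i).
  apply: filterS2 (near_derive (basis_vec j) e) => x e1 e2.
  by apply: (etrans e1); rewrite e2 mxE.
have [_ br] := X_hom.
have aXn := along_sum X sX; have aEn := along_sum E sE.
have dqn := smooth_germ_differentiable (sq X sX).
have dXn := smooth_germ_differentiable sX; have dEn := smooth_germ_differentiable sE.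
near=> x.
have dq : differentiable (fun y => (X y *m jac h y) 0 i) x by near: x.
have dX : differentiable X x by near: x.
have dE : differentiable E x by near: x.
have S : forall j k, H j k x = H k j x by near: x.
have aX : forall j, partial j (fun y => (X y *m jac h y) 0 i) x =
    \sum_k (X x 0 k * H j k x + jac h x k i * partial j (fun y => X y 0 k) x) by near: x.
have aE : forall j, partial j (fun y => (E y *m jac h y) 0 i) x =
    \sum_k (E x 0 k * H j k x + jac h x k i * partial j (fun y => E y 0 k) x) by near: x.
have Eh : forall j, partial j (fun y => (E y *m jac h y) 0 i) x = (lam i)%:R * jac h x j i.
  by near: x.
have brx : lie_field E X x = d *: X x by near: x.
rewrite derive_rV//.
rewrite (eq_bigr (fun j => \sum_k (E x 0 j * X x 0 k * H j k x +
  jac h x k i * (E x 0 j * partial j (fun y => X y 0 k) x)))); last first.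
  move=> j _; rewrite [X in _ *: X](aX j) /GRing.scale/= mulr_sumr; apply: eq_bigr => k _.
  by move: (H j k x) (partial _ _ _) => *; ring.
(* This is [X] applied to [E(h_i) = lam i * h_i]. Its terms with second derivatives of [h] match
   those of [E(X(h_i))] by symmetry, so the difference is the bracket applied to [h_i]. *)
have XE : (lam i)%:R * (X x *m jac h x) 0 i = \sum_j \sum_k (E x 0 j * X x 0 k * H j k x +
    jac h x j i * (X x 0 k * partial k (fun y => E y 0 j) x)).
  rewrite mxE mulr_sumr exchange_big; apply: eq_bigr => k _.
  rewrite mulrCA -(Eh k) aE mulr_sumr; apply: eq_bigr => j _; rewrite (S k j).
  by move: (H j k x) (partial _ _ _) => *; ring.
rewrite mulrDl XE.
under eq_bigr do rewrite big_split/=.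
under [X in _ = X + _]eq_bigr do rewrite big_split/=.
rewrite !big_split/= -addrA; congr (_ + _).
rewrite exchange_big /= mxE mulr_sumr -big_split/=; apply: eq_bigr => k _.
have := congr1 (fun v : Rm => v 0 k) brx; rewrite /lie_field /= !mxE.
rewrite -derive_coord// derive_rV; last first.
  have [L eL cL] := @rV_coord_linear R m k.
  by have := (differentiable_lincomp 0 cL dX).1; rewrite -eL.
rewrite -derive_coord// [X in _ - X]derive_rV; last first.
  have [L eL cL] := @rV_coord_linear R m k.
  by have := (differentiable_lincomp 0 cL dE).1; rewrite -eL.
move=> /eqP; rewrite subr_eq => /eqP B.
rewrite -!mulr_sumr; have {}B : \sum_j E x 0 j * partial j (fun y => X y 0 k) x =
  d * X x 0 k + \sum_j X x 0 j * partial j (fun y => E y 0 k) x := B.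
rewrite B mulrDr addrC; congr (_ + _).
by rewrite mulrC mulrA.
Unshelve. all: by end_near. Qed.

Lemma whomogeneous_push_field i :
  whomogeneous lam ((lam i)%:R + d) (component (push_field X) i).
Proof.
split; first exact: (smooth_germ_rVP _).1 (smooth_germ_push_field sX) i.
pose q y := (X y *m jac h y) 0 i.
have sq : smooth_germ q := (smooth_germ_rVP _).1 (smooth_germ_mulmx_jac sX sh) i.
have H1 := smooth_germ_cvg0 sh' h'0 (near_euler_push i).
have H2 := smooth_germ_cvg0 sh' h'0 near_euler_field.
have H3 := near_forall (fun j => near_derive_comp (basis_vec j) h'0 sh' sq).
have H4 := smooth_germ_cvg0 sh' h'0 (smooth_germ_differentiable sq).
apply: filterS3 (filterI H1 H2) (filterI H3 H4) h'K => y [{}H1 {}H2] [{}H3 {}H4] yK.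
transitivity ('D_(E (h' y)) q (h' y)); last exact: H1.
rewrite [RHS]derive_rV; last exact: H4.
have L : \sum_j (lam j)%:R * y 0 j * partial j (component (push_field X) i) y =
    \sum_j (lam j)%:R * y 0 j * \sum_l jac h' y j l * partial l q (h' y).
  apply: eq_bigr => j _; apply: (f_equal (fun z => _ * z)); apply: (etrans (H3 j)).
  by apply: eq_bigr => l _; rewrite [jac h' y j l]mxE.
have Ej l : E (h' y) 0 l = \sum_j (lam j)%:R * y 0 j * jac h' y j l.
  rewrite /E H2 yK [LHS]mxE; apply: eq_bigr => j _.
  by apply: (f_equal (fun z => z * _)); rewrite mxE.
have RS : \sum_l E (h' y) 0 l *: 'D_(delta_mx 0 l) q (h' y) =
    \sum_l \sum_j (lam j)%:R * y 0 j * jac h' y j l * partial l q (h' y).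
  by apply: eq_bigr => l _; rewrite Ej; exact: mulr_suml.
apply: (etrans L); apply: (etrans _ (esym RS)); rewrite [RHS]exchange_big.
apply: eq_bigr => j _; rewrite mulr_sumr.
by apply: eq_bigr => l _; rewrite mulrA.
Qed.

(** Contraction commutes with changes of coordinates: the Jacobians of [h] and [h'] are inverse to
    each other and cancel between field and form. *)
Lemma near_contr_push w : \forall y \near (0 : Rm), forall i,
  pullback1 h' (contr X w) i y = contr (push_field X) (pullback h' w) i y.
Proof.
have H := smooth_germ_cvg0 sh' h'0 jac_hh'.
apply: filterS2 H h'K => y J yK i; rewrite yK in J.
have c1 (Z : Rm -> Rm) v z l : contr Z v l z = (Z z *m mx2 v z) 0 l.
  by rewrite /contr mxE; apply: eq_bigr => j _; rewrite [mx2 _ _ _ _]mxE.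
rewrite c1 mx2_pullback /push_field !mulmxA -[_ *m jac h (h' y) *m _]mulmxA J mulmx1.
rewrite /pullback1 [RHS]mxE; apply: eq_bigr => j _.
by rewrite c1 mulrC [(jac h' y)^T _ _]mxE.
Qed.

End HomogeneousField.

End ChangeOfCoordinates.


(** * Transport of the normal form to the given coordinates *)

Theorem theorem6p13 (R : realType) (m : nat)
  (f : R -> 'rV[R]_m)
  (tau : R -> R) (h h' : 'rV[R]_m -> 'rV[R]_m) (lam : 'I_m -> nat)
  (hf : quasihomogeneous_curve f tau h h' lam)
  (p : nat) (a : 'I_p -> kform R m 2) (delta : 'I_p -> nat)
  (ha : closed2_basis f a)
  (hdeg : forall j : 'I_p,
     quasihomogeneous_restriction f lam h h' (delta j) (a j))
  (hmono : forall i j : 'I_p, (i <= j)%N -> (delta i <= delta j)%N)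
  (s : 'I_p)
  (hs : forall j : 'I_p, j = s.+1 :> nat -> (delta s < delta j)%N)
  (c : 'I_p -> R) (hc : c s != 0)
  (k : 'I_p) (hk : (s < k)%N) (r : R) (hr : r != 0)
  (hX : exists (X : 'rV[R]_m -> 'rV[R]_m) (d : R),
     [/\ quasihomogeneous_field lam h h' d X, liftable f X &
         same_restriction f (lie_form X (a s)) (scale_form r (a k))]) :
  exists b : 'I_p -> R,
    diffeomorphic_restrictions f
      (lin_comb (fun j : 'I_p => (s <= j)%N) c a)
      (add_form
         (lin_comb (fun j : 'I_p => (s <= j < k)%N) c a)
         (lin_comb (fun j : 'I_p => (k < j)%N) b a)).
Proof.
have [fc [sigma ts] hh' lam_gt0 f_hom] := hf.
have [X [d [X_hom X_lift Xa]]] := hX.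
have [a_closed a_span a_free] := ha.
have [sf f0] := fc; have [st ss t0 s0 tsK] := ts; have [sh sh' h0 h'0 hK] := hh'.
have sX : smooth_germ X := X_lift.1.
pose F := std_curve h f sigma.
have sF : smooth_germ F := smooth_germ_std_curve hh' fc ts.
have [A FA] := std_curveE hh' fc ts f_hom.
have h'F : \forall t \near (0 : R), h' (F t) = f (sigma t).
  have sfs : smooth_germ (f \o sigma) := smooth_germ_comp_curve s0 ss sf.
  have fs0 : (f \o sigma) 0 = 0 by rewrite /= s0 f0.
  by have := smooth_germ_cvg0 sfs fs0 hK; apply: filterS => t [].
have hf' : \forall t \near (0 : R), h (f t) = F (tau t).
  by apply: filterS tsK => t [tK _]; rewrite /F /std_curve tK.
have hK1 : \forall x \near (0 : 'rV[R]_m), h' (h x) = x by apply: filterS hK => x [].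
have hK2 : \forall x \near (0 : 'rV[R]_m), h (h' x) = x by apply: filterS hK => x [].
have pull_h'h (w : kform R m 2) : \forall x \near (0 : 'rV[R]_m), forall I, pullback h' (pullback h w) x I = w x I.
  have H1 := near_pullback_comp w sh h0 sh' h'0.
  by apply: filterS2 H1 (near_pullback_id w hK2) => x E1 E2 I; rewrite E1 E2.
have pull_hh' (w : kform R m 2) : \forall x \near (0 : 'rV[R]_m), forall I, pullback h (pullback h' w) x I = w x I.
  have H1 := near_pullback_comp w sh' h'0 sh h0.
  by apply: filterS2 H1 (near_pullback_id w hK1) => x E1 E2 I; rewrite E1 E2.
have down (w1 w2 : kform R m 2) : same_restriction f w1 w2 -> same_restriction F (pullback h' w1) (pullback h' w2).
  exact: same_restriction_pullback sh' h'0 ss s0 h'F.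
have up (w1 w2 : kform R m 2) : same_restriction F w1 w2 -> same_restriction f (pullback h w1) (pullback h w2).
  exact: same_restriction_pullback sh h0 st t0 hf'.
pose a' j := pullback h' (a j).
have a'_closed j : closed_form (a' j) := closed_form_pullback sh' h'0 (a_closed j).
have a'_form j : form_germ (a' j) := (a'_closed j).1.
have comb_down (P : pred 'I_p) (e : 'I_p -> R) x I :
    pullback h' (lin_comb P e a) x I = lin_comb P e a' x I by exact: pullback_sum.
have comb_up (P : pred 'I_p) (e : 'I_p -> R) : \forall x \near (0 : 'rV[R]_m), forall I,
    pullback h (lin_comb P e a') x I = lin_comb P e a x I.
  have -> : lin_comb P e a' = pullback h' (lin_comb P e a).
    by apply/funext => x; apply/funext => I; rewrite comb_down.
  exact: pull_hh'.
have a'_free e : same_restriction F (lin_comb predT e a') (@zero_form R m 2) -> forall j, e j = 0.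
  move=> /up H; apply: a_free; apply: same_restriction_trans (same_restriction_trans _ H) _.
    apply: same_restriction_sym; exact: same_restriction_near.
  apply: same_restriction_near; apply: near0W => x I.
  by rewrite /pullback big1// => J _; rewrite mulr0.
have a'_span eta : smooth1 eta -> exists e, same_restriction F (dform eta) (lin_comb predT e a').
  move=> seta; have sp := smooth1_pullback1 sh h0 seta.
  have [e /down He] := a_span _ (closed_dform sp); exists e.
  have -> : lin_comb predT e a' = pullback h' (lin_comb predT e a).
    by apply/funext => x; apply/funext => I; rewrite comb_down.
  apply: same_restriction_trans He; apply: same_restriction_near.
  have E1 := near_pullback_ext sh' h'0 (near_dform_pullback1 sh h0 seta).
  by apply: filterS2 E1 (pull_h'h (dform eta)) => x E1 E2 I; rewrite E1 E2.
have potential j : exists E, [/\ smooth1 E,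
    forall l, whomogeneous lam ((delta j)%:R - (lam l)%:R) (E l) &
    same_restriction F (a' j) (dform E)].
  have [E [sE hE EE]] := std_quasi_part_potential lam_gt0 (delta j) (a'_closed j).
  (* [quasi_part] is itself a pullback by [h] of a standard part, so pulling back by [h'] leaves the
     standard part of [a' j], which has a homogeneous primitive. *)
  exists E; split=> //; apply: same_restriction_trans (down _ _ (hdeg j)) _.
  apply: same_restriction_near.
  by apply: filterS2 (pull_h'h (std_quasi_part lam (delta j) (a' j))) EE => x E1 E2 I;
    rewrite E1 E2.
have [E HE] := choice potential.
have E_hom j l : whomogeneous lam ((delta j)%:R - (lam l)%:R) (E j l).
  by have [_ + _] := HE j; apply.
have aE j : same_restriction F (a' j) (dform (E j)) by have [] := HE j.
have Xa' : same_restriction F (dform (contr (push_field h h' X) (a' s))) (scale_form r (a' k)).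
  have := down _ _ Xa => H; apply: same_restriction_trans (same_restriction_trans _ H) _.
    apply: same_restriction_sym; apply: same_restriction_near.
    have E1 := near_pullback_ext sh' h'0 (near_lie_form_closed sX (a_closed s)).
    have E2 := near_dform_pullback1 sh' h'0 (smooth1_contr sX (a_closed s).1).
    have E3 := near_dform_ext (near_contr_push hh' X (a s)).
    by apply: filterS3 E1 E2 E3 => x E1 E2 E3 I; rewrite E1 -E2 E3.
  apply: same_restriction_near; apply: near0W => x I.
  by rewrite /scale_form /a' /pullback mulr_sumr; apply: eq_bigr => J _; rewrite mulrCA.
(* The strict jump is assumed between [s] and its successor only; monotonicity propagates it to all
   later indices. *)
have delta_s (j : 'I_p) : (s < j)%N -> (delta s < delta j)%N.
  move=> sj; have s1p : (s.+1 < p)%N := leq_ltn_trans sj (ltn_ord j).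
  exact: leq_trans (hs (Ordinal s1p) erefl) (hmono (Ordinal s1p) j sj).
have [Phi [psi [b [[Phi' dPhi] [psi' dpsi] Phi_f H]]]] := normal_form_standard lam_gt0 sF FA
  E_hom aE a'_form a'_free a'_span hmono hk delta_s hc hr
  (liftable_push_field hh' fc ts X_lift) (whomogeneous_push_field hh' X_hom) Xa'.
have [sPhi _ Phi0 _ _] := dPhi; have [_ sp' _ p'0 psiK] := dpsi.
have ih' := inverse_germsC hh'.
(* The inverse [psi'] appears because the definition asks for [Phi (f (phi t)) = f t], while the
   normal form provides [Phi (F t) = F (psi t)]. *)
exists b, (h' \o Phi \o h), (sigma \o psi' \o tau); split.
- exists (h' \o Phi' \o h).
  exact: inverse_germs_comp_rV (inverse_germs_comp_rV hh' dPhi) ih'.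
- exists (sigma \o psi \o tau).
  exact: inverse_germs_comp_line (inverse_germs_comp_line ts (inverse_germsC dpsi)) (inverse_germsC ts).
- have sc : smooth_germ (psi' \o tau) := smooth_germ_comp_line t0 st sp'.
  have c0 : (psi' \o tau) 0 = 0 by rewrite /= t0 p'0.
  have sc2 : smooth_germ (sigma \o (psi' \o tau)) := smooth_germ_comp_line c0 sc ss.
  have c20 : (sigma \o (psi' \o tau)) 0 = 0 by rewrite /= t0 p'0 s0.
  have E1 := smooth_germ_cvg0 sc2 c20 hf'.
  have E2 := smooth_germ_cvg0 sc c0 tsK.
  have E3 := smooth_germ_cvg0 sc c0 Phi_f.
  have E4 := smooth_germ_cvg0 st t0 psiK.
  have E5 := smooth_germ_cvg0 sf f0 hK1.
  apply: filterS3 (filterI E1 E2) (filterI E3 E4) (filterI E5 hf') => t.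
  move=> [{}E1 [_ {}E2]] [{}E3 [_ {}E4]] [{}E5 {}E6] /=.
  rewrite /= in E1 E2 E3; rewrite E1 E2 E3 E4 -E6.
  exact: E5.
- apply: same_restriction_trans (same_restriction_trans _ (up _ _ H)) _.
    apply: same_restriction_near.
    set w := lin_comb _ c a.
    have -> : lin_comb (fun j : 'I_p => (s <= j)%N) c a' = pullback h' w.
      by apply/funext => x; apply/funext => I; rewrite comb_down.
    have E1 := near_pullback_ext sh h0 (near_pullback_comp w sh' h'0 sPhi Phi0).
    have sc : smooth_germ (h' \o Phi) := smooth_germ_comp_rV Phi0 sPhi sh'.
    have c0 : (h' \o Phi) 0 = 0 by rewrite /= Phi0.
    have E2 := near_pullback_comp w sc c0 sh h0.
    by apply: filterS2 E1 E2 => x E1 E2 I; rewrite E1 E2.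
  apply: same_restriction_near.
  apply: filterS2 (comb_up (fun j : 'I_p => (s <= j < k)%N) c)
    (comb_up (fun j : 'I_p => (k < j)%N) b) => x E1 E2 I.
  rewrite /add_form -E1 -E2 /pullback -big_split; apply: eq_bigr => J _ /=.
  by rewrite mulrDr.
Qed.
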